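(* Let $n\ge 2$ and let $\Omega\subset\mathbb{C}^n$ be a bounded, balanced, convex and homogeneous domain. Let $G$ be a subdomain of $\Omega$ that is relatively compact in $\Omega$ and such that the pseudoconvex but not Levi flat points are dense in $\partial G$. Let $K\subset\partial G$ be a nonempty (relatively) open subset of $\partial G$. If $D=\Omega\setminus\overline{K}$ is connected, then for every $z\in D$, $$s_D^\Omega(z)=\tilde e^{\Omega}_D(z)=d_{c_\Omega}^{\overline K}(z).$$
   Context: A domain $\Omega\subset\mathbb{C}^n$ is balanced if $\lambda z\in\Omega$ whenever $z\in\Omega$, $\lambda\in\mathbb{C}$, $|\lambda|\le 1$; it is homogeneous if its group of holomorphic automorphisms acts transitively. Let $\mathbb{D}$ be the unit disk in $\mathbb{C}$ and $O(X,Y)$ the set of holomorphic maps from $X$ into $Y$. A point $Q\in\partial G$ is a pseudoconvex but not Levi flat point if, near $Q$, $G=\{\rho<0\}$ for a local $C^2$ defining function $\rho$ (with $d\rho\ne0$), and the Levi form $\sum_{j,k}\frac{\partial^2\rho}{\partial z_j\partial\bar z_k}(Q)v_j\bar v_k$ is $\ge 0$ for all $v\in\mathbb{C}^n$ with $\sum_j\frac{\partial\rho}{\partial z_j}(Q)v_j=0$ and is $>0$ for at least one such $v$. Carathéodory pseudodistance on a domain $D$: $c_D(z,w)=\sup\{\tanh^{-1}|\lambda| : f\in O(D,\mathbb{D}),\ f(z)=0,\ f(w)=\lambda\}$; its balls are $B^c_D(z,r)=\{w\in D: c_D(z,w)<r\}$. For a nonempty compact $S\subset\Omega$ and $z\in\Omega\setminus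 S$, put $d_{c_\Omega}^{S}(z)=\min_{w\in S}\tanh[c_\Omega(z,w)]$. Generalized squeezing function: with the Minkowski function $\rho_\Omega(z)=\inf\{t>0: z/t\in\Omega\}$, for a bounded domain $D\subset\mathbb{C}^n$ and $z\in D$, $$s_D^\Omega(z)=\sup\{r>0:\ \{w\in\mathbb{C}^n:\rho_\Omega(w)<r\}\subset f(D)\ \text{for some injective } f\in O(D,\Omega)\text{ with } f(z)=0\}.$$ Fridman invariant (with respect to the Carathéodory pseudodistance): $$\tilde e^{\Omega}_D(z)=\sup\{\tanh(r):\ B^c_D(z,r)\subset f(\Omega)\ \text{for some injective } f\in O(\Omega,D)\}.$$ *)

(* Defs.v *)
From HB Require Import structures.
From mathcomp Require Import all_boot all_order all_algebra.
From mathcomp Require Import complex.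
From mathcomp Require Import all_classical all_reals all_analysis.

Set Implicit Arguments.
Unset Strict Implicit.
Unset Printing Implicit Defensive.

Import Order.TTheory GRing.Theory Num.Theory.
Import numFieldNormedType.Exports.

Local Open Scope classical_set_scope.
Local Open Scope complex_scope.
Local Open Scope ring_scope.

(* R[i] with its norm topology, as a normed module over itself; 'rV[R[i]]_n
   then inherits the sup norm, whose topology is the usual one of C^n. *)
#[warnings="-redundant-canonical-projection"]
HB.instance Definition _ (R : rcfType) := NormedModule.copy R[i] R[i]^o.

Definition domain (T : topologicalType) (A : set T) : Prop :=
  [/\ open A, connected A & A !=set0].

Definition boundary (T : topologicalType) (A : set T) : set T :=
  closure A `\` interior A.

Definition relatively_open (T : topologicalType) (A B : set T) : Prop :=
  exists2 V : set T, open V & A = B `&` V.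

(* O(X, Y), for X open: differentiability over the complex field.  Only the
   values of f on X matter. *)
Definition holo (R : realType) (V W : normedModType R[i])
    (X : set V) (Y : set W) : set (V -> W) :=
  [set f | forall z, X z -> Y (f z) /\ differentiable f z].

Definition unit_disk (R : realType) : set R[i] := [set l | `|l| < 1].

Definition balanced (R : realType) (n : nat) (Omega : set 'rV[R[i]]_n) : Prop :=
  forall (l : R[i]) z, `|l| <= 1 -> Omega z -> Omega (l *: z).

Definition automorphism (R : realType) (n : nat) (Omega : set 'rV[R[i]]_n) :
    set ('rV[R[i]]_n -> 'rV[R[i]]_n) :=
  [set phi | exists psi : 'rV[R[i]]_n -> 'rV[R[i]]_n,
    [/\ holo Omega Omega phi, holo Omega Omega psi,
        forall z, Omega z -> psi (phi z) = z
      & forall z, Omega z -> phi (psi z) = z]].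

Definition homogeneous (R : realType) (n : nat) (Omega : set 'rV[R[i]]_n) :
    Prop :=
  forall z w, Omega z -> Omega w ->
    exists2 phi, automorphism Omega phi & phi z = w.

(* The derivative at t = 0 of the function t |-> f (z + t v) of the real
   variable t, and the standard basis of C^n as a real vector space. *)
Definition real_partial (R : realType) (n : nat) (v : 'rV[R[i]]_n)
    (f : 'rV[R[i]]_n -> R) (z : 'rV[R[i]]_n) : R :=
  derive1 (fun t : R => f (z + t%:C *: v)) 0.

Definition real_basis (R : realType) (n : nat) : set 'rV[R[i]]_n :=
  [set v | exists j, v = delta_mx 0 j \/ v = 'i%C *: delta_mx 0 j].

Fixpoint class_C (R : realType) (n : nat) (k : nat) (U : set 'rV[R[i]]_n)
    (f : 'rV[R[i]]_n -> R) : Prop :=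
  (forall z, U z -> {for z, continuous f}) /\
  if k is k'.+1 then
    forall v, real_basis v ->
      (forall z, U z -> derivable (fun t : R => f (z + t%:C *: v)) 0 1) /\
      class_C k' U (real_partial v f)
  else True.

Definition complex_partial (R : realType) (n : nat) (v : 'rV[R[i]]_n)
    (f : 'rV[R[i]]_n -> R[i]) (z : 'rV[R[i]]_n) : R[i] :=
  (real_partial v (fun w => complex.Re (f w)) z +i*
   real_partial v (fun w => complex.Im (f w)) z)%C.

(* Wirtinger derivatives d/dz_j = (d/dx_j - i d/dy_j) / 2 and
   d/dzbar_j = (d/dx_j + i d/dy_j) / 2. *)
Definition d_z (R : realType) (n : nat) (j : 'I_n)
    (f : 'rV[R[i]]_n -> R[i]) (z : 'rV[R[i]]_n) : R[i] :=
  (complex_partial (delta_mx 0 j) f z -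
   'i%C * complex_partial ('i%C *: delta_mx 0 j) f z) / 2.

Definition d_zbar (R : realType) (n : nat) (j : 'I_n)
    (f : 'rV[R[i]]_n -> R[i]) (z : 'rV[R[i]]_n) : R[i] :=
  (complex_partial (delta_mx 0 j) f z +
   'i%C * complex_partial ('i%C *: delta_mx 0 j) f z) / 2.

Definition levi_form (R : realType) (n : nat) (rho : 'rV[R[i]]_n -> R)
    (Q v : 'rV[R[i]]_n) : R[i] :=
  \sum_(j < n) \sum_(k < n)
    d_z j (d_zbar k (fun w => (rho w)%:C)) Q * v 0 j * (v 0 k)^*%C.

Definition complex_tangent (R : realType) (n : nat) (rho : 'rV[R[i]]_n -> R)
    (Q : 'rV[R[i]]_n) : set 'rV[R[i]]_n :=
  [set v | \sum_(j < n) d_z j (fun w => (rho w)%:C) Q * v 0 j = 0].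

Definition local_defining_function (R : realType) (n : nat)
    (G U : set 'rV[R[i]]_n) (rho : 'rV[R[i]]_n -> R) : Prop :=
  [/\ class_C 2 U rho,
      G `&` U = [set z | U z /\ rho z < 0]
    & forall z, U z -> exists2 v, real_basis v & real_partial v rho z != 0].

(* The order on R[i] is 0 <= x iff x is a nonnegative real number; the Levi
   form of a real C^2 function takes real values. *)
Definition pseudoconvex_not_levi_flat (R : realType) (n : nat)
    (G : set 'rV[R[i]]_n) : set 'rV[R[i]]_n :=
  [set Q | boundary G Q /\
    exists (U : set 'rV[R[i]]_n) (rho : 'rV[R[i]]_n -> R),
      [/\ open U, U Q, local_defining_function G U rho,
          forall v, complex_tangent rho Q v -> 0 <= levi_form rho Q v
        & exists2 v, complex_tangent rho Q v & 0 < levi_form rho Q v]].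

Definition tanh (R : realType) (x : R) : R :=
  (expR x - expR (- x)) / (expR x + expR (- x)).

Definition atanh (R : realType) (x : R) : R := ln ((1 + x) / (1 - x)) / 2.

Definition etanh (R : realType) (x : \bar R) : R :=
  match x with
  | EFin r => tanh r
  | EPInf => 1
  | ENInf => -1
  end.

(* As a supremum in the extended reals; it is finite when D is a domain, so the
   values of etanh at the infinities are mere limit conventions. *)
Definition caratheodory (R : realType) (n : nat) (D : set 'rV[R[i]]_n)
    (z w : 'rV[R[i]]_n) : \bar R :=
  ereal_sup [set x | exists2 f, holo D (@unit_disk R) f &
    f z = 0 /\ x = (atanh (complex.Re `|f w|))%:E].

Definition caratheodory_ball (R : realType) (n : nat) (D : set 'rV[R[i]]_n)
    (z : 'rV[R[i]]_n) (r : R) : set 'rV[R[i]]_n :=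
  [set w | D w /\ (caratheodory D z w < r%:E)%E].

(* For S nonempty and compact in the domain Omega the infimum is a minimum. *)
Definition caratheodory_dist (R : realType) (n : nat)
    (Omega S : set 'rV[R[i]]_n) (z : 'rV[R[i]]_n) : R :=
  inf [set etanh (caratheodory Omega z w) | w in S].

Definition minkowski (R : realType) (n : nat) (Omega : set 'rV[R[i]]_n)
    (z : 'rV[R[i]]_n) : R :=
  inf [set t : R | 0 < t /\ Omega ((t%:C)^-1 *: z)].

Definition squeezing (R : realType) (n : nat) (Omega D : set 'rV[R[i]]_n)
    (z : 'rV[R[i]]_n) : R :=
  sup [set r : R | 0 < r /\
    exists f, [/\ holo D Omega f, set_inj D f, f z = 0
      & [set w | minkowski Omega w < r] `<=` f @` D]].

Definition fridman (R : realType) (n : nat) (Omega D : set 'rV[R[i]]_n)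
    (z : 'rV[R[i]]_n) : R :=
  sup [set x : R | exists r : R, [/\ 0 < r, x = tanh r &
    exists f, [/\ holo Omega D f, set_inj Omega f
      & caratheodory_ball D z r `<=` f @` Omega]]].

(* Main.v *)
Require Import Defs.
From HB Require Import structures.
From mathcomp Require Import all_boot all_order all_algebra.
From mathcomp Require Import complex.
From mathcomp Require Import all_classical all_reals all_analysis.
From mathcomp Require Import ring lra zify.
Import Order.TTheory GRing.Theory Num.Theory.
Import numFieldNormedType.Exports.
Local Open Scope classical_set_scope.
Local Open Scope complex_scope.
Local Open Scope ring_scope.

Set Implicit Arguments.
Unset Strict Implicit.
Unset Printing Implicit Defensive.

(** Write [d] for the Caratheodory distance of [z] to [L = closure K], and let
    [phi] be an automorphism of [Omega] with [phi z = 0].  The Minkowski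
    function [rho] of [Omega] is a norm, and by the Schwarz lemma
    [tanh (c_Omega (z, w)) = rho (phi w)].

    Lower bounds: [phi] itself is a competitor for the squeezing function, and
    [u |-> phi^-1 (d u)] one for the Fridman invariant.

    A Hartogs extension theorem, by Cauchy integrals over the circles
    [l |-> l z], extends every holomorphic [D -> Omega] to [Omega -> Omega].
    Hence [c_D = c_Omega] on [D].  Moreover, if [f : D -> Omega] is injective,
    [f z = 0] and [f D] contains [{rho < r}] with [r > d], then at a point [w0]
    of [L] nearest to [z] the extension of [f] takes a value [f w'] with [w'] in
    [D]; injective holomorphic maps being open (Osgood), [f] takes values near
    [f w'] twice, since [L] has empty interior.

    If [f : Omega -> D] is injective and its image contains [B^c_D (z, r)] with
    [tanh r > d], then the image contains [W \ L] for a neighbourhood [W] of a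
    point [Q] of [K] where the Levi form has a positive eigenvalue.  A family of
    analytic discs outside [closure G] shrinks to [Q], and the maximum principle
    for [rho \o f^-1] along the discs forces [Q] into the image of [f]. *)

(** * Norms and complex differentiability *)

(** The circles [l |-> l z] degenerate at the origin, so the base point is first moved to 0: then 0
    lies off the image of the hole, and an extension known only away from 0 suffices. Cauchy's
    formula on an annulus writes [f] as an outer mean minus an inner mean, and needs [f] only on the
    shell between a level of [rho] enclosing the hole and the boundary of [Omega]. The inner mean is
    where [n >= 2] enters: through every point of the shell passes a complex line that misses the
    hole, along which the inner mean is an entire function tending to 0. Connectedness of [D]
    carries the agreement from the shell to all of [D]. Vector-valued maximum principles and the
    Schwarz lemma reduce to scalar ones through linear forms bounded by [rho], which convexity
    supplies. In the Fridman part the discs, indexed by [t >= 0], touch [L] only at the centre of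
    the disc [t = 0]. Their boundary circles, [t = 0] included, form a compact set off [L]; hence
    their lifts stay below a level [q < 1] of [rho], and so do the lifted centres as [t] tends to
    0. *)

Section RealNorm.
Context {R : realType}.
Local Notation C := R[i].

(** The norm of a normed module over [R[i]] takes values in [R[i]]; its real part carries the same
    information and lives in the ordered field [R]. *)
Definition nrm (V : normedModType C) (v : V) : R := complex.Re `|v|.

Section Norm.
Context {V : normedModType C}.
Implicit Types u v w : V.

Lemma nrmE v : `|v| = (nrm v)%:C.
Proof. by rewrite /nrm RRe_real// ger0_real. Qed.

Lemma nrm_ge0 v : 0 <= nrm v.
Proof. by rewrite -ler0c -nrmE. Qed.

Lemma nrm0 : nrm (0 : V) = 0.
Proof. by rewrite /nrm normr0. Qed.

Lemma nrm_eq0 v : (nrm v == 0) = (v == 0).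
Proof. by rewrite -(inj_eq (@complexI R)) -nrmE normr_eq0. Qed.

Lemma nrm_gt0 v : (0 < nrm v) = (v != 0).
Proof. by rewrite lt_neqAle nrm_ge0 andbT eq_sym nrm_eq0. Qed.

Lemma nrmD u v : nrm (u + v) <= nrm u + nrm v.
Proof. by rewrite -lecR rmorphD/= -!nrmE ler_normD. Qed.

Lemma nrmN v : nrm (- v) = nrm v.
Proof. by rewrite /nrm normrN. Qed.

Lemma nrmBC u v : nrm (u - v) = nrm (v - u).
Proof. by rewrite -nrmN opprB. Qed.

Lemma nrmB u v : nrm (u - v) <= nrm u + nrm v.
Proof. by rewrite -[nrm v]nrmN nrmD. Qed.

Lemma nrmBD w u v : nrm (u - v) <= nrm (u - w) + nrm (w - v).
Proof. by rewrite -[u - v](subrKA w) nrmD. Qed.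

Lemma nrm_lerB u v : nrm u - nrm v <= nrm (u - v).
Proof. by rewrite lerBlDr -{1}[u](subrK v) nrmD. Qed.

Lemma nrm_lerD u v : nrm u - nrm v <= nrm (u + v).
Proof. by rewrite -[v]opprK nrmN nrm_lerB. Qed.

Lemma nrmZ (l : C) v : nrm (l *: v) = nrm l * nrm v.
Proof. by apply: (@complexI R); rewrite rmorphM/= -!nrmE normrZ. Qed.

End Norm.

Lemma nrmM (a b : C) : nrm (a * b) = nrm a * nrm b.
Proof. by apply: (@complexI R); rewrite rmorphM/= -!nrmE normrM. Qed.

Lemma nrm1 : nrm (1 : C) = 1.
Proof. by rewrite /nrm normr1. Qed.

Lemma nrmX (a : C) n : nrm (a ^+ n) = nrm a ^+ n.
Proof. by elim: n => [|n IH]; rewrite ?expr0 ?nrm1// !exprS nrmM IH. Qed.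

Lemma nrmV (a : C) : nrm (a^-1) = (nrm a)^-1.
Proof. by apply: (@complexI R); rewrite fmorphV/= -!nrmE normfV. Qed.

Lemma nrm_real (x : R) : nrm (x%:C : C) = `|x|.
Proof. by rewrite /nrm normc_def/= expr0n addr0 sqrtr_sqr. Qed.

Lemma nrm_pos (x : R) : 0 <= x -> nrm (x%:C : C) = x.
Proof. by move=> x0; rewrite nrm_real ger0_norm. Qed.

Lemma nrm_i : nrm ('i%C : C) = 1.
Proof. by rewrite /nrm normc_def/= expr0n expr1n add0r sqrtr1. Qed.

Lemma nrm_Re (a : C) : `|complex.Re a| <= nrm a.
Proof. by rewrite -lecR -nrmE normc_ge_Re. Qed.

Lemma nrm_Im (a : C) : `|complex.Im a| <= nrm a.
Proof. by have := nrm_Re (a * 'i%C); rewrite ReiNIm normrN nrmM nrm_i mulr1. Qed.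

Lemma nrm_sqr (a : C) : nrm a ^+ 2 = complex.Re a ^+ 2 + complex.Im a ^+ 2.
Proof.
by rewrite /nrm normc_def/= sqr_sqrtr// addr_ge0// sqr_ge0.
Qed.

Lemma nrm_le_ReIm (a : C) : nrm a <= `|complex.Re a| + `|complex.Im a|.
Proof.
rewrite -(@ler_pXn2r _ 2)// ?nnegrE ?nrm_ge0 ?addr_ge0// nrm_sqr sqrrD.
by rewrite !real_normK ?num_real// lerD2r lerDl mulrn_wge0// mulr_ge0.
Qed.

(** Multiplying by the unimodular [c] turns a bound on a real part into a bound on a modulus;
    integrals, mean values and separating forms all use it. *)
Lemma normc_rotate (a : C) : exists2 c : C, nrm c = 1 & c * a = (nrm a)%:C.
Proof.
have [->|a0] := eqVneq a 0; first by exists 1; rewrite ?nrm1// mulr0 nrm0.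
have na : nrm a != 0 by rewrite nrm_eq0.
exists (a^-1 * (nrm a)%:C); last by rewrite mulrAC mulVf// mul1r.
by rewrite nrmM nrmV nrm_pos ?nrm_ge0// mulVf.
Qed.

End RealNorm.

Section Topology.
Context {R : realType}.
Local Notation C := R[i].

Lemma nbhs_nrm (V : normedModType C) (z : V) (A : set V) :
  nbhs z A <-> exists2 e : R, 0 < e & forall w, nrm (w - z) < e -> A w.
Proof.
split=> [/nbhs_normP[e /= e0 h]|[e e0 h]].
  have er : e = (complex.Re e)%:C by rewrite RRe_real// gtr0_real.
  exists (complex.Re e) => [|w hw]; first by rewrite -ltcR -er.
  by apply: h; rewrite /= distrC nrmE er ltcR.
apply/nbhs_normP; exists (e%:C) => /=; first by rewrite ltcR.
by move=> w /=; rewrite distrC nrmE ltcR => /h.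
Qed.

Lemma open_nrm (V : normedModType C) (A : set V) :
  open A <-> forall z, A z ->
    exists2 e : R, 0 < e & forall w, nrm (w - z) < e -> A w.
Proof.
rewrite openE; split=> h z Az; first by apply/nbhs_nrm; exact: h.
by apply/nbhs_nrm; exact: h.
Qed.

Lemma nbhsR (z : R) (A : set R) :
  nbhs z A <-> exists2 e : R, 0 < e & forall w, `|w - z| < e -> A w.
Proof.
split=> [/nbhs_normP[e /= e0 h]|[e e0 h]].
  by exists e => // w hw; apply: h; rewrite /= distrC.
by apply/nbhs_normP; exists e => //= w; rewrite /= distrC => /h.
Qed.

Lemma continuous_nrm (V W : normedModType C) (f : V -> W) (z : V) :
  {for z, continuous f} <-> forall e : R, 0 < e ->
    exists2 d : R, 0 < d & forall w, nrm (w - z) < d -> nrm (f w - f z) < e.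
Proof.
split=> [h e e0|h A /nbhs_nrm[e e0 he]].
  have /h/nbhs_nrm[d d0 hd] : nbhs (f z) [set y | nrm (y - f z) < e].
    by apply/nbhs_nrm; exists e.
  by exists d => // w /hd.
have [d d0 hd] := h e e0.
by apply/nbhs_nrm; exists d => // w hw; apply: he; apply: hd.
Qed.

Lemma continuousR_nrm (W : normedModType C) (f : R -> W) (z : R) :
  {for z, continuous f} <-> forall e : R, 0 < e ->
    exists2 d : R, 0 < d & forall w, `|w - z| < d -> nrm (f w - f z) < e.
Proof.
split=> [h e e0|h A /nbhs_nrm[e e0 he]].
  have /h/nbhsR[d d0 hd] : nbhs (f z) [set y | nrm (y - f z) < e].
    by apply/nbhs_nrm; exists e.
  by exists d => // w /hd.
have [d d0 hd] := h e e0.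
by apply/nbhsR; exists d => // w hw; apply: he; apply: hd.
Qed.

Lemma continuous_nrmR (V : normedModType C) (f : V -> R) (z : V) :
  {for z, continuous f} <-> forall e : R, 0 < e ->
    exists2 d : R, 0 < d & forall w, nrm (w - z) < d -> `|f w - f z| < e.
Proof.
split=> [h e e0|h A /nbhsR[e e0 he]].
  have /h/nbhs_nrm[d d0 hd] : nbhs (f z) [set y | `|y - f z| < e].
    by apply/nbhsR; exists e.
  by exists d => // w /hd.
have [d d0 hd] := h e e0.
by apply/nbhs_nrm; exists d => // w hw; apply: he; apply: hd.
Qed.

Lemma continuousR (f : R -> R) (z : R) :
  {for z, continuous f} <-> forall e : R, 0 < e ->
    exists2 d : R, 0 < d & forall w, `|w - z| < d -> `|f w - f z| < e.
Proof.
split=> [h e e0|h A /nbhsR[e e0 he]].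
  have /h/nbhsR[d d0 hd] : nbhs (f z) [set y | `|y - f z| < e].
    by apply/nbhsR; exists e.
  by exists d => // w /hd.
have [d d0 hd] := h e e0.
by apply/nbhsR; exists d => // w hw; apply: he; apply: hd.
Qed.

Lemma nrm_continuous (V : normedModType C) : continuous (@nrm R V).
Proof.
move=> z; apply/continuous_nrmR => e e0; exists e => // w hw.
apply: le_lt_trans hw; rewrite ler_norml nrm_lerB andbT lerNl opprB nrmBC.
exact: nrm_lerB.
Qed.

Lemma Re_continuous : continuous (@complex.Re R : C -> R).
Proof.
move=> z; apply/continuous_nrmR => e e0; exists e => // w.
by apply: le_lt_trans; rewrite -raddfB nrm_Re.
Qed.

Lemma Im_continuous : continuous (@complex.Im R : C -> R).
Proof.
move=> z; apply/continuous_nrmR => e e0; exists e => // w.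
by apply: le_lt_trans; rewrite -raddfB nrm_Im.
Qed.

Lemma real_complex_continuous : continuous (fun x : R => x%:C : C).
Proof.
move=> z; apply/continuousR_nrm => e e0; exists e => // w.
by rewrite -rmorphB nrm_real.
Qed.

Lemma differentiable_nrm (V W : normedModType C) (f : V -> W) (z : V) :
  differentiable f z -> forall e : R, 0 < e ->
  exists2 d : R, 0 < d & forall h, nrm h < d ->
    nrm (f (z + h) - f z - 'd f z h) <= e * nrm h.
Proof.
move=> /diff_locallyP[_ hf] e e0.
have /eqaddoP/(_ e%:C) := hf; rewrite ltcR => /(_ e0)/nbhs_nrm[d d0 hd].
exists d => // h hh; have := hd h; rewrite subr0 => /(_ hh) /=.
rewrite [X in `|X|](_ : _ = f (z + h) - f z - 'd f z h); last first.
  by rewrite !fctE /= [h + z]addrC opprD addrA.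
by rewrite !nrmE -rmorphM lecR.
Qed.

Lemma diff_bounded (V W : normedModType C) (f : V -> W) (z : V) :
  differentiable f z ->
  exists2 K : R, 0 < K & forall h, nrm ('d f z h) <= K * nrm h.
Proof.
move=> /diff_locallyP[hc _].
have /continuous_nrm/(_ 1 ltr01)[d d0 hd] := hc 0.
exists (2 / d); first by rewrite divr_gt0.
move=> h; have [->|h0] := eqVneq h 0; first by rewrite linear0 !nrm0 mulr0.
have nh : 0 < nrm h by rewrite nrm_gt0.
pose k := d / (2 * nrm h).
have k0 : 0 < k by rewrite divr_gt0// mulr_gt0.
have nk : nrm (k%:C : C) = k by rewrite nrm_pos// ltW.
have kh : k * nrm h = d / 2 by rewrite /k; field; rewrite gt_eqF.
have dd : d / 2 < d by rewrite ltr_pdivrMr// mulr_natr mulr2n ltrDl.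
have := hd (k%:C *: h); rewrite subr0 linear0 subr0 linearZ/= !nrmZ nk kh.
move=> /(_ dd)/ltW; rewrite -ler_pdivlMl//; move=> /le_trans; apply.
by rewrite mulr1 /k invf_div mulrAC.
Qed.

Lemma nrm_differentiable (V W : normedModType C) (f : V -> W) (z : V)
    (L : {linear V -> W}) (K : R) :
  (forall h, nrm (L h) <= K * nrm h) ->
  (forall e : R, 0 < e -> exists2 d : R, 0 < d & forall h, nrm h < d ->
    nrm (f (z + h) - f z - L h) <= e * nrm h) ->
  differentiable f z /\ 'd f z = L :> (V -> W).
Proof.
move=> hK hf.
have Lc : continuous L.
  move=> x; apply/continuous_nrm => e e0.
  have K0 : 0 < `|K| + 1 by rewrite ltr_wpDl.
  exists (e / (`|K| + 1)) => [|w]; first by rewrite divr_gt0.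
  rewrite -linearB ltr_pdivlMr//; apply: le_lt_trans.
  apply: (le_trans (hK _)); rewrite mulrC ler_wpM2l ?nrm_ge0//.
  by rewrite (le_trans (ler_norm _))// lerDl.
have dE : f \o shift z = cst (f z) + L +o_0 id.
  apply/eqaddoP => e e0.
  have er : e = (complex.Re e)%:C by rewrite RRe_real// gtr0_real.
  have re0 : 0 < complex.Re e by rewrite -ltcR -er.
  have [d d0 hd] := hf _ re0; apply/nbhs_nrm; exists d => // h.
  rewrite subr0 => /hd.
  rewrite [X in nrm X](_ : _ = (f \o shift z - (cst (f z) + L)) h); last first.
    by rewrite !fctE /= [z + h]addrC opprD addrA.
  by rewrite er !nrmE -rmorphM lecR.
have dL := diff_unique Lc dE.
by split=> //; apply/diff_locallyP; rewrite dL.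
Qed.

Lemma differentiable_cts (V W : normedModType C) (f : V -> W) z :
  differentiable f z -> {for z, continuous f}.
Proof. exact: differentiable_continuous. Qed.

Lemma near_nrm (V : normedModType C) (P : V -> Prop) (z : V) (e : R) :
  0 < e -> (forall w, nrm (w - z) < e -> P w) -> \forall w \near z, P w.
Proof. by move=> e0 h; apply/nbhs_nrm; exists e. Qed.

Lemma differentiable_eq_near (V W : normedModType C) (f g : V -> W) z :
  (\forall w \near z, f w = g w) -> differentiable g z -> differentiable f z.
Proof.
move=> /nbhs_nrm[e e0 fg] dg.
have [K _ hK] := diff_bounded dg.
apply: (proj1 (nrm_differentiable hK _)) => e' e'0.
have [d d0 hd] := differentiable_nrm dg e'0.
exists (Num.min d e); first by rewrite lt_min d0 e0.
move=> h; rewrite lt_min => /andP[/hd h1 h2].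
by rewrite !fg ?subrr ?nrm0// [z + h]addrC addrK.
Qed.

End Topology.

(* Wrapping these predicates in inductive types keeps the unifier from unfolding
   the filters behind them when it compares two different points. *)
Variant cont_at (T U : topologicalType) (f : T -> U) (x : T) : Prop :=
  ContAt of {for x, continuous f}.

Variant hol_at (R : realType) (V W : normedModType R[i]) (f : V -> W) (z : V) :
  Prop := HolAt of differentiable f z.

Definition der_def (R : realType) (V W : normedModType R[i]) (f : V -> W)
  (z h : V) : W := 'd f z h.
Fact der_key : unit. Proof. exact: tt. Qed.
Definition der := locked_with der_key der_def.
Arguments der {R V W} f z h.

Section Derivative.
Context {R : realType}.
Local Notation C := R[i].

Section DerivativeTheory.
Context {V W : normedModType C}.
Implicit Types (f : V -> W) (z h : V).

Lemma derE f z h : der f z h = 'd f z h.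
Proof. by rewrite /der unlock. Qed.

Lemma derD f z h k : der f z (h + k) = der f z h + der f z k.
Proof. by rewrite !derE linearD. Qed.

Lemma der0 f z : der f z 0 = 0.
Proof. by rewrite !derE linear0. Qed.

Lemma derZ f z (c : C) h : der f z (c *: h) = c *: der f z h.
Proof. by rewrite !derE linearZ. Qed.

Lemma hol_eps f z : hol_at f z -> forall e : R, 0 < e ->
  exists2 d : R, 0 < d & forall h, nrm h < d ->
    nrm (f (z + h) - f z - der f z h) <= e * nrm h.
Proof.
move=> [df] e e0; have [d d0 hd] := differentiable_nrm df e0.
by exists d => // h hh; rewrite derE; exact: hd.
Qed.

Lemma der_bounded f z : hol_at f z ->
  exists2 K : R, 0 < K & forall h, nrm (der f z h) <= K * nrm h.
Proof.
move=> [df]; have [K K0 hK] := diff_bounded df.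
by exists K => // h; rewrite derE.
Qed.

Lemma hol_intro f z (L : {linear V -> W}) (K : R) :
  (forall h, nrm (L h) <= K * nrm h) ->
  (forall e : R, 0 < e -> exists2 d : R, 0 < d & forall h, nrm h < d ->
    nrm (f (z + h) - f z - L h) <= e * nrm h) ->
  hol_at f z /\ forall h, der f z h = L h.
Proof.
move=> hK hf; have [df dE] := nrm_differentiable hK hf.
by split=> [//|h]; rewrite derE dE.
Qed.

Lemma hol_eq_near f g z :
  (\forall w \near z, f w = g w) -> hol_at g z -> hol_at f z.
Proof. by move=> fg [dg]; split; exact: differentiable_eq_near dg. Qed.

End DerivativeTheory.

Lemma hol_comp (U V W : normedModType C) (f : U -> V) (g : V -> W) (z : U) :
  hol_at f z -> hol_at g (f z) -> hol_at (fun t => g (f t)) z.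
Proof. by move=> [df] [dg]; split; exact: (differentiable_comp df dg). Qed.

Lemma der_comp (U V W : normedModType C) (f : U -> V) (g : V -> W) (z h : U) :
  hol_at f z -> hol_at g (f z) ->
  der (fun t => g (f t)) z h = der g (f z) (der f z h).
Proof.
move=> [df] [dg]; rewrite !derE.
by have := congr1 (fun u => u h) (diff_comp df dg).
Qed.

Lemma derC (f : C -> C) z h : der f z h = h * der f z 1.
Proof. by rewrite -{1}[h]mulr1 -[h * 1]/(h *: (1 : C)) derZ. Qed.

End Derivative.

Section ContAt.
Context {R : realType}.
Local Notation C := R[i].

Lemma cont_atP (T U : topologicalType) (f : T -> U) (x : T) :
  cont_at f x <-> {for x, continuous f}.
Proof. by split=> [[]|]. Qed.

Lemma hol_atP (V W : normedModType C) (f : V -> W) (z : V) :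
  hol_at f z <-> differentiable f z.
Proof. by split=> [[]|]. Qed.

Lemma hol_cont (V W : normedModType C) (f : V -> W) (z : V) :
  hol_at f z -> cont_at f z.
Proof. by move=> [/differentiable_cts]. Qed.

Lemma cont_eps (V W : normedModType C) (f : V -> W) (z : V) :
  cont_at f z -> forall e : R, 0 < e ->
    exists2 d : R, 0 < d & forall w, nrm (w - z) < d -> nrm (f w - f z) < e.
Proof. by move=> [/continuous_nrm]. Qed.

Lemma cont_at_eps (V W : normedModType C) (f : V -> W) (z : V) :
  (forall e : R, 0 < e ->
    exists2 d : R, 0 < d & forall w, nrm (w - z) < d -> nrm (f w - f z) < e) ->
  cont_at f z.
Proof. by move=> /continuous_nrm. Qed.

Lemma cont_comp (T U W : topologicalType) (f : T -> U) (g : U -> W) (x : T) :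
  cont_at f x -> cont_at g (f x) -> cont_at (fun t => g (f t)) x.
Proof. by move=> [cf] [cg]; split; exact: (continuous_comp cf cg). Qed.

Lemma cont_cst (T U : topologicalType) (k : U) (x : T) :
  cont_at (fun _ : T => k) x.
Proof. by split; exact: cst_continuous. Qed.

Lemma cont_id (T : topologicalType) (x : T) : cont_at (fun t : T => t) x.
Proof. by split. Qed.

Section Module.
Context {T : topologicalType} {V : normedModType C}.
Implicit Types (f g : T -> V) (x : T).

Lemma contN f x : cont_at f x -> cont_at (fun t => - f t) x.
Proof. by move=> [cf]; split; exact: (continuousN cf). Qed.

Lemma contD f g x : cont_at f x -> cont_at g x -> cont_at (fun t => f t + g t) x.
Proof. by move=> [cf] [cg]; split; exact: (continuousD cf cg). Qed.

Lemma contB f g x : cont_at f x -> cont_at g x -> cont_at (fun t => f t - g t) x.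
Proof. by move=> [cf] [cg]; split; exact: (continuousB cf cg). Qed.

End Module.

Lemma contM (T : topologicalType) (f g : T -> C) (x : T) :
  cont_at f x -> cont_at g x -> cont_at (fun t => f t * g t) x.
Proof. by move=> [cf] [cg]; split; exact: (continuousM cf cg). Qed.

Lemma cont_nrm (T : topologicalType) (V : normedModType C) (f : T -> V) (x : T) :
  cont_at f x -> cont_at (fun t => nrm (f t)) x.
Proof. by move=> cf; apply: (cont_comp cf); split; exact: nrm_continuous. Qed.

End ContAt.

(** * Integrals of complex-valued functions over real intervals *)

Section ComplexIntegral.
Context {R : realType}.
Local Notation C := R[i].
Local Notation mu := (@lebesgue_measure R).
Implicit Types (a b c : R) (f g : R -> C).

Definition cint a b f : C :=
  (\int[mu]_(x in `[a, b]) complex.Re (f x)) +i*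
  (\int[mu]_(x in `[a, b]) complex.Im (f x)).

Definition cont_on a b f := forall x, a <= x <= b -> cont_at f x.

Lemma integrable_itv a b (u : R -> R) :
  (forall x, a <= x <= b -> {for x, continuous u}) ->
  mu.-integrable `[a, b] (EFin \o u).
Proof.
move=> h; apply: continuous_compact_integrable; first exact: segment_compact.
by apply: continuous_in_subspaceT => x; rewrite inE/= in_itv/=; exact: h.
Qed.

Lemma integrable_Re a b f : cont_on a b f ->
  mu.-integrable `[a, b] (EFin \o (fun x => complex.Re (f x))).
Proof.
move=> h; apply: (@integrable_itv _ _ (fun x => complex.Re (f x))) => x /h[hx].
by apply: (continuous_comp hx); exact: Re_continuous.
Qed.

Lemma integrable_Im a b f : cont_on a b f ->
  mu.-integrable `[a, b] (EFin \o (fun x => complex.Im (f x))).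
Proof.
move=> h; apply: (@integrable_itv _ _ (fun x => complex.Im (f x))) => x /h[hx].
by apply: (continuous_comp hx); exact: Im_continuous.
Qed.

Lemma cint_ext a b f g : (forall x, a <= x <= b -> f x = g x) ->
  cint a b f = cint a b g.
Proof.
move=> h; rewrite /cint; congr (_ +i* _); apply: eq_Rintegral => x;
  by rewrite inE/= in_itv/= => /h ->.
Qed.

Lemma cintD a b f g : cont_on a b f -> cont_on a b g ->
  cint a b (fun x => f x + g x) = cint a b f + cint a b g.
Proof.
move=> hf hg; rewrite /cint.
under eq_Rintegral do rewrite raddfD.
under [X in _ +i* X]eq_Rintegral do rewrite raddfD.
rewrite !RintegralD//; by [exact: integrable_Re|exact: integrable_Im].
Qed.

Lemma cintZ a b (k : C) f : cont_on a b f ->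
  cint a b (fun x => k * f x) = k * cint a b f.
Proof.
move=> hf; rewrite /cint; case: k => k1 k2.
have E1 x : complex.Re ((k1 +i* k2) * f x) =
    k1 * complex.Re (f x) + (- k2) * complex.Im (f x).
  by case: (f x) => u v /=; rewrite mulNr.
have E2 x : complex.Im ((k1 +i* k2) * f x) =
    k1 * complex.Im (f x) + k2 * complex.Re (f x).
  by case: (f x) => u v /=.
have I1 := integrable_Re hf; have I2 := integrable_Im hf.
under eq_Rintegral do rewrite E1.
under [X in _ +i* X]eq_Rintegral do rewrite E2.
have iZ (k : R) (u : R -> R) : mu.-integrable `[a, b] (EFin \o u) ->
    mu.-integrable `[a, b] (EFin \o (fun x => k * u x)).
  by move=> hu; exact: (integrableZl _ k hu).
rewrite !RintegralD//; try exact: iZ.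
by rewrite !RintegralZl//= mulNr.
Qed.

Lemma cintN a b f : cont_on a b f ->
  cint a b (fun x => - f x) = - cint a b f.
Proof.
by move=> hf; rewrite -mulN1r -cintZ//; apply: cint_ext => x _; rewrite mulN1r.
Qed.

Lemma cont_onN a b f : cont_on a b f -> cont_on a b (fun x => - f x).
Proof. by move=> h x /h; exact: contN. Qed.

Lemma cont_onM a b f g : cont_on a b f -> cont_on a b g ->
  cont_on a b (fun x => f x * g x).
Proof. by move=> hf hg x hx; exact: contM (hf x hx) (hg x hx). Qed.

Lemma cont_on_cst a b (k : C) : cont_on a b (fun=> k).
Proof. by move=> x _; exact: cont_cst. Qed.

Lemma cintB a b f g : cont_on a b f -> cont_on a b g ->
  cint a b (fun x => f x - g x) = cint a b f - cint a b g.
Proof. by move=> hf hg; rewrite (cintD hf (cont_onN hg)) (cintN hg). Qed.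

Lemma cint_cst a b (k : C) : a <= b -> cint a b (fun=> k) = (b - a)%:C * k.
Proof.
move=> ab; rewrite /cint !Rintegral_cst//= lebesgue_measure_itv/= lte_fin.
case: k => u v /=; move: ab; rewrite le_eqVlt => /predU1P[->|->].
  by rewrite ltxx subrr !mulr0 mul0r.
by simpc; rewrite /= ![(b - a) * _]mulrC.
Qed.

(** After the rotation the modulus is the real part of the integral of [c * f], so monotonicity of a
    real integral applies and no factor is lost. *)
Lemma cint_nrm a b f (K : R) : a <= b -> cont_on a b f ->
  (forall x, a <= x <= b -> nrm (f x) <= K) -> nrm (cint a b f) <= K * (b - a).
Proof.
move=> ab hf hK; have [c c1 hc] := normc_rotate (cint a b f).
have -> : nrm (cint a b f) = complex.Re (cint a b (fun x => c * f x)).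
  by rewrite cintZ// hc.
have hcf : cont_on a b (fun x => c * f x).
  exact: (@cont_onM a b (fun=> c) f (@cont_on_cst a b c) hf).
rewrite /cint/=; apply: (@le_trans _ _ (\int[mu]_(x in `[a, b]) K)).
  apply: le_Rintegral => //; first exact: integrable_Re.
    by apply: integrable_itv => x _; exact: cst_continuous.
  move=> x; rewrite /= in_itv/= => /hK; apply: le_trans.
  by rewrite (le_trans (ler_norm _))// (le_trans (nrm_Re _))// nrmM c1 mul1r.
rewrite Rintegral_cst//= lebesgue_measure_itv/= lte_fin.
move: ab; rewrite le_eqVlt => /predU1P[->|->//].
by rewrite ltxx subrr.
Qed.

Lemma cint_split a b c f : a <= b -> b <= c -> cont_on a c f ->
  cint a c f = cint a b f + cint b c f.
Proof.
move=> ab bc hf.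
have S (u : R -> R) : mu.-integrable `[a, c] (EFin \o u) ->
    \int[mu]_(x in `[a, c]) u x =
    \int[mu]_(x in `[a, b]) u x + \int[mu]_(x in `[b, c]) u x.
  move=> hu; apply/eqP; rewrite addrC -subr_eq; apply/eqP.
  rewrite Rintegral_itvB// ?bnd_simp//.
  rewrite Rintegral_itv_obnd_cbnd//; apply: integrableS hu => //.
  by apply: subset_itvr; rewrite bnd_simp.
rewrite /cint (S _ (integrable_Re hf)) (S _ (integrable_Im hf)).
by [].
Qed.

End ComplexIntegral.

(** * Goursat's theorem and circle means *)

Section Goursat.
Context {R : realType}.
Local Notation C := R[i].
Implicit Types (g : C -> C).

(** The integral of g dz along the boundary of the rectangle, counterclockwise: bottom minus top,
    then right minus left with dz = i dy. *)
Definition rint (x0 x1 y0 y1 : R) g : C :=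
  cint x0 x1 (fun x => g (x +i* y0)) - cint x0 x1 (fun x => g (x +i* y1)) +
  'i%C * (cint y0 y1 (fun y => g (x1 +i* y)) -
          cint y0 y1 (fun y => g (x0 +i* y))).

Definition in_rect (x0 x1 y0 y1 : R) : set C :=
  [set z | x0 <= complex.Re z <= x1 /\ y0 <= complex.Im z <= y1].

Lemma cont_hline (g : C -> C) a b y : (forall x, a <= x <= b ->
  cont_at g (x +i* y)) -> cont_on a b (fun x => g (x +i* y)).
Proof.
move=> h x /h /cont_eps hx; split; apply/continuousR_nrm => e /hx[d d0 hd].
exists d => // w hw; apply: hd.
have -> : w +i* y - (x +i* y) = (w - x)%:C :> C by simpc.
by rewrite nrm_real.
Qed.

Lemma cont_vline (g : C -> C) a b x : (forall y, a <= y <= b ->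
  cont_at g (x +i* y)) -> cont_on a b (fun y => g (x +i* y)).
Proof.
move=> h y /h /cont_eps hx; split; apply/continuousR_nrm => e /hx[d d0 hd].
exists d => // w hw; apply: hd.
have -> : x +i* w - (x +i* y) = 'i%C * (w - y)%:C :> C by simpc.
by rewrite nrmM nrm_i mul1r nrm_real.
Qed.

Definition cont_rect x0 x1 y0 y1 g :=
  forall z, in_rect x0 x1 y0 y1 z -> cont_at g z.

Lemma cont_rectP x0 x1 y0 y1 g : cont_rect x0 x1 y0 y1 g ->
  (forall y, y0 <= y <= y1 -> cont_on x0 x1 (fun x => g (x +i* y))) /\
  (forall x, x0 <= x <= x1 -> cont_on y0 y1 (fun y => g (x +i* y))).
Proof.
by move=> h; split=> y hy;
  [apply: cont_hline => x hx|apply: cont_vline => x hx]; apply: h; split.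
Qed.

Lemma rint_splitx m x0 x1 y0 y1 g : x0 <= m -> m <= x1 -> y0 <= y1 ->
  cont_rect x0 x1 y0 y1 g ->
  rint x0 x1 y0 y1 g = rint x0 m y0 y1 g + rint m x1 y0 y1 g.
Proof.
move=> xm mx yy /cont_rectP[hx hy]; rewrite /rint.
rewrite (@cint_split _ x0 m x1 (fun x => g (x +i* y0)))//; last first.
  by apply: hx; rewrite lexx.
rewrite (@cint_split _ x0 m x1 (fun x => g (x +i* y1)))//; last first.
  by apply: hx; rewrite lexx yy.
ring.
Qed.

Lemma rint_splity m x0 x1 y0 y1 g : x0 <= x1 -> y0 <= m -> m <= y1 ->
  cont_rect x0 x1 y0 y1 g ->
  rint x0 x1 y0 y1 g = rint x0 x1 y0 m g + rint x0 x1 m y1 g.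
Proof.
move=> xx ym my /cont_rectP[hx hy]; rewrite /rint.
rewrite (@cint_split _ y0 m y1 (fun y => g (x0 +i* y)))//; last first.
  by apply: hy; rewrite lexx.
rewrite (@cint_split _ y0 m y1 (fun y => g (x1 +i* y)))//; last first.
  by apply: hy; rewrite lexx xx.
ring.
Qed.

Lemma rint_nrm x0 x1 y0 y1 g (K : R) : x0 <= x1 -> y0 <= y1 ->
  cont_rect x0 x1 y0 y1 g ->
  (forall z, in_rect x0 x1 y0 y1 z -> nrm (g z) <= K) ->
  nrm (rint x0 x1 y0 y1 g) <= 2 * K * ((x1 - x0) + (y1 - y0)).
Proof.
move=> xx yy /cont_rectP[hx hy] hK; rewrite /rint.
have A y : y0 <= y <= y1 ->
    nrm (cint x0 x1 (fun x => g (x +i* y))) <= K * (x1 - x0).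
  by move=> yI; apply: cint_nrm => //; [exact: hx|move=> x xI; apply: hK; split].
have B x : x0 <= x <= x1 ->
    nrm (cint y0 y1 (fun y => g (x +i* y))) <= K * (y1 - y0).
  by move=> xI; apply: cint_nrm => //; [exact: hy|move=> y yI; apply: hK; split].
apply: (le_trans (nrmD _ _)); rewrite nrmM nrm_i mul1r.
have := nrmB (cint x0 x1 (fun x => g (x +i* y0)))
  (cint x0 x1 (fun x => g (x +i* y1))).
have := nrmB (cint y0 y1 (fun y => g (x1 +i* y)))
  (cint y0 y1 (fun y => g (x0 +i* y))).
have := A y0; have := A y1; have := B x0; have := B x1.
rewrite !lexx xx yy => /(_ isT) b1 /(_ isT) b2 /(_ isT) b3 /(_ isT) b4; lra.
Qed.

Lemma rint_affine x0 x1 y0 y1 (a b : C) : x0 <= x1 -> y0 <= y1 ->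
  rint x0 x1 y0 y1 (fun z => a + b * z) = 0.
Proof.
move=> xx yy.
have cr : cont_rect x0 x1 y0 y1 (fun z : C => a + b * z).
  by move=> z _; exact: contD (cont_cst _ _) (contM (cont_cst _ _) (cont_id _)).
have [hx hy] := cont_rectP cr.
rewrite /rint -!cintB; try (by apply: hx; rewrite lexx ?yy ?xx);
  try (by apply: hy; rewrite lexx ?yy ?xx).
rewrite (@cint_ext _ x0 x1 _ (fun=> b * ('i%C * (y0 - y1)%:C))); last first.
  move=> x _.
  have -> : a + b * (x +i* y0) - (a + b * (x +i* y1)) =
    b * ((x +i* y0) - (x +i* y1)) by ring.
  by congr (b * _); simpc.
rewrite (@cint_ext _ y0 y1 _ (fun=> b * (x1 - x0)%:C)); last first.
  move=> y _.
  have -> : a + b * (x1 +i* y) - (a + b * (x0 +i* y)) =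
    b * ((x1 +i* y) - (x0 +i* y)) by ring.
  by congr (b * _); simpc.
rewrite !cint_cst// !rmorphB/=; ring.
Qed.

Lemma rintB x0 x1 y0 y1 f g : x0 <= x1 -> y0 <= y1 ->
  cont_rect x0 x1 y0 y1 f -> cont_rect x0 x1 y0 y1 g ->
  rint x0 x1 y0 y1 (fun z => f z - g z) =
  rint x0 x1 y0 y1 f - rint x0 x1 y0 y1 g.
Proof.
move=> xx yy /cont_rectP[fx fy] /cont_rectP[gx gy]; rewrite /rint !cintB;
 try (by apply: fx; rewrite lexx ?yy ?xx);
  try (by apply: fy; rewrite lexx ?yy ?xx);
 try (by apply: gx; rewrite lexx ?yy ?xx);
  try (by apply: gy; rewrite lexx ?yy ?xx).
ring.
Qed.

Lemma nrm_rect x0 x1 y0 y1 (z p : C) : in_rect x0 x1 y0 y1 z ->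
  in_rect x0 x1 y0 y1 p -> nrm (z - p) <= (x1 - x0) + (y1 - y0).
Proof.
move=> [/andP[z1 z2] /andP[z3 z4]] [/andP[p1 p2] /andP[p3 p4]].
apply: (le_trans (nrm_le_ReIm _)); rewrite !raddfB/=.
by apply: lerD; rewrite ler_norml; apply/andP; split; lra.
Qed.

(** Affine functions integrate to 0, so only the remainder of the first-order expansion at [p]
    counts: it is at most [e / 2] times the size (width plus height) of the rectangle, on a boundary
    of length twice that size. *)
Lemma goursat_local (p : C) g (e : R) : hol_at g p -> 0 < e ->
  exists2 d : R, 0 < d & forall x0 x1 y0 y1, x0 <= x1 -> y0 <= y1 ->
   (x1 - x0) + (y1 - y0) < d -> cont_rect x0 x1 y0 y1 g ->
   in_rect x0 x1 y0 y1 p ->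
   nrm (rint x0 x1 y0 y1 g) <= e * ((x1 - x0) + (y1 - y0)) ^+ 2.
Proof.
move=> dg e0; have e2 : 0 < e / 2 by rewrite divr_gt0.
have [d d0 hd] := hol_eps dg e2.
exists d => // x0 x1 y0 y1 xx yy sd cg ip.
pose A z := (g p - p * der g p 1) + der g p 1 * z.
have cA : cont_rect x0 x1 y0 y1 A.
  by move=> z _; exact: contD (cont_cst _ _) (contM (cont_cst _ _) (cont_id _)).
have -> : rint x0 x1 y0 y1 g = rint x0 x1 y0 y1 (fun z => g z - A z).
  by rewrite rintB// rint_affine// subr0.
have cr : cont_rect x0 x1 y0 y1 (fun z => g z - A z).
  by move=> z hz; exact: contB (cg z hz) (cA z hz).
set s := _ + _.
apply: (le_trans (rint_nrm (K := e / 2 * s) xx yy cr _)); last first.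
  by rewrite -/s (_ : 2 * (e / 2 * s) * s = e * s ^+ 2)//; field.
move=> z hz; have nz : nrm (z - p) <= s by exact: nrm_rect hz ip.
have := hd (z - p); rewrite [p + _]addrC subrK => /(_ (le_lt_trans nz sd)).
rewrite [X in nrm X](_ : _ = g z - A z); last by rewrite derC /A; ring.
by move=> /le_trans; apply; rewrite ler_wpM2l// ltW.
Qed.

Definition rect := ((R * R) * (R * R))%type.
Definition rintr g (Q : rect) := rint Q.1.1 Q.1.2 Q.2.1 Q.2.2 g.
Definition mid (I : R * R) := (I.1 + I.2) / 2.
Definition lo (I : R * R) := (I.1, mid I).
Definition hi (I : R * R) := (mid I, I.2).

(** A quarter carrying at least a fourth of the modulus of the integral. The last quarter is the
    default; [childP] shows that it qualifies when the other three fail. *)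
Definition child g (Q : rect) : rect :=
  let big P := nrm (rintr g Q) <= 4 * nrm (rintr g P) in
  if big (lo Q.1, lo Q.2) then (lo Q.1, lo Q.2)
  else if big (lo Q.1, hi Q.2) then (lo Q.1, hi Q.2)
  else if big (hi Q.1, lo Q.2) then (hi Q.1, lo Q.2)
  else (hi Q.1, hi Q.2).

Definition half_of (J I : R * R) :=
  [/\ J.1 <= J.2, I.1 <= J.1, J.2 <= I.2 & J.2 - J.1 = (I.2 - I.1) / 2].

Lemma half_lo I : I.1 <= I.2 -> half_of (lo I) I.
Proof. by case: I => a b /= ab; split; rewrite /lo /mid/=; lra. Qed.

Lemma half_hi I : I.1 <= I.2 -> half_of (hi I) I.
Proof. by case: I => a b /= ab; split; rewrite /hi /mid/=; lra. Qed.

Lemma nrmD4_lt (a b c d : C) (s : R) : 4 * nrm a < s -> 4 * nrm b < s ->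
  4 * nrm c < s -> 4 * nrm d < s -> nrm (a + b + (c + d)) < s.
Proof.
have := nrmD (a + b) (c + d); have := nrmD a b; have := nrmD c d.
move: (nrm a) (nrm b) (nrm c) (nrm d) (nrm _) (nrm _) (nrm _) => *; lra.
Qed.

Lemma childP g Q : Q.1.1 <= Q.1.2 -> Q.2.1 <= Q.2.2 ->
  cont_rect Q.1.1 Q.1.2 Q.2.1 Q.2.2 g ->
  [/\ half_of (child g Q).1 Q.1, half_of (child g Q).2 Q.2 &
      nrm (rintr g Q) <= 4 * nrm (rintr g (child g Q))].
Proof.
case: Q => -[x0 x1] [y0 y1] /= xx yy cg.
have hx : x0 <= (x0 + x1) / 2 <= x1 by apply/andP; split; lra.
have hy : y0 <= (y0 + y1) / 2 <= y1 by apply/andP; split; lra.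
have [/andP[hx1 hx2] /andP[hy1 hy2]] := (hx, hy).
have E : rintr g ((x0, x1), (y0, y1)) =
   rintr g (lo (x0, x1), lo (y0, y1)) + rintr g (lo (x0, x1), hi (y0, y1)) +
   (rintr g (hi (x0, x1), lo (y0, y1)) + rintr g (hi (x0, x1), hi (y0, y1))).
  rewrite /rintr/= /mid/= (rint_splitx hx1 hx2)// (rint_splity _ hy1 hy2)//.
    rewrite [X in _ + X](rint_splity _ hy1 hy2)// => z [/andP[z1 z2] z3].
    by apply: cg; split=> //; apply/andP; split; rewrite // (le_trans hx1).
  move=> z [/andP[z1 z2] z3].
  by apply: cg; split=> //; apply/andP; split; rewrite // (le_trans z2).
rewrite /child/=; case: ifPn => [h1|/negP h1]; first by split; [exact: half_lo|exact: half_lo|].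
case: ifPn => [h2|/negP h2]; first by split; [exact: half_lo|exact: half_hi|].
case: ifPn => [h3|/negP h3]; first by split; [exact: half_hi|exact: half_lo|].
split; [exact: half_hi|exact: half_hi|].
rewrite leNgt; apply/negP => h4.
move: h1 h2 h3 => /negP; rewrite -ltNge => h1 /negP; rewrite -ltNge => h2.
move=> /negP; rewrite -ltNge => h3.
by have := nrmD4_lt h1 h2 h3 h4; rewrite -E ltxx.
Qed.

Lemma nested_point (I : nat -> R * R) :
  (forall k, (I k).1 <= (I k).2) ->
  (forall k, (I k).1 <= (I k.+1).1 /\ (I k.+1).2 <= (I k).2) ->
  exists p, forall k, (I k).1 <= p <= (I k).2.
Proof.
move=> h1 h2.
have mon1 j k : (j <= k)%N -> (I j).1 <= (I k).1.
  move=> /subnK <-; elim: (k - j)%N => [//|m IH].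
  by rewrite addSn; apply: (le_trans IH); case: (h2 (m + j)%N).
have mon2 j k : (j <= k)%N -> (I k).2 <= (I j).2.
  move=> /subnK <-; elim: (k - j)%N => [//|m IH].
  by rewrite addSn; apply: le_trans IH; case: (h2 (m + j)%N).
have cross j k : (I j).1 <= (I k).2.
  apply: (le_trans (mon1 _ _ (leq_maxl j k))).
  exact: (le_trans (h1 _) (mon2 _ _ (leq_maxr j k))).
exists (sup [set x | exists k, x = (I k).1]) => k; apply/andP; split.
  apply: ub_le_sup; last by exists k.
  by exists (I 0%N).2 => x [j ->].
by apply: ge_sup; [exists (I 0%N).1, 0%N|move=> x [j ->]].
Qed.

Lemma half_pow_small (w d : R) : 0 < d -> exists k, w / 2 ^+ k < d.
Proof.
move=> d0; have [k hk] : exists k : nat, w / d < k%:R.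
  exists (Num.bound `|w / d|); apply: (le_lt_trans (ler_norm _)).
  exact: archi_boundP.
exists k; rewrite ltr_pdivrMr ?exprn_gt0// mulrC -ltr_pdivrMr//.
apply: (lt_le_trans hk); rewrite -natrX ler_nat.
by rewrite ltnW// ltn_expl.
Qed.

(** Goursat's bisection: the [k]-th rectangle has size [W / 2 ^+ k] and an integral of modulus at
    least [A / 4 ^+ k], whereas [goursat_local] at the common point bounds it by
    [e * W ^+ 2 / 4 ^+ k] for large [k]; the powers of 4 cancel. *)
Lemma goursat x0 x1 y0 y1 g : x0 <= x1 -> y0 <= y1 ->
  (forall z, in_rect x0 x1 y0 y1 z -> hol_at g z) ->
  rint x0 x1 y0 y1 g = 0.
Proof.
move=> xx yy dg; apply/eqP; rewrite -nrm_eq0 eq_le nrm_ge0 andbT leNgt.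
apply/negP => A0; set A := nrm _ in A0.
pose Q k := iter k (child g) ((x0, x1), (y0, y1)).
pose W := (x1 - x0) + (y1 - y0).
have inv k : [/\ (Q k).1.1 <= (Q k).1.2, (Q k).2.1 <= (Q k).2.2,
   in_rect (Q k).1.1 (Q k).1.2 (Q k).2.1 (Q k).2.2 `<=` in_rect x0 x1 y0 y1,
   A <= 4 ^+ k * nrm (rintr g (Q k)) &
   ((Q k).1.2 - (Q k).1.1) + ((Q k).2.2 - (Q k).2.1) = W / 2 ^+ k] /\
   [/\ half_of (Q k.+1).1 (Q k).1 & half_of (Q k.+1).2 (Q k).2].
  elim: k => [|k [[i1 i2 i3 i4 i5] [[a1 a2 a3 a4] [b1 b2 b3 b4]]]].
    split; last first.
      have [|||c1 c2 _] := @childP g ((x0, x1), (y0, y1)) => //.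
      by move=> z hz; apply: hol_cont; apply: dg.
    by split=> //; rewrite ?expr0 ?mul1r ?divr1.
  have sub : in_rect (Q k.+1).1.1 (Q k.+1).1.2 (Q k.+1).2.1 (Q k.+1).2.2
      `<=` in_rect x0 x1 y0 y1.
    apply: subset_trans i3 => z [/andP[z1 z2] /andP[z3 z4]].
    by split; apply/andP; split; [exact: le_trans z1|exact: le_trans a3|
      exact: le_trans z3|exact: le_trans b3].
  have ct j : in_rect (Q j).1.1 (Q j).1.2 (Q j).2.1 (Q j).2.2
      `<=` in_rect x0 x1 y0 y1 ->
      cont_rect (Q j).1.1 (Q j).1.2 (Q j).2.1 (Q j).2.2 g.
    by move=> s z /s/dg/hol_cont.
  have [_ _ c3] := childP i1 i2 (ct _ i3).
  have [d1 d2 _] := childP a1 b1 (ct _ sub).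
  split=> //; split=> //.
    apply: (le_trans i4); rewrite exprS [4 * _]mulrC -mulrA ler_wpM2l//.
  by rewrite a4 b4 exprS -mulrDl i5 -mulrA -invfM [_ * 2]mulrC.
have [px hpx] : exists p, forall k, (Q k).1.1 <= p <= (Q k).1.2.
  apply: (@nested_point (fun k => (Q k).1)) => k; first by case: (inv k) => -[].
  by case: (inv k) => _ [[? ? ? ?] _].
have [py hpy] : exists p, forall k, (Q k).2.1 <= p <= (Q k).2.2.
  apply: (@nested_point (fun k => (Q k).2)) => k; first by case: (inv k) => -[].
  by case: (inv k) => _ [_ [? ? ? ?]].
have W0 : 0 <= W by rewrite /W; lra.
(* Chosen so that [e * W ^+ 2 < A]; the [+ 1] covers [W = 0]. *)
pose e := A / (2 * (W ^+ 2 + 1)).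
have W1 : 0 < W ^+ 2 + 1 by rewrite ltr_wpDl// sqr_ge0.
have e0 : 0 < e by rewrite divr_gt0// mulr_gt0.
have dp : hol_at g (px +i* py).
  by apply: dg; split; [exact: (hpx 0%N)|exact: (hpy 0%N)].
have [d d0 hd] := goursat_local dp e0.
have [k hk] := half_pow_small W d0.
have [[i1 i2 i3 i4 i5] _] := inv k.
have := hd _ _ _ _ i1 i2; rewrite i5 => /(_ hk).
have ct : cont_rect (Q k).1.1 (Q k).1.2 (Q k).2.1 (Q k).2.2 g.
  by move=> z /i3/dg/hol_cont.
move=> /(_ ct) H; have {}H := H (conj (hpx k) (hpy k)).
have : A <= e * W ^+ 2.
  apply: (le_trans i4); rewrite -ler_pdivlMl ?exprn_gt0//.
  apply: (le_trans H); rewrite le_eqVlt; apply/orP; left; apply/eqP.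
  have four : 4 = 2 ^+ 2 :> R by ring.
  have -> : 4 ^+ k = 2 ^+ k ^+ 2 :> R by rewrite four -!exprM mulnC.
  by field; rewrite expf_neq0// pnatr_eq0.
apply/negP; rewrite -ltNge /e -mulrA -[ltRHS]mulr1 ltr_pM2l//.
by rewrite mulrC ltr_pdivrMr ?mulr_gt0//; lra.
Qed.

End Goursat.

Section GoursatException.
Context {R : realType}.
Local Notation C := R[i].

(** Four rectangles around [p] are cut off, each avoiding [p] and hence of zero integral; on the
    remaining square of side [2 * d] the integrand is bounded, so the integral is of order [d]. *)
Lemma rint_except x0 x1 y0 y1 (g : C -> C) (p : C) :
  x0 < complex.Re p < x1 -> y0 < complex.Im p < y1 ->
  cont_rect x0 x1 y0 y1 g ->
  (forall z, in_rect x0 x1 y0 y1 z -> z != p -> hol_at g z) ->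
  rint x0 x1 y0 y1 g = 0.
Proof.
case: p => px py /= /andP[x0p px1] /andP[y0p py1] cg dg.
have [d0 d00 hd0] : exists2 d : R, 0 < d & forall w : C,
    nrm (w - (px +i* py)) < d -> nrm (g w - g (px +i* py)) < 1.
  have : cont_at g (px +i* py) by apply: cg; split; apply/andP; split; rewrite ltW.
  by move=> /cont_eps/(_ 1 ltr01).
pose K := nrm (g (px +i* py)) + 1.
have K0 : 0 < K by rewrite ltr_wpDl// nrm_ge0.
apply/eqP; rewrite -nrm_eq0 eq_le nrm_ge0 andbT.
apply/ler_addgt0Pr => e e0; rewrite add0r.
(* The remaining square has width plus height [4 * d]: [d0 / 8] keeps it where [g] is bounded by
   [K], and [e / (8 * K)] makes [2 * K * (4 * d) <= e]. *)
pose d := Num.min (Num.min (px - x0) (x1 - px))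
  (Num.min (Num.min (py - y0) (y1 - py)) (Num.min (d0 / 8) (e / (8 * K)))).
have [d1 [d2 [d3 [d4 [d5 [d6 d7]]]]]] : d <= px - x0 /\ d <= x1 - px /\
    d <= py - y0 /\ d <= y1 - py /\ d <= d0 / 8 /\ d <= e / (8 * K) /\ 0 < d.
  by rewrite /d !ge_min !lexx !orbT !lt_min !subr_gt0 x0p px1 y0p py1 !divr_gt0// mulr_gt0.
have mono a0 a1 b0 b1 : x0 <= a0 -> a1 <= x1 -> y0 <= b0 -> b1 <= y1 ->
   in_rect a0 a1 b0 b1 `<=` in_rect x0 x1 y0 y1.
  move=> h1 h2 h3 h4 z [/andP[z1 z2] /andP[z3 z4]]; split; apply/andP; split;
   by [exact: le_trans z1|exact: le_trans h2|exact: le_trans z3|exact: le_trans h4].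
have cm a0 a1 b0 b1 : x0 <= a0 -> a1 <= x1 -> y0 <= b0 -> b1 <= y1 ->
   cont_rect a0 a1 b0 b1 g.
  by move=> h1 h2 h3 h4 z hz; apply: cg; exact: mono hz.
have G a0 a1 b0 b1 : x0 <= a0 -> a1 <= x1 -> y0 <= b0 -> b1 <= y1 ->
   a0 <= a1 -> b0 <= b1 ->
   [|| a1 < px, px < a0, b1 < py | py < b0] -> rint a0 a1 b0 b1 g = 0.
  move=> h1 h2 h3 h4 h5 h6 h; apply: goursat => // z hz; apply: dg.
    exact: mono hz.
  apply: contraTneq h => ez; move: hz; rewrite ez.
  by case=> /= /andP[z1 z2] /andP[z3 z4]; rewrite !ltNge z1 z2 z3 z4.
have xl : x0 <= px - d by lra.
have xr : px + d <= x1 by lra.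
have yl : y0 <= py - d by lra.
have yr : py + d <= y1 by lra.
rewrite (@rint_splitx _ (px - d))//; try lra.
rewrite (G x0 (px - d) y0 y1)//; try lra; try (by apply/or4P; apply: Or41; lra).
rewrite add0r (@rint_splitx _ (px + d))//; try lra; try exact: cm.
rewrite (G (px + d) x1 y0 y1)//; try lra; try (by apply/or4P; apply: Or42; lra).
rewrite addr0 (@rint_splity _ (py - d))//; try lra; try exact: cm.
rewrite (G (px - d) (px + d) y0 (py - d))//; try lra;
  try (by apply/or4P; apply: Or43; lra).
rewrite add0r (@rint_splity _ (py + d))//; try lra; try exact: cm.
rewrite (G (px - d) (px + d) (py + d) y1)//; try lra;
  try (by apply/or4P; apply: Or44; lra).
rewrite addr0; apply: (@le_trans _ _ (2 * K * ((px + d - (px - d)) + (py + d - (py - d))))).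
  apply: rint_nrm; [lra|lra|exact: cm|].
  move=> z hz.
  have zp : nrm (z - (px +i* py)) < d0.
    apply: (@le_lt_trans _ _ ((px + d - (px - d)) + (py + d - (py - d)))).
      by apply: (nrm_rect hz); split; apply/andP; split => /=; lra.
    by move: d5; lra.
  rewrite -[g z](subrK (g (px +i* py))); apply: (le_trans (nrmD _ _)).
  by rewrite addrC /K lerD2l ltW// hd0.
move: d6; rewrite ler_pdivlMr ?mulr_gt0// => d6.
by apply: le_trans d6; nra.
Qed.

End GoursatException.

Section ExpCircle.
Context {R : realType}.
Local Notation C := R[i].

Lemma is_derive_eps (f : R -> R) (x df : R) : is_derive x 1 f df ->
  forall e : R, 0 < e -> exists2 d : R, 0 < d & forall h, `|h| < d ->
    `|f (x + h) - f x - df * h| <= e * `|h|.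
Proof.
move=> [dv Ddf] e e0.
have : h^-1 *: (f (h *: 1 + x) - f x) @[h --> 0^'] --> df by rewrite -Ddf.
move=> /cvgrPdist_lt/(_ e e0)/nbhs_ballP[d /= d0 hd].
exists d => // h hh; have [->|h0] := eqVneq h 0.
  by rewrite addr0 subrr mulr0 subr0 normr0 mulr0.
have := hd h; rewrite /ball/= sub0r normrN => /(_ hh h0) /ltW.
rewrite /GRing.scale/= mulr1 [h + x]addrC => H.
have -> : f (x + h) - f x - df * h = - (df - h^-1 * (f (x + h) - f x)) * h.
  by field.
by rewrite normrM normrN ler_wpM2r.
Qed.

(** [cis s t] is s e^(it), and [cexp] below is the complex exponential. *)
Definition cis (s t : R) : C := (s * cos t) +i* (s * sin t).
Definition cexp (z : C) : C := cis (expR (complex.Re z)) (complex.Im z).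

Lemma cisM s t s' t' : cis s t * cis s' t' = cis (s * s') (t + t').
Proof.
by rewrite /cis cosD sinD; simpc; congr (_ +i* _); ring.
Qed.

Lemma cexpD z w : cexp (z + w) = cexp z * cexp w.
Proof. by rewrite /cexp cisM !raddfD/= expRD. Qed.

Lemma nrm_cis s t : nrm (cis s t) = `|s|.
Proof.
apply/eqP; rewrite -(@eqrXn2 _ 2)// ?nrm_ge0// nrm_sqr/= real_normK ?num_real//.
by rewrite !exprMn -mulrDr cos2Dsin2 mulr1.
Qed.

Lemma cexp_near1 (e : R) : 0 < e -> exists2 d : R, 0 < d & forall h : C,
  nrm h < d -> nrm (cexp h - 1 - h) <= e * nrm h.
Proof.
move=> e0; pose e' := Num.min (e / 6) 1.
have e'0 : 0 < e' by rewrite lt_min divr_gt0//= ltr01.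
have e'e : 6 * e' <= e by rewrite mulrC -ler_pdivlMr// /e' ge_min lexx.
have e'1 : e' <= 1 by rewrite /e' ge_min lexx orbT.
have [d1 d10 h1] := is_derive_eps (is_derive_expR 0) e'0.
have [d2 d20 h2] := is_derive_eps (is_derive_cos 0) e'0.
have [d3 d30 h3] := is_derive_eps (is_derive_sin 0) e'0.
pose d := Num.min (e' / 2) (Num.min d1 (Num.min d2 d3)).
exists d; first by rewrite /d !lt_min d10 d20 d30 divr_gt0.
move=> h; rewrite /d !lt_min => /and4P[he hd1 hd2 hd3].
have xh := nrm_Re h; have yh := nrm_Im h; case: h he hd1 hd2 hd3 xh yh => x y /=.
set n := nrm _ => he hd1 hd2 hd3 xn yn.
have := h1 x (le_lt_trans xn hd1); have := h2 y (le_lt_trans yn hd2).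
have := h3 y (le_lt_trans yn hd3).
rewrite !(add0r, expR0, cos0, sin0, oppr0, mul0r, subr0, mul1r) => s3 s2 s1.
have ex : `|expR x - 1| <= e'.
  rewrite -[expR x - 1](subrK x); apply: (le_trans (ler_normD _ _)).
  have x2 : `|x| <= e' / 2 by rewrite (le_trans xn)// ltW.
  have := ler_wpM2r (normr_ge0 x) e'1; move: s1 x2.
  by move: (Num.norm (expR x - 1 - x)) (Num.norm x) => u v; lra.
have ex2 : expR x <= 2 by move: ex; rewrite ler_norml => /andP[_]; lra.
(* The remainder splits into three terms, each small compared with [n]: the remainders of cosine and
   sine at 0, that of the real exponential, and a product of two small factors. *)
have -> : cexp (x +i* y) - 1 - (x +i* y) =
  (expR x)%:C * ((cos y - 1) +i* (sin y - y)) + (expR x - 1 - x)%:C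
    + 'i%C * ((y * (expR x - 1))%:C).
  by rewrite /cexp /cis /=; simpc; congr (_ +i* _); ring.
have t1 : nrm ((expR x)%:C * ((cos y - 1) +i* (sin y - y)) : C) <= 4 * (e' * n).
  rewrite nrmM nrm_pos ?expR_ge0//.
  have := nrm_le_ReIm ((cos y - 1) +i* (sin y - y)) => /=.
  have a0 := nrm_ge0 ((cos y - 1) +i* (sin y - y) : C).
  have b0 := expR_ge0 x.
  have yn' : e' * `|y| <= e' * n by rewrite ler_wpM2l// ltW.
  move=> H; apply: (@le_trans _ _ (2 * nrm ((cos y - 1) +i* (sin y - y) : C))).
    by rewrite ler_wpM2r.
  lra.
have t2 : nrm ((expR x - 1 - x)%:C : C) <= e' * n.
  by rewrite nrm_real (le_trans s1)// ler_wpM2l// ltW.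
have t3 : nrm ('i%C * ((y * (expR x - 1))%:C) : C) <= e' * n.
  by rewrite nrmM nrm_i mul1r nrm_real normrM mulrC ler_pM.
apply: (le_trans (nrmD _ _)); apply: (@le_trans _ _ (6 * (e' * n))).
  apply: (@le_trans _ _ (4 * (e' * n) + e' * n + e' * n)); last lra.
  by apply: lerD t3; apply: (le_trans (nrmD _ _)); exact: lerD.
by rewrite mulrA ler_wpM2r// nrm_ge0.
Qed.

Lemma diffC_intro (f : C -> C) (z c : C) :
  (forall e : R, 0 < e -> exists2 d : R, 0 < d & forall h, nrm h < d ->
    nrm (f (z + h) - f z - c * h) <= e * nrm h) ->
  hol_at f z /\ der f z 1 = c.
Proof.
move=> H; pose L : {linear C -> C} := *:%R c.
have hK h : nrm (L h) <= nrm c * nrm h by rewrite nrmZ.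
have [df ->] := hol_intro hK H.
by split => //; rewrite /L/= -[_ *: _]/(c * 1) mulr1.
Qed.

Lemma diff_cexp (z : C) : hol_at cexp z /\ der cexp z 1 = cexp z.
Proof.
apply: diffC_intro => e e0.
have n0 : 0 < nrm (cexp z) by rewrite nrm_cis gtr0_norm ?expR_gt0.
have [d d0 hd] := cexp_near1 (divr_gt0 e0 n0).
exists d => // h /hd H.
have -> : cexp (z + h) - cexp z - cexp z * h = cexp z * (cexp h - 1 - h).
  by rewrite cexpD; ring.
rewrite nrmM (le_trans (ler_wpM2l (nrm_ge0 _) H))//.
by rewrite mulrA mulrCA divff ?mulr1// gt_eqF.
Qed.

End ExpCircle.

Section CircleMean.
Context {R : realType}.
Local Notation C := R[i].
Implicit Types (g : C -> C) (s t : R).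

(** This is the contour integral of g(l) dl / l over the circle of radius [s], divided by 2 pi i.
    With this normalisation the means over two circles agree when [g] is holomorphic on the annulus
    between them. *)
Definition cmean (s : R) g : C :=
  ((2 * pi)^-1)%:C * cint (- pi) pi (fun t => g (cis s t)).

Lemma cis_cont s t : cont_at (cis s) t.
Proof.
split; apply/continuousR_nrm => e e0.
have c1 : {for t, continuous (fun t => s * cos t)}.
  by apply: continuousM; [exact: cst_continuous|exact: continuous_cos].
have c2 : {for t, continuous (fun t => s * sin t)}.
  by apply: continuousM; [exact: cst_continuous|exact: continuous_sin].
have e2 : 0 < e / 2 by rewrite divr_gt0.
have [d1 d10 h1] := (continuousR _ _).1 c1 _ e2.
have [d2 d20 h2] := (continuousR _ _).1 c2 _ e2.
exists (Num.min d1 d2); first by rewrite lt_min d10 d20.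
move=> w; rewrite lt_min => /andP[/h1 a1 /h2 a2].
apply: (le_lt_trans (nrm_le_ReIm _)); rewrite /cis !raddfB/=; lra.
Qed.

Definition cont_circle s g := forall l : C, nrm l = s -> cont_at g l.

Lemma cont_circleP s g a b : 0 <= s -> cont_circle s g ->
  cont_on a b (fun t => g (cis s t)).
Proof.
move=> s0 h t _; apply: (cont_comp (cis_cont s t)).
by apply: h; rewrite nrm_cis ger0_norm.
Qed.

Lemma twopi_gt0 : 0 < 2 * pi :> R.
Proof. by rewrite mulr_gt0// pi_gt0. Qed.

Lemma pi_le : - pi <= pi :> R.
Proof. by rewrite -subr_ge0 opprK -mulr2n -mulr_natl ltW// twopi_gt0. Qed.

Lemma cmean_nrm s g K : 0 <= s -> cont_circle s g ->
  (forall l, nrm l = s -> nrm (g l) <= K) -> nrm (cmean s g) <= K.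
Proof.
move=> s0 cg hK; rewrite /cmean nrmM nrm_pos ?invr_ge0 ?(ltW twopi_gt0)//.
rewrite ler_pdivrMl ?twopi_gt0// mulrC.
have -> : 2 * pi = pi - - pi :> R by rewrite opprK mulr2n mulrDl mul1r.
apply: cint_nrm => //; [exact: pi_le|exact: cont_circleP|].
by move=> x _; apply: hK; rewrite nrm_cis ger0_norm.
Qed.

Lemma cmean_cst s (k : C) : cmean s (fun=> k) = k.
Proof.
rewrite /cmean cint_cst ?pi_le// mulrA -rmorphM/= opprK.
have -> : pi + pi = 2 * pi :> R by rewrite mulr2n mulrDl mul1r.
by rewrite mulVf ?gt_eqF ?twopi_gt0// mul1r.
Qed.

Lemma cmeanD s f g : 0 <= s -> cont_circle s f -> cont_circle s g ->
  cmean s (fun l => f l + g l) = cmean s f + cmean s g.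
Proof.
by move=> s0 hf hg; rewrite /cmean cintD ?mulrDr//; exact: cont_circleP.
Qed.

Lemma cmeanB s f g : 0 <= s -> cont_circle s f -> cont_circle s g ->
  cmean s (fun l => f l - g l) = cmean s f - cmean s g.
Proof.
by move=> s0 hf hg; rewrite /cmean cintB ?mulrBr//; exact: cont_circleP.
Qed.

Lemma cmeanZ s (k : C) f : 0 <= s -> cont_circle s f ->
  cmean s (fun l => k * f l) = k * cmean s f.
Proof.
by move=> s0 hf; rewrite /cmean cintZ 1?mulrCA//; exact: cont_circleP.
Qed.

Lemma cmean_ext s f g : 0 <= s -> (forall l, nrm l = s -> f l = g l) ->
  cmean s f = cmean s g.
Proof.
move=> s0 fg; rewrite /cmean; congr (_ * _); apply: cint_ext => t _.
by rewrite fg// nrm_cis ger0_norm.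
Qed.

Lemma cexp_eq1 (x y : R) : - pi <= y <= pi -> cexp (x +i* y) = 1 -> x = 0 /\ y = 0.
Proof.
move=> yI E.
have x0 : x = 0.
  have := congr1 (@nrm R C) E; rewrite nrm_cis/= nrm1 ger0_norm ?expR_ge0//.
  by move=> ex; apply: expR_inj; rewrite expR0.
split=> //; move: E; rewrite x0 /cexp /cis/= expR0 !mul1r => -[c1 _].
have cy : cos `|y| = 1 by case: (ger0P y) => _; rewrite ?cosN.
apply/eqP; rewrite -normr_eq0; apply/eqP; apply: cos_inj; rewrite ?in_itv/=.
- rewrite normr_ge0/= ler_norml; exact: yI.
- by rewrite lexx/= ltW// pi_gt0.
- by rewrite cos0.
Qed.

(** In the coordinate [cexp] the annulus is the rectangle [ln s1, ln s2] x [-pi, pi]. Its horizontal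
    sides cancel by periodicity, and its vertical sides give the two means. *)
Lemma cmean_rect s1 s2 g : 0 < s1 -> s1 <= s2 ->
  (forall l, s1 <= nrm l <= s2 -> cont_at g l) ->
  rint (ln s1) (ln s2) (- pi) pi (g \o cexp) = 0 -> cmean s1 g = cmean s2 g.
Proof.
move=> s10 s12 cg; have s20 : 0 < s2 by exact: lt_le_trans s12.
rewrite /rint (@cint_ext _ (ln s1) (ln s2) (fun x => (g \o cexp) (x +i* (- pi)))
  (fun x => (g \o cexp) (x +i* pi))); last first.
  by move=> x _; rewrite /comp /cexp /cis/= cosN sinN sinpi oppr0.
rewrite subrr add0r => /eqP; rewrite mulf_eq0 subr_eq0 => /orP[/eqP[/eqP]|].
  by rewrite oner_eq0.
by rewrite /cmean /comp /cexp/= !lnK ?posrE// => /eqP ->.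
Qed.

Lemma cexp_rect s1 s2 z : 0 < s1 -> 0 < s2 ->
  in_rect (ln s1) (ln s2) (- pi) pi z ->
  s1 <= nrm (cexp z) <= s2.
Proof.
move=> s10 s20 [/andP[z1 z2] _]; rewrite nrm_cis ger0_norm ?expR_ge0//.
by rewrite -[s1]lnK ?posrE// -[s2]lnK ?posrE// !ler_expR z1 z2.
Qed.

Lemma cmean_const s1 s2 g : 0 < s1 -> s1 <= s2 ->
  (forall l, s1 <= nrm l <= s2 -> hol_at g l) ->
  cmean s1 g = cmean s2 g.
Proof.
move=> s10 s12 dg; have s20 : 0 < s2 by exact: lt_le_trans s12.
apply: cmean_rect => // [l hl|]; first exact/hol_cont/dg.
apply: goursat; [by rewrite ler_ln ?posrE|exact: pi_le|] => z hz.
apply: (@hol_comp _ _ _ _ (@cexp R) g); first by case: (diff_cexp z).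
by apply: dg; exact: cexp_rect hz.
Qed.

Lemma cmean_const1 s1 s2 g : 0 < s1 -> s1 < 1 -> 1 < s2 ->
  (forall l, s1 <= nrm l <= s2 -> cont_at g l) ->
  (forall l : C, s1 <= nrm l <= s2 -> l != 1 -> hol_at g l) ->
  cmean s1 g = cmean s2 g.
Proof.
move=> s10 s11 s21 cg dg; have s20 : 0 < s2 by exact: lt_trans s21.
have s12 : s1 <= s2 by rewrite ltW// (lt_trans s11).
apply: cmean_rect => //.
(* The exceptional point 1 has the single preimage 0 in the rectangle, by [cexp_eq1], and
   [s1 < 1 < s2] puts it in the interior. *)
apply: (@rint_except _ _ _ _ _ _ 0) => /=.
- by rewrite -ln1 !ltr_ln ?posrE// s11 s21.
- by rewrite oppr_lt0 pi_gt0.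
- move=> z hz; apply: (@cont_comp _ _ _ (@cexp R) g).
    by apply: hol_cont; case: (diff_cexp z).
  by apply: cg; exact: cexp_rect hz.
move=> z hz z0; apply: (@hol_comp _ _ _ _ (@cexp R) g); first by case: (diff_cexp z).
apply: dg; first exact: cexp_rect hz.
apply: contra z0 => /eqP E; case: z hz E => x y [_ yI] E.
by have [-> ->] := @cexp_eq1 x y yI E.
Qed.

End CircleMean.

(** * Cauchy's formula and the maximum principle *)

Section ScalarDiff.
Context {R : realType} {V : normedModType R[i]}.
Local Notation C := R[i].
Implicit Types (f g : V -> C) (z : V).

Lemma hol_cst (c : C) z : hol_at (fun _ : V => c) z.
Proof. by split; exact: differentiable_cst. Qed.

Lemma holD f g z : hol_at f z -> hol_at g z -> hol_at (fun x => f x + g x) z.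
Proof. by move=> [df] [dg]; split; exact: (differentiableD df dg). Qed.

Lemma holB f g z : hol_at f z -> hol_at g z -> hol_at (fun x => f x - g x) z.
Proof. by move=> [df] [dg]; split; exact: (differentiableB df dg). Qed.

Lemma holM f g z : hol_at f z -> hol_at g z -> hol_at (fun x => f x * g x) z.
Proof. by move=> [df] [dg]; split; exact: (differentiableM df dg). Qed.

Lemma holV f z : hol_at f z -> f z != 0 -> hol_at (fun x => (f x)^-1) z.
Proof. by move=> [df] f0; split; exact: (differentiableV df f0). Qed.

Lemma holX f n z : hol_at f z -> hol_at (fun x => f x ^+ n) z.
Proof.
move=> df; elim: n => [|n IH]; first exact: hol_cst.
by under eq_fun do rewrite exprS; exact: holM df IH.
Qed.

Lemma hol_div f g z : hol_at f z -> hol_at g z -> g z != 0 ->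
  hol_at (fun x => f x / g x) z.
Proof. by move=> df dg g0; exact: holM df (holV dg g0). Qed.

End ScalarDiff.

Section CauchyFormula.
Context {R : realType}.
Local Notation C := R[i].
Implicit Types (f g h : C -> C) (s : R) (l w p : C).

Lemma hol_id (z : C) : hol_at (fun l : C => l) z.
Proof.
apply: (proj1 (@diffC_intro R (fun l => l) z 1 _)) => e e0; exists 1 => // h _.
rewrite [X in nrm X](_ : _ = 0); last by ring.
by rewrite nrm0 mulr_ge0 ?nrm_ge0// ltW.
Qed.

Lemma hol_scale f (w l : C) : hol_at f (l * w) ->
  hol_at (fun l : C => f (l * w)) l.
Proof.
move=> df; exact: hol_comp (holM (hol_id l) (hol_cst w l)) df.
Qed.

Lemma der_scale f (w l : C) : hol_at f (l * w) ->
  der (fun l : C => f (l * w)) l 1 = der f (l * w) 1 * w.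
Proof.
move=> df; have hw := holM (hol_id l) (hol_cst w l).
rewrite (der_comp _ hw df).
suff -> : der (fun t : C => t * w) l 1 = w by rewrite derC mulrC.
apply: (proj2 (@diffC_intro R (fun t => t * w) l w _)) => e e0; exists 1 => // h _.
rewrite [X in nrm X](_ : _ = 0); last by ring.
by rewrite nrm0 mulr_ge0 ?nrm_ge0// ltW.
Qed.

Lemma cont_circle_hol s f : (forall l, nrm l = s -> hol_at f l) ->
  cont_circle s f.
Proof. by move=> h l /h /hol_cont. Qed.

Lemma nrm_small_eq0 (z : C) : (forall e : R, 0 < e -> nrm z <= e) -> z = 0.
Proof.
move=> h; apply/eqP; rewrite -nrm_eq0 eq_le nrm_ge0 andbT.
by apply/ler_addgt0Pr => e /h; rewrite add0r.
Qed.

Lemma nrm_neq1 (l : C) : nrm l != 1 -> l != 1.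
Proof. by apply: contra => /eqP ->; rewrite nrm1. Qed.

(** Under [cmean] this is the Cauchy kernel at the point 1, since l/(l-1) times dl/l is dl/(l-1).
    Other points are reached by rescaling the variable. *)
Definition kern (l : C) : C := l / (l - 1).

Lemma hol_kern l : l != 1 -> hol_at kern l.
Proof.
move=> l1; apply: hol_div; [exact: hol_id| |by rewrite subr_eq0].
by apply: holB; [exact: hol_id|exact: hol_cst].
Qed.

Lemma kern_nrm_lt1 (l : C) : nrm l < 1 -> nrm (kern l) <= nrm l / (1 - nrm l).
Proof.
move=> l1; rewrite nrmM nrmV ler_wpM2l ?nrm_ge0// lef_pV2 ?posrE ?subr_gt0//.
  by rewrite nrmBC -{1}(@nrm1 R) nrm_lerB.
by rewrite nrm_gt0 subr_eq0 nrm_neq1// lt_eqF.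
Qed.

Lemma inv_nrm_gt1 (l : C) : 1 < nrm l -> nrm ((l - 1)^-1) <= (nrm l - 1)^-1.
Proof.
move=> l1; rewrite nrmV lef_pV2 ?posrE ?subr_gt0//.
  by rewrite -{1}(@nrm1 R) nrm_lerB.
by rewrite nrm_gt0 subr_eq0 nrm_neq1// gt_eqF.
Qed.

Lemma kern_nrm_gt1 (l : C) : 1 < nrm l -> nrm (kern l) <= nrm l / (nrm l - 1).
Proof.
by move=> l1; rewrite nrmM ler_wpM2l ?nrm_ge0// inv_nrm_gt1.
Qed.

(** The mean does not depend on the radius, and it is small at large radii. The two means of [kern]
    below are found in the same way, by letting the radius tend to 0 and to infinity. *)
Lemma cmean_inv s : 0 < s -> cmean s (fun l : C => l^-1) = 0.
Proof.
move=> s0; apply: nrm_small_eq0 => e e0.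
have d l : 0 < nrm l -> hol_at (fun l : C => l^-1) l.
  by rewrite nrm_gt0 => l0; apply: holV => //; exact: hol_id.
pose t := Num.max s e^-1.
have t0 : 0 < t by rewrite lt_max s0.
rewrite (@cmean_const _ s t)//; first last.
- by move=> l /andP[l0 _]; apply: d; exact: lt_le_trans l0.
- by rewrite le_max lexx.
apply: cmean_nrm; [exact: ltW|by apply: cont_circle_hol => l ls; apply: d; rewrite ls|].
move=> l lt; rewrite nrmV lt invf_ple ?posrE//.
by rewrite le_max lexx orbT.
Qed.

Lemma cmean_kern_lt1 s : 0 < s -> s < 1 -> cmean s kern = 0.
Proof.
move=> s0 s1; apply: nrm_small_eq0 => e e0.
have d l : nrm l < 1 -> hol_at kern l.
  by move=> l1; apply: hol_kern; rewrite nrm_neq1// lt_eqF.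
pose t := Num.min s (Num.min (1 / 2) (e / 2)).
have t0 : 0 < t by rewrite !lt_min s0 !divr_gt0.
have ts : t <= s by rewrite ge_min lexx.
have t2 : t <= 1 / 2 by rewrite !ge_min lexx orbT.
have te : t <= e / 2 by rewrite !ge_min lexx !orbT.
rewrite -(@cmean_const _ t s)//; last first.
  by move=> l /andP[_ l1]; apply: d; exact: le_lt_trans s1.
have t1 : t < 1 by lra.
apply: cmean_nrm; [exact: ltW|by apply: cont_circle_hol => l ls; apply: d; rewrite ls|].
move=> l lt; rewrite (le_trans (kern_nrm_lt1 _)) ?lt//.
by rewrite ler_pdivrMr ?subr_gt0//; nra.
Qed.

Lemma cmean_kern_gt1 s : 1 < s -> cmean s kern = 1.
Proof.
move=> s1; apply/eqP; rewrite -subr_eq0; apply/eqP; apply: nrm_small_eq0 => e e0.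
have s0 : 0 < s by exact: lt_trans s1.
have d l : 1 < nrm l -> hol_at kern l.
  by move=> l1; apply: hol_kern; rewrite nrm_neq1// gt_eqF.
pose t := Num.max s (1 + e^-1).
have ts : s <= t by rewrite le_max lexx.
have t1 : 1 < t by exact: lt_le_trans ts.
have t0 : 0 < t by exact: lt_trans t1.
have te : 1 + e^-1 <= t by rewrite le_max lexx orbT.
rewrite (@cmean_const _ s t)//; last first.
  by move=> l /andP[l1 _]; apply: d; exact: lt_le_trans l1.
rewrite -[X in _ - X](@cmean_cst R t) -(cmeanB (ltW t0)); first last.
- by move=> l _; exact: cont_cst.
- by apply: cont_circle_hol => l lt; apply: d; rewrite lt.
have E l : nrm l = t -> kern l - 1 = (l - 1)^-1.
  move=> lt; rewrite /kern; field.
  by rewrite subr_eq0 nrm_neq1// lt gt_eqF.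
rewrite (cmean_ext (ltW t0) E); apply: cmean_nrm; first exact: ltW.
  apply: cont_circle_hol => l lt; apply: holV.
    by apply: holB; [exact: hol_id|exact: hol_cst].
  by rewrite subr_eq0 nrm_neq1// lt gt_eqF.
move=> l lt; rewrite (le_trans (inv_nrm_gt1 _)) ?lt//.
rewrite invf_ple ?posrE ?subr_gt0//; lra.
Qed.

(** The difference quotient with its removable value. At [p] only continuity is known at this stage;
    for [p = 1] this is the exception that [cmean_const1] allows. *)
Definition dquot f (p l : C) : C :=
  if l == p then der f p 1 else (f l - f p) / (l - p).

Lemma dquot_cont f p : hol_at f p -> cont_at (dquot f p) p.
Proof.
move=> df; apply: cont_at_eps => e e0.
have e2 : 0 < e / 2 by rewrite divr_gt0.
have [d d0 hd] := hol_eps df e2.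
exists d => // w hw; rewrite /dquot eqxx; case: ifPn => [_|wp].
  by rewrite subrr nrm0.
have wp0 : w - p != 0 by rewrite subr_eq0.
have := hd _ hw; rewrite [p + _]addrC subrK derC => H.
have -> : (f w - f p) / (w - p) - der f p 1 =
  (f w - f p - (w - p) * der f p 1) / (w - p) by field.
rewrite nrmM nrmV ltr_pdivrMr ?nrm_gt0//; apply: (le_lt_trans H).
by rewrite ltr_pM2r ?nrm_gt0// ltr_pdivrMr//; lra.
Qed.

Lemma dquot_hol f p l : l != p -> hol_at f l ->
  hol_at (dquot f p) l.
Proof.
move=> lp df; have np : 0 < nrm (l - p) by rewrite nrm_gt0 subr_eq0.
apply: (@hol_eq_near R _ _ (dquot f p) (fun l => (f l - f p) / (l - p))).
  apply: (near_nrm np) => w wl; rewrite /dquot; case: eqP => // wp.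
  by move: wl; rewrite wp nrmBC ltxx.
apply: hol_div; last by rewrite subr_eq0.
  by apply: holB => //; exact: hol_cst.
by apply: holB; [exact: hol_id|exact: hol_cst].
Qed.

(** [l * dquot h 1 l] has equal means on both circles and equals [(h l - h 1) * kern l] there; the
    mean of [kern] is 0 on the inner and 1 on the outer circle, which isolates [h 1]. *)
Lemma cauchy_annulus s1 s2 h : 0 < s1 -> s1 < 1 -> 1 < s2 ->
  (forall l, s1 <= nrm l <= s2 -> hol_at h l) ->
  h 1 = cmean s2 (fun l => h l * kern l) - cmean s1 (fun l => h l * kern l).
Proof.
move=> s10 s11 s21 dh; have s20 : 0 < s2 by exact: lt_trans s21.
have d1 : hol_at h (1 : C) by apply: dh; rewrite nrm1 !ltW.
have cg : cmean s1 (fun l => l * dquot h 1 l) = cmean s2 (fun l => l * dquot h 1 l).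
  apply: (cmean_const1 s10 s11 s21) => l hl.
    apply: (contM (cont_id l)); have [->|l1] := eqVneq l 1.
      exact: dquot_cont d1.
    exact: hol_cont (dquot_hol l1 (dh l hl)).
  by move=> l1; exact: holM (hol_id l) (dquot_hol l1 (dh l hl)).
have K s : 0 < s -> s != 1 -> s1 <= s <= s2 ->
   cmean s (fun l => l * dquot h 1 l) =
   cmean s (fun l => h l * kern l) - h 1 * cmean s kern.
  move=> s0 sn1 sI.
  have n1 l : nrm l = s -> l != 1 by move=> ls; rewrite nrm_neq1// ls.
  have ck : cont_circle s kern.
    by apply: cont_circle_hol => l /n1; exact: hol_kern.
  have ch : cont_circle s h by apply: cont_circle_hol => l ls; apply: dh; rewrite ls.
  have chk : cont_circle s (fun l => h l * kern l).
    by move=> l ls; apply: (contM (ch l ls) (ck l ls)).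
  have chk1 : cont_circle s (fun l => h 1 * kern l).
    by move=> l ls; apply: (contM (cont_cst (h 1) _) (ck l ls)).
  rewrite -(cmeanZ _ (ltW s0) ck) -(cmeanB (ltW s0) chk chk1).
  apply: cmean_ext; first exact: ltW.
  move=> l /n1 l1; rewrite /dquot (negbTE l1) /kern; field.
  by rewrite subr_eq0.
have := cg; rewrite !K//; first last.
- by rewrite lexx ltW// (lt_trans s11).
- by rewrite lt_eqF.
- by rewrite lexx andbT ltW// (lt_trans s11).
- by rewrite gt_eqF.
rewrite cmean_kern_lt1// cmean_kern_gt1// mulr1 mulr0 subr0 => ->.
by rewrite opprB addrC subrK.
Qed.

Definition bounded_near0 h := exists B d : R,
  [/\ 0 < B, 0 < d & forall l, 0 < nrm l -> nrm l < d -> nrm (h l) <= B].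

(** The inner term of [cauchy_annulus] is at most [B * (t / (1 - t))] at radius [t], so it
    disappears as [t] tends to 0; boundedness near 0 stands in for holomorphy there. *)
Lemma cauchy_punctured s h : 1 < s ->
  (forall l, 0 < nrm l -> nrm l <= s -> hol_at h l) ->
  bounded_near0 h -> h 1 = cmean s (fun l => h l * kern l).
Proof.
move=> s1 dh [B [d [B0 d0 hB]]]; apply/eqP; rewrite -subr_eq0; apply/eqP.
apply: nrm_small_eq0 => e e0.
pose t := Num.min (d / 2) (Num.min (1 / 2) (e / (2 * B))).
have t0 : 0 < t by rewrite !lt_min !divr_gt0// mulr_gt0.
have td : t < d.
  by apply: (@le_lt_trans _ _ (d / 2)); [rewrite ge_min lexx|lra].
have t2 : t <= 1 / 2 by rewrite !ge_min lexx orbT.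
have te : t <= e / (2 * B) by rewrite !ge_min lexx !orbT.
have t1 : t < 1 by lra.
rewrite (@cauchy_annulus t s)//; last first.
  by move=> l /andP[l1 l2]; apply: dh => //; exact: lt_le_trans l1.
rewrite addrAC subrr add0r nrmN; apply: cmean_nrm; first exact: ltW.
  apply: cont_circle_hol => l lt; apply: holM.
    by apply: dh; rewrite lt// ltW// (lt_trans t1).
  by apply: hol_kern; rewrite nrm_neq1// lt lt_eqF.
move=> l lt; rewrite nrmM; apply: (@le_trans _ _ (B * (t / (1 - t)))).
  apply: ler_pM; rewrite ?nrm_ge0//; first by apply: hB; rewrite lt.
  by have := @kern_nrm_lt1 l; rewrite lt => /(_ t1).
rewrite mulrA ler_pdivrMr ?subr_gt0//.
move: te; rewrite ler_pdivlMr ?mulr_gt0// => te; nra.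
Qed.

(** By Bernoulli's inequality the powers of [a / K > 1] would be unbounded. The lemma strips the
    constant factor off an estimate valid for all powers. *)
Lemma le_of_pow (a K c : R) : 0 <= a -> 0 <= K ->
  (forall N, a ^+ N <= K ^+ N * c) -> a <= K.
Proof.
move=> a0 K0 h; rewrite leNgt; apply/negP => Ka.
have [K00|Kn0] := eqVneq K 0.
  by have := h 1%N; rewrite !expr1 K00 mul0r leNgt -{1}K00 Ka.
have Kp : 0 < K by rewrite lt_neqAle eq_sym Kn0.
pose r := a / K; have r1 : 0 < r - 1 by rewrite subr_gt0 ltr_pdivlMr ?mul1r.
have rN N : 1 + (r - 1) *+ N <= r ^+ N.
  elim: N => [|N IH]; first by rewrite mulr0n addr0.
  rewrite exprS; apply: (@le_trans _ _ (r * (1 + (r - 1) *+ N))); last first.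
    by rewrite ler_wpM2l// divr_ge0.
  rewrite mulrS -mulr_natr -subr_ge0.
  rewrite [X in 0 <= X](_ : _ = (r - 1) ^+ 2 * N%:R); last by ring.
  by rewrite mulr_ge0// sqr_ge0.
have rc N : r ^+ N <= c.
  rewrite /r expr_div_n ler_pdivrMr ?exprn_gt0// mulrC; exact: h.
have := archi_boundP (normr_ge0 (c / (r - 1))); set N := Num.bound _.
have := le_trans (rN N) (rc N); rewrite -mulr_natr => H1 H2.
have : c / (r - 1) < N%:R by exact: le_lt_trans (ler_norm _) H2.
by rewrite ltr_pdivrMr// => H3; lra.
Qed.

(** Cauchy's formula for [h ^+ N] gives [nrm (h 1) ^+ N <= K ^+ N * (s / (s - 1))]; letting [N] grow
    removes the factor that comes from the kernel. *)
Lemma max_principle1 s h (K : R) : 1 < s ->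
  (forall l, 0 < nrm l -> nrm l <= s -> hol_at h l) ->
  bounded_near0 h -> (forall l, nrm l = s -> nrm (h l) <= K) -> nrm (h 1) <= K.
Proof.
move=> s1 dh [B [d [B0 d0 hB]]] hK; have s0 : 0 < s by exact: lt_trans s1.
have K0 : 0 <= K.
  by apply: le_trans (hK s%:C _); rewrite ?nrm_ge0// nrm_pos// ltW.
apply: (@le_of_pow _ _ (s / (s - 1))); rewrite ?nrm_ge0// => N.
rewrite -nrmX; have -> : h 1 ^+ N = cmean s (fun l => h l ^+ N * kern l).
  apply: (@cauchy_punctured s (fun l => h l ^+ N)) => // [l l0 ls|].
    by apply: holX; exact: dh.
  exists (B ^+ N), d; split; rewrite ?exprn_gt0// => l l0 ld.
  rewrite nrmX; apply: lerXn2r; rewrite ?nnegrE ?nrm_ge0//; first exact: ltW.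
    exact: hB.
apply: cmean_nrm; first exact: ltW.
  apply: cont_circle_hol => l lt; apply: holM.
    by apply: holX; apply: dh; rewrite lt.
  by apply: hol_kern; rewrite nrm_neq1// lt gt_eqF.
move=> l ls; rewrite nrmM; apply: ler_pM; rewrite ?nrm_ge0//.
  by rewrite nrmX lerXn2r ?nnegrE ?nrm_ge0// hK.
by have := @kern_nrm_gt1 l; rewrite ls => /(_ s1).
Qed.

Lemma max_principle0 s f (K : R) (w : C) :
  (forall l, 0 < nrm l -> nrm l <= s -> hol_at f l) ->
  bounded_near0 f -> (forall l, nrm l = s -> nrm (f l) <= K) ->
  0 < nrm w -> nrm w <= s -> nrm (f w) <= K.
Proof.
move=> df [B [d [B0 d0 hB]]] hK w0; rewrite le_eqVlt => /predU1P[/hK//|ws].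
have -> : f w = (fun l => f (l * w)) 1 by rewrite mul1r.
apply: (@max_principle1 (s / nrm w) (fun l => f (l * w))); first by rewrite ltr_pdivlMr// mul1r.
- move=> l l0 ls; apply: hol_scale; apply: df; rewrite nrmM ?mulr_gt0//.
  by rewrite -ler_pdivlMr.
- exists B, (d / nrm w); split; rewrite ?divr_gt0// => l l0 ld.
  by apply: hB; rewrite nrmM ?mulr_gt0// -ltr_pdivlMr.
- by move=> l ls; apply: hK; rewrite nrmM ls mulfVK// gt_eqF.
Qed.

Lemma cmean_center s f : 0 < s ->
  (forall l, nrm l <= s -> hol_at f l) -> cmean s f = f 0.
Proof.
move=> s0 df; apply/eqP; rewrite -subr_eq0; apply/eqP.
apply: nrm_small_eq0 => e e0.
have /cont_eps/(_ _ e0)[d dp hd] : cont_at f 0.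
  by apply: hol_cont; apply: df; rewrite nrm0 ltW.
pose t := Num.min s (d / 2).
have t0 : 0 < t by rewrite lt_min s0 divr_gt0.
have ts : t <= s by rewrite ge_min lexx.
have td : t < d by apply: (@le_lt_trans _ _ (d / 2)); [rewrite ge_min lexx orbT|lra].
have dts l : t <= nrm l <= s -> hol_at f l by move=> /andP[_ /df].
rewrite -(cmean_const t0 ts dts).
have cf : cont_circle t f by apply: cont_circle_hol => l lt; apply: df; rewrite lt.
rewrite -[X in _ - X](@cmean_cst R t) -(cmeanB (ltW t0) cf); last first.
  by move=> l _; exact: cont_cst.
apply: cmean_nrm; first exact: ltW.
  by move=> l lt; exact: contB (cf l lt) (cont_cst _ _).
by move=> l lt; rewrite ltW// hd// subr0 lt.
Qed.

Lemma max_principle s f (K : R) (w : C) : 0 < s ->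
  (forall l, nrm l <= s -> hol_at f l) ->
  (forall l, nrm l = s -> nrm (f l) <= K) -> nrm w <= s -> nrm (f w) <= K.
Proof.
move=> s0 df hK ws; have [->|w0] := eqVneq w 0.
  rewrite -(cmean_center s0 df); apply: cmean_nrm; rewrite ?ltW//.
  by apply: cont_circle_hol => l ls; apply: df; rewrite ls.
apply: (@max_principle0 s) => //; rewrite ?nrm_gt0//; first by move=> l _; exact: df.
have /cont_eps/(_ _ ltr01)[d d0 hd] : cont_at f 0.
  by apply: hol_cont; apply: df; rewrite nrm0 ltW.
exists (nrm (f 0) + 1), d; split=> //; first by rewrite ltr_wpDl// nrm_ge0.
move=> l _ ld; rewrite -[f l](subrK (f 0)) addrC (le_trans (nrmD _ _))// lerD2l.
by rewrite ltW// hd// subr0.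
Qed.

Lemma cauchy_deriv s f : 0 < s ->
  (forall l, nrm l <= s -> hol_at f l) ->
  der f 0 1 = cmean s (fun l => f l / l).
Proof.
move=> s0 df; have d0 : hol_at f 0 by apply: df; rewrite nrm0 ltW.
have dq l : 0 < nrm l -> nrm l <= s -> hol_at (dquot f 0) l.
  by rewrite nrm_gt0 => l0 ls; exact: dquot_hol l0 (df l ls).
have n0 l t : 0 < t -> nrm l = t -> l != 0 by move=> t0 lt; rewrite -nrm_gt0 lt.
have E : cmean s (fun l => f l / l) = cmean s (dquot f 0).
  have cf : cont_circle s (fun l => f l / l).
    apply: cont_circle_hol => l ls; apply: hol_div; [|exact: hol_id|exact: n0 ls].
    by apply: df; rewrite ls.
  have ci : cont_circle s (fun l : C => l^-1).
    apply: cont_circle_hol => l ls; apply: holV; [exact: hol_id|exact: n0 ls].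
  have ci0 : cont_circle s (fun l : C => f 0 * l^-1).
    by move=> l ls; apply: (contM (cont_cst (f 0) _) (ci l ls)).
  have -> : cmean s (fun l => f l / l) =
     cmean s (fun l => f l / l) - f 0 * cmean s (fun l : C => l^-1).
    by rewrite cmean_inv// mulr0 subr0.
  rewrite -(cmeanZ _ (ltW s0) ci) -(cmeanB (ltW s0) cf ci0).
  apply: cmean_ext; [exact: ltW|move=> l /(n0 _ _ s0) l0].
  by rewrite /dquot (negbTE l0) subr0 mulrBl.
apply/esym/eqP; rewrite E -subr_eq0; apply/eqP; apply: nrm_small_eq0 => e e0.
have /cont_eps/(_ _ e0)[d dp hd] := dquot_cont d0.
pose t := Num.min s (d / 2).
have t0 : 0 < t by rewrite lt_min s0 divr_gt0.
have ts : t <= s by rewrite ge_min lexx.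
have td : t < d by apply: (@le_lt_trans _ _ (d / 2)); [rewrite ge_min lexx orbT|lra].
have dts l : t <= nrm l <= s -> hol_at (dquot f 0) l.
  by move=> /andP[l1 l2]; exact: dq (lt_le_trans t0 l1) l2.
rewrite -(cmean_const t0 ts dts).
have cf : cont_circle t (dquot f 0).
  by apply: cont_circle_hol => l lt; apply: dq; rewrite lt.
rewrite -[X in _ - X](@cmean_cst R t) -(cmeanB (ltW t0) cf); last first.
  by move=> l _; exact: cont_cst.
apply: cmean_nrm; first exact: ltW.
  by move=> l lt; exact: contB (cf l lt) (cont_cst _ _).
move=> l lt; have := hd l; rewrite subr0 lt => /(_ td).
by rewrite {2}/dquot eqxx => /ltW.
Qed.

Lemma cauchy_deriv_le s f (K : R) : 0 < s ->
  (forall l, nrm l <= s -> hol_at f l) ->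
  (forall l, nrm l = s -> nrm (f l) <= K) -> nrm (der f 0 1) <= K / s.
Proof.
move=> s0 df hK; rewrite (cauchy_deriv s0 df).
have n0 l : nrm l = s -> l != 0 by move=> lt; rewrite -nrm_gt0 lt.
apply: cmean_nrm; first exact: ltW.
  apply: cont_circle_hol => l ls; apply: hol_div; [|exact: hol_id|exact: n0 ls].
  by apply: df; rewrite ls.
by move=> l ls; rewrite nrmM nrmV ls ler_wpM2r ?invr_ge0 ?(ltW s0)// hK.
Qed.

Lemma taylor_lipschitz s f (K : R) w : 0 < s ->
  (forall l, nrm l <= s -> hol_at f l) ->
  (forall l, nrm l = s -> nrm (f l) <= K) -> nrm w <= s ->
  nrm (f w - f 0) <= 2 * K / s * nrm w.
Proof.
move=> s0 df hK ws; have [->|w0] := eqVneq w 0.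
  by rewrite subrr nrm0 mulr0.
have K2 l : nrm l = s -> nrm (f l - f 0) <= 2 * K.
  move=> ls; rewrite (le_trans (nrmB _ _))// mulrDl mul1r; apply: lerD.
    exact: hK.
  by apply: (max_principle s0 df hK); rewrite nrm0 ltW.
have d0 : hol_at f 0 by apply: df; rewrite nrm0 ltW.
have wn : 0 < nrm w by rewrite nrm_gt0.
have : nrm (dquot f 0 w) <= 2 * K / s.
  apply: (@max_principle0 s) => //.
  - by move=> l; rewrite nrm_gt0 => l0 ls; exact: dquot_hol l0 (df l ls).
  - have /cont_eps/(_ _ ltr01)[d dp hd] := dquot_cont d0.
    exists (nrm (dquot f 0 0) + 1), d; split=> //; first by rewrite ltr_wpDl// nrm_ge0.
    move=> l _ ld; rewrite -[dquot f 0 l](subrK (dquot f 0 0)) addrC.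
    by rewrite (le_trans (nrmD _ _))// lerD2l ltW// hd// subr0.
  move=> l ls; have l0 : l != 0 by rewrite -nrm_gt0 ls.
  rewrite /dquot (negbTE l0) subr0 nrmM nrmV ls ler_wpM2r ?invr_ge0 ?(ltW s0)//.
  exact: K2.
by rewrite /dquot (negbTE w0) subr0 nrmM nrmV ler_pdivrMr.
Qed.

(** [f w], [f 0] and [der f 0 1 * w] are the means of one function [u] against [kern l], 1 and
    [l^-1]; the difference of these kernels is [l^-1 * (l - 1)^-1], of second order in the inverse
    radius. *)
Lemma taylor2 s f (K : R) w : 0 < s ->
  (forall l, nrm l <= s -> hol_at f l) ->
  (forall l, nrm l = s -> nrm (f l) <= K) -> nrm w <= s / 2 ->
  nrm (f w - f 0 - der f 0 1 * w) <= 2 * K / s ^+ 2 * nrm w ^+ 2.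
Proof.
move=> s0 df hK ws; have [->|w0] := eqVneq w 0.
  by rewrite subrr mulr0 subrr nrm0 expr0n mulr0.
have wn : 0 < nrm w by rewrite nrm_gt0.
(* Rescaling puts [w] at the point 1 of a disc of radius [t]; the bound [nrm w <= s / 2] gives
   [t >= 2], whence [(t - 1)^-1 <= 2 / t]. *)
pose t := s / nrm w; pose u l := f (l * w).
have t2 : 2 <= t by rewrite ler_pdivlMr//; move: ws; lra.
have t1 : 1 < t by lra.
have t0 : 0 < t by lra.
have tw : t * nrm w = s by rewrite /t mulfVK// gt_eqF.
have lw l : nrm l <= t -> nrm (l * w) <= s by move=> lt; rewrite nrmM -tw ler_wpM2r// ltW.
have du l : nrm l <= t -> hol_at u l.
  by move=> lt; apply: hol_scale; apply: df; exact: lw.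
have uK l : nrm l = t -> nrm (u l) <= K by move=> lt; apply: hK; rewrite nrmM lt tw.
have K0 : 0 <= K by apply: le_trans (hK s%:C _); rewrite ?nrm_ge0// nrm_pos// ltW.
have n0 l : nrm l = t -> l != 0 by move=> lt; rewrite -nrm_gt0 lt.
have n1 l : nrm l = t -> l != 1 by move=> lt; rewrite nrm_neq1// lt gt_eqF.
have E1 : f w = cmean t (fun l => u l * kern l).
  rewrite -[w in LHS]mul1r -/(u 1); apply: cauchy_punctured => //.
    by move=> l _; exact: du.
  exists (K + 1), t; split=> //; first lra.
  move=> l _ lt; rewrite (@le_trans _ _ K) ?lerDl//.
  by apply: (max_principle t0 du uK); exact: ltW.
have E2 : f 0 = cmean t u by rewrite (cmean_center t0 du) /u mul0r.
have E3 : der f 0 1 * w = cmean t (fun l => u l / l).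
  rewrite -(cauchy_deriv t0 du).
  have d0' : hol_at f (0 * w) by rewrite mul0r; apply: df; rewrite nrm0 ltW.
  by rewrite (der_scale d0') mul0r.
have cu : cont_circle t u by apply: cont_circle_hol => l lt; apply: du; rewrite lt.
have cul : cont_circle t (fun l => u l / l).
  apply: cont_circle_hol => l lt; apply: hol_div; [|exact: hol_id|exact: n0].
  by apply: du; rewrite lt.
have cuk : cont_circle t (fun l => u l * kern l).
  apply: cont_circle_hol => l lt; apply: holM; first by apply: du; rewrite lt.
  by apply: hol_kern; exact: n1.
have cukB : cont_circle t (fun l => u l * kern l - u l).
  by move=> l lt; exact: contB (cuk l lt) (cu l lt).
rewrite E1 E2 E3 -(cmeanB (ltW t0) cuk cu) -(cmeanB (ltW t0) cukB cul).
apply: cmean_nrm; first exact: ltW.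
  by move=> l lt; exact: contB (cukB l lt) (cul l lt).
move=> l lt; have -> : u l * kern l - u l - u l / l = u l * (l^-1 * (l - 1)^-1).
  by rewrite /kern; field; rewrite subr_eq0 (n0 _ lt) (n1 _ lt).
rewrite !nrmM nrmV lt.
have := @inv_nrm_gt1 l; rewrite lt => /(_ t1) H.
have -> : 2 * K / s ^+ 2 * nrm w ^+ 2 = K * (t^-1 * (2 / t)).
  by rewrite /t; field; rewrite ?gt_eqF.
apply: ler_pM; rewrite ?nrm_ge0 ?mulr_ge0 ?invr_ge0 ?nrm_ge0 ?(ltW t0)//.
  exact: uK.
rewrite ler_wpM2l ?invr_ge0 ?(ltW t0)// (le_trans H)//.
by rewrite ler_pdivlMr// mulrC ler_pdivrMr ?subr_gt0//; lra.
Qed.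

End CauchyFormula.

(** * Several variables *)

Section LinearIntro.
Context {R : realType} {V W : normedModType R[i]}.
Local Notation C := R[i].

Lemma hol_introf (f : V -> W) (z : V) (L : V -> W) (K : R) :
  (forall (a : C) u v, L (a *: u + v) = a *: L u + L v) ->
  (forall h, nrm (L h) <= K * nrm h) ->
  (forall e : R, 0 < e -> exists2 d : R, 0 < d & forall h, nrm h < d ->
    nrm (f (z + h) - f z - L h) <= e * nrm h) ->
  hol_at f z /\ forall h, der f z h = L h.
Proof.
move=> linL hK hf.
pose Lm := @GRing.isLinear.Build C V W *:%R L linL.
pose LL : {linear V -> W} := HB.pack L Lm.
exact: (@hol_intro R V W f z LL K hK hf).
Qed.

End LinearIntro.

Section SeveralVariables.
Context {R : realType} {V : normedModType R[i]}.
Local Notation C := R[i].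
Implicit Types (f g : V -> C) (z w h e : V) (l : C).

Definition hol_near (W : normedModType C) (f : V -> W) z :=
  exists2 r : R, 0 < r & forall w, nrm (w - z) < r -> hol_at f w.

Lemma hol_near_at (W : normedModType C) (f : V -> W) z : hol_near f z -> hol_at f z.
Proof. by case=> r r0; apply; rewrite subrr nrm0. Qed.

Lemma hol_line f z h (l : C) : hol_at f (z + l *: h) ->
  hol_at (fun l => f (z + l *: h)) l /\
  der (fun l => f (z + l *: h)) l 1 = der f (z + l *: h) h.
Proof.
move=> df; apply: diffC_intro => e e0.
have h1 : 0 < nrm h + 1 by rewrite ltr_wpDl ?nrm_ge0.
have [d d0 hd] := hol_eps df (divr_gt0 e0 h1).
exists (d / (nrm h + 1)); first exact: divr_gt0.
move=> k hk; have kh : nrm (k *: h) <= nrm k * (nrm h + 1).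
  by rewrite nrmZ ler_wpM2l ?nrm_ge0// lerDl.
have := hd (k *: h); rewrite derZ -[k *: der _ _ _]/(k * _).
have -> : z + (l + k) *: h = z + l *: h + k *: h by rewrite scalerDl addrA.
rewrite (mulrC _ k) => H.
apply: (le_trans (H _)); first by apply: le_lt_trans kh _; rewrite -ltr_pdivlMr.
rewrite -mulrA ler_wpM2l ?(ltW e0)// ler_pdivrMl// (le_trans kh)//.
by rewrite mulrC.
Qed.

Lemma hol_shift (W : normedModType C) (f : V -> W) h w :
  hol_at f (w + h) -> hol_at (fun w => f (w + h)) w.
Proof.
move=> df; apply: (@hol_comp _ _ _ _ (fun w => w + h) f) df.
apply: (proj1 (@hol_introf R V V (fun w => w + h) w id 1 _ _ _)) => //.
  by move=> k; rewrite mul1r.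
move=> e' e'0; exists 1 => // k _.
rewrite [X in nrm X](_ : _ = 0); first by rewrite nrm0 mulr_ge0 ?nrm_ge0// ltW.
by rewrite [w + k + h]addrAC [w + h + k]addrC addrK subrr.
Qed.

Definition hol_ball f z (r M : R) :=
  forall w, nrm (w - z) <= r -> hol_at f w /\ nrm (f w) <= M.

Lemma unit_direction h : h != 0 ->
  let e := (nrm h)^-1%:C *: h in nrm e = 1 /\ h = (nrm h)%:C *: e.
Proof.
move=> h0 /=; have hn : nrm h != 0 by rewrite nrm_eq0.
rewrite nrmZ nrm_pos ?invr_ge0 ?nrm_ge0// mulVf//; split => //.
by rewrite scalerA -rmorphM/= divff// scale1r.
Qed.

Lemma ball_line f z e r M (l : C) : nrm e = 1 -> hol_ball f z r M ->
  nrm l <= r -> hol_at (fun l => f (z + l *: e)) l /\ nrm (f (z + l *: e)) <= M.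
Proof.
move=> e1 hb lr; have [|h1 h2] := hb (z + l *: e).
  by rewrite addrAC subrr add0r nrmZ e1 mulr1.
by split=> //; case: (hol_line h1).
Qed.

Lemma ball_taylor2 f z r M h : 0 < r -> hol_ball f z r M -> nrm h <= r / 2 ->
  nrm (f (z + h) - f z - der f z h) <= 2 * M / r ^+ 2 * nrm h ^+ 2.
Proof.
move=> r0 hb hr; have [->|h0] := eqVneq h 0.
  by rewrite addr0 subrr der0 subrr !nrm0 expr0n mulr0.
have [e1 hE] := unit_direction h0; move: e1 hE; set e := _ *: h => e1 hE.
have B := fun l => @ball_line f z e r M l e1 hb.
have := @taylor2 R r (fun l => f (z + l *: e)) M (nrm h)%:C r0
  (fun l lr => proj1 (B l lr)).
rewrite -hE scale0r addr0 nrm_pos ?nrm_ge0//.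
have -> : der (fun l => f (z + l *: e)) 0 1 * (nrm h)%:C = der f z h.
  rewrite mulrC hE derZ -hE; congr (_ * _).
  have [|_ ->] := @hol_line f z e 0; rewrite scale0r addr0//.
  by apply: (proj1 (hb _ _)); rewrite subrr nrm0 ltW.
by apply => // l lr; apply: (proj2 (B l _)); rewrite lr.
Qed.

Lemma ball_lipschitz f z r M h : 0 < r -> hol_ball f z r M -> nrm h <= r ->
  nrm (f (z + h) - f z) <= 2 * M / r * nrm h.
Proof.
move=> r0 hb hr; have [->|h0] := eqVneq h 0.
  by rewrite addr0 subrr !nrm0 mulr0.
have [e1 hE] := unit_direction h0; move: e1 hE; set e := _ *: h => e1 hE.
have B := fun l => @ball_line f z e r M l e1 hb.
have := @taylor_lipschitz R r (fun l => f (z + l *: e)) M (nrm h)%:C r0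
  (fun l lr => proj1 (B l lr)).
rewrite -hE scale0r addr0 nrm_pos ?nrm_ge0//.
by apply => // l lr; apply: (proj2 (B l _)); rewrite lr.
Qed.

Lemma ball_der_le f z r M h : 0 < r -> hol_ball f z r M ->
  nrm (der f z h) <= M / r * nrm h.
Proof.
move=> r0 hb; have [->|h0] := eqVneq h 0; first by rewrite der0 !nrm0 mulr0.
have [e1 hE] := unit_direction h0; move: e1 hE; set e := _ *: h => e1 hE.
have B := fun l => @ball_line f z e r M l e1 hb.
rewrite {1}hE derZ nrmM nrm_pos ?nrm_ge0// mulrC ler_wpM2r ?nrm_ge0//.
have := @cauchy_deriv_le R r (fun l => f (z + l *: e)) M r0
  (fun l lr => proj1 (B l lr)).
have [|_ ->] := @hol_line f z e 0; rewrite scale0r addr0//.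
  by apply: (proj1 (hb _ _)); rewrite subrr nrm0 ltW.
by apply => // l lr; apply: (proj2 (B l _)); rewrite lr.
Qed.

Lemma hol_near_ball f z : hol_near f z ->
  exists r M : R, [/\ 0 < r, 0 < M & hol_ball f z r M].
Proof.
move=> hf; have [r r0 hr] := hf.
have [d d0 hd] := cont_eps (hol_cont (hol_near_at hf)) ltr01.
exists (Num.min r d / 2), (nrm (f z) + 1).
have m0 : 0 < Num.min r d by rewrite lt_min r0.
have m2 : Num.min r d / 2 < Num.min r d by lra.
split; [by rewrite divr_gt0|by rewrite ltr_wpDl ?nrm_ge0|].
move=> w /le_lt_trans/(_ m2); rewrite lt_min => /andP[wr wd].
split; first exact: hr.
rewrite -[f w](subrK (f z)) addrC (le_trans (nrmD _ _))// lerD2l ltW//.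
exact: hd.
Qed.

Lemma hol_ball_sub f z w r M r' : hol_ball f z r M ->
  nrm (w - z) + r' <= r -> hol_ball f w r' M.
Proof.
move=> hb h v vr; apply: hb; apply: le_trans h.
by rewrite (le_trans (nrmBD w v z))// addrC lerD2l.
Qed.

(** The increment [D w = f (w + h) - f w] is itself holomorphic and of order [nrm h], so Cauchy's
    estimates make it Lipschitz with a constant of order [nrm h]; passing from [D y] to [D z] then
    costs only a small multiple of [nrm h]. *)
Lemma strict_diff f z : hol_near f z -> forall e : R, 0 < e ->
  exists2 d : R, 0 < d & forall x y, nrm (x - z) < d -> nrm (y - z) < d ->
    nrm (f x - f y - der f z (x - y)) <= e * nrm (x - y).
Proof.
move=> /hol_near_ball[r [M [r0 M0 hb]]] e e0.
(* The first summand is the Lipschitz constant of [D] on the ball of radius [r / 4]; the second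
   comes from [ball_taylor2] for [f] at [z], one factor [nrm h] being bounded by [2 * d]. *)
pose K := 2 * (2 * M / (r / 2)) / (r / 4) + 2 * (2 * M / r ^+ 2).
have K0 : 0 < K by rewrite addr_gt0// !(mulr_gt0, invr_gt0, exprn_gt0).
pose d := Num.min (r / 8) (e / K).
have d0 : 0 < d by rewrite lt_min !divr_gt0.
have dr : d <= r / 8 by rewrite ge_min lexx.
have dK : d * K <= e by rewrite -ler_pdivlMr// ge_min lexx orbT.
exists d => // x y xd yd; pose h := x - y.
have hd : nrm h <= 2 * d.
  have := nrmBD z x y; rewrite [nrm (z - y)]nrmBC -/h; lra.
have -> : x = y + h by rewrite addrC subrK.
rewrite [y + h]addrC addrK [h + y]addrC.
pose D w := f (w + h) - f w.
have hD : hol_ball D z (r / 4) (2 * M / (r / 2) * nrm h).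
  move=> w wr; have hbw : hol_ball f w (r / 2) M by apply: (hol_ball_sub hb); lra.
  split; last by apply: ball_lipschitz => //; lra.
  have whr : nrm (w + h - z) <= r by rewrite addrAC (le_trans (nrmD _ _))//; lra.
  have wr' : nrm (w - z) <= r by lra.
  apply: holB; last by case: (hb w wr').
  by apply: hol_shift; case: (hb _ whr).
have t1 : nrm (D y - D z) <= 2 * (2 * M / (r / 2) * nrm h) / (r / 4) * nrm (y - z).
  have := @ball_lipschitz D z (r / 4) _ (y - z) _ hD.
  by rewrite [z + _]addrC subrK; apply; rewrite ?divr_gt0//; lra.
have t2 : nrm (D z - der f z h) <= 2 * M / r ^+ 2 * nrm h ^+ 2.
  by apply: ball_taylor2 => //; lra.
rewrite -/(D y) -[X in nrm X](subrKA (D z)) (le_trans (nrmD _ _))//.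
apply: (le_trans (lerD t1 t2)).
apply: (@le_trans _ _ (d * K * nrm h)); last by rewrite ler_wpM2r ?nrm_ge0.
rewrite /K mulrDr mulrDl; apply: lerD.
  rewrite -mulrA [X in X <= _](_ : _ =
    nrm (y - z) * (2 * (2 * M / (r / 2)) / (r / 4)) * nrm h); last by ring.
  rewrite ler_wpM2r ?nrm_ge0// ler_wpM2r ?(ltW yd)//.
  by rewrite !mulr_ge0 ?invr_ge0 ?mulr_ge0 ?(ltW M0) ?(ltW r0)// invr_ge0 mulr_ge0// ltW.
rewrite [nrm h ^+ 2]expr2 mulrA ler_wpM2r ?nrm_ge0//.
have a0 : 0 <= 2 * M / r ^+ 2 by rewrite divr_ge0 ?sqr_ge0// mulr_ge0// ltW.
by move: (2 * M / r ^+ 2) a0 => a a0; nra.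
Qed.

End SeveralVariables.

Section ParametricMean.
Context {R : realType} {V : normedModType R[i]}.
Local Notation C := R[i].
Implicit Types (l : C).

(** The derivative is the mean of the derivatives, because the Taylor error is quadratic uniformly
    in [l]. The functions are bounded uniformly on a neighbourhood [O] of the circle, and not just
    on it, in order to show that their derivatives are continuous in [l]. *)
Lemma hol_cmean (s r M : R) (O : set C) (Phi : C -> V -> C) (z : V) :
  0 < s -> 0 < r ->
  (forall l, nrm l = s -> exists2 d : R, 0 < d &
    forall l', nrm (l' - l) < d -> O l') ->
  (forall l, O l -> hol_ball (Phi l) z r M) ->
  (forall w, nrm (w - z) <= r -> cont_circle s (fun l => Phi l w)) ->
  hol_at (fun w => cmean s (fun l => Phi l w)) z.
Proof.
move=> s0 r0 hO hPhi cPhi.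
have cO l : nrm l = s -> O l.
  by move=> /hO[d d0]; apply; rewrite subrr nrm0.
have M0 : 0 <= M.
  have /cO/hPhi/(_ z) : nrm (s%:C : C) = s by rewrite nrm_pos// ltW.
  by rewrite subrr nrm0 ltW// => /(_ isT)[_]; apply: le_trans; exact: nrm_ge0.
pose A := 2 * M / r ^+ 2.
have A0 : 0 <= A by rewrite divr_ge0 ?sqr_ge0// mulr_ge0.
have T l h : O l -> nrm h <= r / 2 ->
    nrm (Phi l (z + h) - Phi l z - der (Phi l) z h) <= A * nrm h ^+ 2.
  by move=> /hPhi hl hr; exact: ball_taylor2.
have czh h : nrm h <= r -> cont_circle s (fun l => Phi l (z + h)).
  by move=> hr; apply: cPhi; rewrite [z + h]addrC addrK.
have cz : cont_circle s (fun l => Phi l z) by have := @czh 0; rewrite addr0 nrm0; apply; exact: ltW.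
have cder h : cont_circle s (fun l => der (Phi l) z h).
  move=> l0 ls; apply: cont_at_eps => e e0.
  pose N := nrm h + 1.
  have N0 : 0 < N by rewrite ltr_wpDl ?nrm_ge0.
  pose t := Num.min (r / 2 / N) (e / (4 * (A * N ^+ 2 + 1))).
  have AN : 0 < A * N ^+ 2 + 1 by rewrite ltr_wpDl// mulr_ge0// exprn_ge0// ltW.
  have t0 : 0 < t by rewrite lt_min !divr_gt0// mulr_gt0.
  have tr : t * N <= r / 2 by rewrite -ler_pdivlMr// ge_min lexx.
  have te : 4 * (t * (A * N ^+ 2 + 1)) <= e.
    by rewrite mulrCA -ler_pdivlMr ?mulr_gt0// ge_min lexx orbT.
  (* Uniformly for [l] in [O], the difference quotient [q l / t] is within [e / 4] of the
     derivative, and it is continuous at the points of the circle; continuity of the derivative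
     follows. *)
  pose k := t%:C *: h.
  have nk : nrm k = t * nrm h by rewrite nrmZ nrm_pos// ltW.
  have kN : nrm k <= t * N by rewrite nk ler_wpM2l ?(ltW t0)// lerDl.
  have kr : nrm k <= r / 2 by exact: le_trans tr.
  have kr' : nrm k <= r by lra.
  pose q l := Phi l (z + k) - Phi l z.
  have cq : cont_at q l0 := contB (czh _ kr' _ ls) (cz _ ls).
  have [d1 d10 hd1] := hO _ ls.
  have te0 : 0 < t * (e / 2) by rewrite mulr_gt0// divr_gt0.
  have [d2 d20 hd2] := cont_eps cq te0.
  exists (Num.min d1 d2); first by rewrite lt_min d10.
  move=> l; rewrite lt_min => /andP[/hd1 Ol /hd2 ql].
  have E l' : O l' -> nrm (t%:C * der (Phi l') z h - q l') <= t * (e / 4).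
    move=> Ol'; rewrite -[t%:C * _]/(t%:C *: _) -derZ -/k nrmBC.
    apply: (le_trans (T l' k Ol' kr)).
    apply: (@le_trans _ _ (A * (t * N) ^+ 2)).
      by rewrite ler_wpM2l// lerXn2r ?nnegrE ?nrm_ge0// mulr_ge0 ?(ltW t0) ?(ltW N0).
    by move: (ltW t0) te => t0' te; rewrite exprMn; move: (N ^+ 2) te => N2 te; nra.
  have tH : nrm (t%:C * (der (Phi l) z h - der (Phi l0) z h)) < t * e.
    rewrite mulrBr; have e1 := E l Ol; have e2 := E l0 (cO _ ls).
    have := nrmBD (q l) (t%:C * der (Phi l) z h) (t%:C * der (Phi l0) z h).
    have := nrmBD (q l0) (q l) (t%:C * der (Phi l0) z h).
    rewrite [nrm (q l0 - _)]nrmBC.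
    move: e1 e2 ql; move: (nrm _) (nrm _) (nrm _) (nrm _) (nrm _) => a1 a2 a3 a4 a5; lra.
  by move: tH; rewrite nrmM nrm_pos ?(ltW t0)// ltr_pM2l.
apply: (proj1 (@hol_introf R V C _ z (fun h => cmean s (fun l => der (Phi l) z h)) (M / r) _ _ _)).
- move=> a u v; rewrite -[a *: cmean _ _]/(a * _).
  have ca : cont_circle s (fun l => a * der (Phi l) z u).
    by move=> l ls; exact: contM (cont_cst _ _) (cder u l ls).
  rewrite -(cmeanZ a (ltW s0) (cder u)) -(cmeanD (ltW s0) ca (cder v)).
  by apply: cmean_ext => [|l _]; [exact: ltW|rewrite derD derZ].
- move=> h; apply: cmean_nrm => //; first exact: ltW.
  by move=> l /cO/hPhi hl; exact: ball_der_le.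
move=> e e0; pose d := Num.min (r / 2) (e / (A + 1)).
have A1 : 0 < A + 1 by rewrite ltr_wpDl.
exists d; first by rewrite lt_min !divr_gt0.
move=> h; rewrite lt_min => /andP[/ltW hr].
rewrite ltr_pdivlMr// => he; have hr' : nrm h <= r by lra.
have cB : cont_circle s (fun l => Phi l (z + h) - Phi l z).
  by move=> l ls; exact: contB (czh _ hr' _ ls) (cz _ ls).
rewrite -(cmeanB (ltW s0) (czh _ hr') cz) -(cmeanB (ltW s0) cB (cder h)).
apply: cmean_nrm; first exact: ltW.
  by move=> l ls; exact: contB (cB l ls) (cder h l ls).
move=> l /cO Ol; apply: (le_trans (T l h Ol hr)).
rewrite expr2 mulrA ler_wpM2r ?nrm_ge0//.
by move: (nrm_ge0 h) he; move: (nrm h) => x; nra.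
Qed.

(** Cauchy's formula writes the directional derivative as the mean of [f (w + l *: e) / l] over a
    fixed small circle, which is holomorphic in [w] by [hol_cmean]. *)
Lemma hol_der (f : V -> C) (z e : V) : hol_near f z ->
  hol_at (fun w => der f w e) z.
Proof.
move=> /hol_near_ball[r [M [r0 M0 hb]]].
pose s := r / 8 / (nrm e + 1).
have e1 : 0 < nrm e + 1 by rewrite ltr_wpDl ?nrm_ge0.
have s0 : 0 < s by rewrite !divr_gt0.
have se l : nrm l <= 2 * s -> nrm (l *: e) <= r / 4.
  move=> ls; rewrite nrmZ; apply: (@le_trans _ _ (2 * s * (nrm e + 1))).
    by apply: ler_pM; rewrite ?nrm_ge0// lerDl.
  by rewrite /s -mulrA mulfVK ?gt_eqF//; lra.
have hw w l : nrm (w - z) <= r / 4 -> nrm l <= 2 * s ->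
    hol_ball f (w + l *: e) (r / 4) M.
  move=> wz /se le4; apply: (hol_ball_sub hb).
  by have := nrmD (w - z) (l *: e); rewrite [w + _ - z]addrAC; lra.
have hwf w l : nrm (w - z) <= r / 4 -> nrm l <= 2 * s -> hol_at f (w + l *: e).
  by move=> wz ls; apply: (proj1 (hw w l wz ls _ _)); rewrite subrr nrm0; lra.
apply: (@hol_eq_near R _ _ _ (fun w => cmean s (fun l => f (w + l *: e) / l))).
  apply: (@near_nrm _ _ _ _ (r / 4)); first by rewrite divr_gt0.
  move=> w /ltW wz.
  have s2 : s <= 2 * s by lra.
  rewrite -(@cauchy_deriv R s (fun l => f (w + l *: e)) s0); last first.
    by move=> l ls; case: (hol_line (hwf w l wz (le_trans ls s2))).
  have [|_ ->] := @hol_line R V f w e 0; last by rewrite scale0r addr0.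
  by apply: hwf => //; rewrite nrm0; lra.
pose O := [set l : C | s / 2 <= nrm l <= 2 * s].
apply: (@hol_cmean s (r / 4) (M / (s / 2)) O (fun l w => f (w + l *: e) / l)) => //.
- by rewrite divr_gt0.
- move=> l ls; exists (s / 2); first by rewrite divr_gt0.
  move=> l' ll; have := nrm_lerB l l'; have := nrm_lerB l' l.
  by rewrite [nrm (l - _)]nrmBC ls /O /= => a b; apply/andP; split; lra.
- move=> l /andP[l1 l2] w wz.
  have wl0 : nrm (w + l *: e - (w + l *: e)) <= r / 4 by rewrite subrr nrm0; lra.
  have [h1 h2] := hw w l wz l2 _ wl0; split.
    by apply: holM; [exact: hol_shift|exact: hol_cst].
  rewrite nrmM nrmV; apply: ler_pM; rewrite ?invr_ge0 ?nrm_ge0//.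
  have sp : 0 < s / 2 by rewrite divr_gt0.
  by rewrite lef_pV2// posrE// (lt_le_trans sp).
- move=> w wz l ls; apply: contM.
    by apply: hol_cont; case: (hol_line (hwf w l wz _)); rewrite // ls; lra.
  by apply: hol_cont; apply: holV; [exact: hol_id|rewrite -nrm_gt0 ls].
Qed.

End ParametricMean.

Section RowVectors.
Context {R : realType}.
Local Notation C := R[i].

Lemma nrm_coord n (v : 'rV[C]_n) j : nrm (v 0 j) <= nrm v.
Proof.
rewrite -lecR -!nrmE -[`|v|]/(mx_norm v) mx_normE.
rewrite (_ : Num.norm (v 0 j) = (`|v 0 j|%:nng)%:num)// num_le.
by apply/bigmax_geP; right => /=; exists (0, j).
Qed.

Lemma nrm_rV_le n (v : 'rV[C]_n) a : 0 <= a ->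
  (forall j, nrm (v 0 j) <= a) -> nrm v <= a.
Proof.
move=> a0 h; rewrite -lecR -!nrmE -[`|v|]/(mx_norm v) mx_normE.
have a0' : 0 <= (a%:C : C) by rewrite ler0c.
rewrite (_ : a%:C = (NngNum a0')%:num)// num_le.
apply/bigmax_leP; split; first by rewrite -num_le.
by move=> [i j] _ /=; rewrite -num_le/= ord1 nrmE lecR.
Qed.

Lemma ex_common_delta n (P : 'I_n -> R -> Prop) :
  (forall j d d', d' <= d -> P j d -> P j d') ->
  (forall j, exists2 d : R, 0 < d & P j d) ->
  exists2 d : R, 0 < d & forall j, P j d.
Proof.
move=> mono h; suff [d d0 hd] : exists2 d : R, 0 < d &
    forall j, j \in enum 'I_n -> P j d.
  by exists d => // j; apply: hd; rewrite mem_enum.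
elim: (enum 'I_n) => [|j s [d d0 hd]]; first by exists 1.
have [d' d'0 hd'] := h j; exists (Num.min d d'); first by rewrite lt_min d0.
move=> k; rewrite inE => /predU1P[->|/hd hk].
  by apply: mono hd'; rewrite ge_min lexx orbT.
by apply: mono hk; rewrite ge_min lexx.
Qed.

Lemma hol_coordinate n (v : 'rV[C]_n) j : hol_at (fun w : 'rV[C]_n => w 0 j) v.
Proof. by split; exact: differentiable_coord. Qed.

Lemma hol_coord (V : normedModType C) n (F : V -> 'rV[C]_n) z j : hol_at F z ->
  hol_at (fun x => F x 0 j) z.
Proof. by move=> hF; exact: hol_comp hF (hol_coordinate _ _). Qed.

Lemma hol_rV (V : normedModType C) n (F : V -> 'rV[C]_n) z :
  (forall j, hol_at (fun x => F x 0 j) z) -> hol_at F z.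
Proof.
move=> h; split.
have -> : F = \sum_(j < n) (fun x => F x 0 j *: delta_mx 0 j).
  apply/funext => x; rewrite fct_sumE {1}[F x]row_sum_delta.
  by apply: eq_bigr.
by apply: differentiable_sum => j; apply: differentiableZl; case: (h j).
Qed.

Lemma der_coordinate n (v h : 'rV[C]_n) j :
  der (fun w : 'rV[C]_n => w 0 j) v h = h 0 j.
Proof.
apply: (proj2 (@hol_introf R _ C (fun w : 'rV[C]_n => w 0 j) v
  (fun w => w 0 j) 1 _ _ _)).
- by move=> a u w; rewrite !mxE.
- by move=> k; rewrite mul1r nrm_coord.
move=> e e0; exists 1 => // k _.
rewrite !mxE [v 0 j + _]addrC addrK subrr nrm0 mulr_ge0 ?nrm_ge0//.
exact: ltW.
Qed.

Lemma der_coord (V : normedModType C) n (F : V -> 'rV[C]_n) z h j : hol_at F z ->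
  der (fun x => F x 0 j) z h = (der F z h) 0 j.
Proof.
by move=> hF; rewrite (der_comp _ hF (hol_coordinate _ j)) der_coordinate.
Qed.

Lemma strict_diff_rV (V : normedModType C) n (F : V -> 'rV[C]_n) z :
  hol_near F z -> forall e : R, 0 < e ->
  exists2 d : R, 0 < d & forall x y, nrm (x - z) < d -> nrm (y - z) < d ->
    nrm (F x - F y - der F z (x - y)) <= e * nrm (x - y).
Proof.
move=> hF e e0; have hz := hol_near_at hF.
pose P (j : 'I_n) (d : R) := forall x y, nrm (x - z) < d -> nrm (y - z) < d ->
    nrm (F x 0 j - F y 0 j - der F z (x - y) 0 j) <= e * nrm (x - y).
have [d d0 hd] : exists2 d : R, 0 < d & forall j, P j d.
  apply: ex_common_delta => [j d d' dd h x y xd yd|j].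
    by apply: h; [exact: lt_le_trans dd|exact: lt_le_trans dd].
  have hj : hol_near (fun x => F x 0 j) z.
    by case: hF => r r0 hr; exists r => // w /hr; exact: hol_coord.
  have [d d0 hd] := strict_diff hj e0; exists d => // x y xd yd.
  by rewrite -der_coord//; exact: hd.
exists d => // x y xd yd; apply: nrm_rV_le => [|j].
  by rewrite mulr_ge0 ?nrm_ge0// ltW.
by rewrite !mxE; exact: hd.
Qed.

(** Vectors are rows, so the matrix acts on the right ([der_jac]) and is the transpose of the usual
    Jacobian. *)
Definition jac m n (F : 'rV[C]_m -> 'rV[C]_n) z : 'M[C]_(m, n) :=
  \matrix_(i, j) (der F z (delta_mx 0 i)) 0 j.

Lemma der_jac m n (F : 'rV[C]_m -> 'rV[C]_n) z h : der F z h = h *m jac F z.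
Proof.
have dsum (s : seq 'I_m) : der F z (\sum_(i <- s) h 0 i *: delta_mx 0 i) =
    \sum_(i <- s) h 0 i *: der F z (delta_mx 0 i).
  elim: s => [|i s IH]; first by rewrite !big_nil der0.
  by rewrite !big_cons derD derZ IH.
rewrite {1}[h]row_sum_delta dsum; apply/rowP => j.
rewrite summxE mxE; apply: eq_bigr => i _; rewrite !mxE//.
Qed.

Lemma nrm_mulmx m n (M : 'M[C]_(m, n)) :
  exists2 K : R, 0 < K & forall v : 'rV[C]_m, nrm (v *m M) <= K * nrm v.
Proof.
pose K := 1 + \sum_i \sum_j nrm (M i j).
have S0 : 0 <= \sum_i \sum_j nrm (M i j).
  by do 2![apply: sumr_ge0 => ? _]; exact: nrm_ge0.
exists K => [|v]; first by rewrite ltr_pwDl.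
apply: nrm_rV_le => [|j]; first by rewrite mulr_ge0 ?nrm_ge0// addr_ge0.
rewrite mxE; apply: (@le_trans _ _ (\sum_i nrm (v 0 i * M i j))).
  elim/big_ind2 : _ => [|x1 x2 y1 y2 h1 h2|i _] //; first by rewrite nrm0.
  by rewrite (le_trans (nrmD _ _))// lerD.
apply: (@le_trans _ _ (\sum_i nrm v * \sum_j nrm (M i j))).
  apply: ler_sum => i _; rewrite nrmM; apply: ler_pM; rewrite ?nrm_ge0//.
    exact: nrm_coord.
  by rewrite (bigD1 j)//= lerDl sumr_ge0// => k _; exact: nrm_ge0.
by rewrite -mulr_sumr mulrC ler_wpM2r ?nrm_ge0// /K lerDr.
Qed.

Lemma unitmx_inj n (J : 'M[C]_n) :
  (forall u : 'rV_n, u *m J = 0 -> u = 0) -> J \in unitmx.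
Proof.
move=> hJ; rewrite -row_free_unit -kermx_eq0; apply/eqP/row_matrixP => i.
by rewrite row0; apply: hJ; exact: (sub_kermxP (row_sub i _)).
Qed.

Lemma hol_mulmx m n (M : 'M[C]_(m, n)) z : hol_at (fun v : 'rV[C]_m => v *m M) z
  /\ forall h, der (fun v : 'rV[C]_m => v *m M) z h = h *m M.
Proof.
have [K K0 hK] := nrm_mulmx M.
apply: (@hol_introf R _ _ (fun v : 'rV[C]_m => v *m M) z (mulmxr M) K).
- by move=> a u v; rewrite /= mulmxDl scalemxAl.
- exact: hK.
move=> e e0; exists 1 => // h _.
rewrite [X in nrm X](_ : _ = 0) ?nrm0 ?mulr_ge0 ?nrm_ge0 ?(ltW e0)//.
by rewrite /= mulmxDl [z *m M + _]addrC addrK subrr.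
Qed.

Lemma compact_ballC (a : C) (r : R) : compact [set c : C | nrm (c - a) <= r].
Proof.
pose I := `[- r, r]%classic : set R.
pose f (p : R * R) : C := a + (p.1 +i* p.2).
have cI : compact (I `*` I) by apply: compact_setX; exact: segment_compact.
have fc : continuous f.
  move=> p; suff [//] : cont_at f p.
  have -> : f = fun p : R * R => a + (p.1%:C + 'i%C * p.2%:C).
    by apply/funext => q; rewrite /f; congr (_ + _); simpc.
  have cC (u : R * R -> R) : cont_at u p -> cont_at (fun p => (u p)%:C : C) p.
    by move=> cu; apply: (cont_comp cu); split; exact: real_complex_continuous.
  apply: contD (cont_cst _ _) (contD _ (contM (cont_cst _ _) _)); apply: cC; split.
    exact: cvg_fst.
  exact: cvg_snd.
apply: (@subclosed_compact _ _ (f @` (I `*` I))).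
- rewrite (_ : mkset _ = (fun c => nrm (c - a)) @^-1` [set x | x <= r])//.
  apply: closed_comp; last exact: closed_le.
  move=> c _; have := cont_nrm (contB (cont_id c) (cont_cst a c)).
  by move=> /cont_atP.
- by apply: continuous_compact => //; exact: continuous_subspaceT.
move=> c /= cr; exists (complex.Re (c - a), complex.Im (c - a)).
  by split => /=; rewrite /I/= in_itv/= -ler_norml;
    [exact: le_trans (nrm_Re _) cr|exact: le_trans (nrm_Im _) cr].
rewrite /f /=; have -> : complex.Re (c - a) +i* complex.Im (c - a) = c - a.
  by case: (c - a).
by rewrite addrC subrK.
Qed.

Lemma compact_ball n (a : 'rV[C]_n) (r : R) : 0 <= r ->
  compact [set v : 'rV[C]_n | nrm (v - a) <= r].
Proof.
move=> r0.
have -> : [set v : 'rV[C]_n | nrm (v - a) <= r] =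
   [set v : 'rV[C]_n | forall j, [set c : C | nrm (c - a 0 j) <= r] (v ord0 j)].
  apply/seteqP; split=> v /= h.
    by move=> j; apply: le_trans h; have := nrm_coord (v - a) j; rewrite !mxE.
  by apply: nrm_rV_le => // j; rewrite !mxE; exact: h.
by apply: (@rV_compact C n (fun j => [set c : C | nrm (c - a 0 j) <= r])) => j;
  exact: compact_ballC.
Qed.

End RowVectors.

Section InverseFunction.
Context {R : realType} {n : nat}.
Local Notation C := R[i].
Local Notation V := 'rV[C]_n.
Implicit Types (F g : V -> V) (a x y : V).

(** In the target coordinates [T x = F x *m invmx J] the map differs from the identity by a map of
    Lipschitz constant 1/2, which gives the lower bound. Surjectivity comes from minimising the
    distance of [T x] to [y'] over a compact ball. *)
Lemma local_lipschitz_inverse F a : hol_near F a -> jac F a \in unitmx ->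
  exists r c : R, [/\ 0 < r, 0 < c,
    forall x, nrm (x - a) < r -> hol_at F x &
    (forall x y, nrm (x - a) < r -> nrm (y - a) < r ->
      c * nrm (x - y) <= nrm (F x - F y)) /\
    (forall p, 0 < p -> p < r -> exists2 e : R, 0 < e &
      forall y, nrm (y - F a) < e -> exists2 x, nrm (x - a) <= p & F x = y)].
Proof.
move=> hF uJ; set J := jac F a in uJ *.
have [K K0 hK] := nrm_mulmx (invmx J).
have K2 : 0 < 1 / (2 * K) by rewrite divr_gt0// mulr_gt0.
have [d d0 hd] := strict_diff_rV hF K2.
have [r0 r00 hr0] := hF.
pose r := Num.min d r0.
have rd : r <= d by rewrite ge_min lexx.
have rr : r <= r0 by rewrite ge_min lexx orbT.
have r_gt0 : 0 < r by rewrite lt_min d0.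
pose T x := F x *m invmx J.
have TE x y : nrm (x - a) < r -> nrm (y - a) < r ->
    nrm (T x - T y - (x - y)) <= nrm (x - y) / 2.
  move=> xr yr; have -> : T x - T y - (x - y) =
      (F x - F y - der F a (x - y)) *m invmx J.
    by rewrite der_jac !mulmxBl -/J !mulmxK// mulmxBl !mulmxK.
  apply: (le_trans (hK _)).
  have := hd x y (lt_le_trans xr rd) (lt_le_trans yr rd).
  rewrite -(ler_pM2l K0) => /le_trans; apply.
  by rewrite le_eqVlt; apply/orP; left; apply/eqP; field; rewrite gt_eqF.
have low x y : nrm (x - a) < r -> nrm (y - a) < r ->
    nrm (x - y) / 2 <= nrm (T x - T y).
  move=> xr yr; have := TE x y xr yr.
  have := nrm_lerB (x - y) (x - y - (T x - T y)).
  by rewrite subKr [nrm (x - y - _)]nrmBC; lra.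
exists r, (1 / (2 * K)); split; [exact: r_gt0|exact: K2| |].
  by move=> x xr; apply: hr0; exact: lt_le_trans rr.
split=> [x y xr yr|p p0 pr].
  have := le_trans (low x y xr yr) (_ : _ <= K * nrm (F x - F y)).
  rewrite -mulmxBl => /(_ (hK _)) H.
  rewrite mulrAC mul1r ler_pdivrMr ?mulr_gt0//; lra.
pose B := [set x : V | nrm (x - a) <= p].
have cB : compact B by apply: compact_ball; exact: ltW.
exists (p / 2 / K); first by rewrite !divr_gt0.
move=> y ye; pose y' := y *m invmx J.
have ya : nrm (y' - T a) < p / 2.
  rewrite -mulmxBl (le_lt_trans (hK _))// mulrC -ltr_pdivlMr//.
have Br x : B x -> nrm (x - a) < r by move=> h; exact: le_lt_trans pr.
have cphi : {within B, continuous (fun x => nrm (T x - y'))}.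
  apply: continuous_in_subspaceT => x; rewrite inE => /Br xr.
  have hx : hol_at F x by apply: hr0; exact: lt_le_trans rr.
  have hT : hol_at T x := hol_comp hx (proj1 (hol_mulmx (invmx J) (F x))).
  by have /cont_atP := cont_nrm (contB (hol_cont hT) (cont_cst y' x)).
have Ba : B a by rewrite /B/= subrr nrm0 ltW.
have [|x Bx xmin] := compact_EVT_min _ cB cphi; first by exists a.
exists x; first by move: Bx; rewrite inE.
have {}Bx : B x by move: Bx; rewrite inE.
have [T0|T0] := eqVneq (T x) y'.
  by have := congr1 (fun v => v *m J) T0; rewrite /T /y' !mulmxKV.
exfalso.
(* A Newton step from a minimiser with nonzero residual stays in the ball and at least halves the
   residual, contradicting minimality. *)
pose x1 := x + (y' - T x).
have Bx1 : B x1.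
  rewrite /B /x1/=; have := TE x a (Br _ Bx) (Br _ Ba).
  have -> : x + (y' - T x) - a = (y' - T a) - (T x - T a - (x - a)).
    by move: (T x) (T a) (y') => u v w; apply/rowP => j; rewrite !mxE; ring.
  have := nrmB (y' - T a) (T x - T a - (x - a)).
  have : nrm (x - a) <= p by [].
  lra.
have := xmin x1 (mem_set Bx1); apply/negP; rewrite -ltNge.
have := TE x1 x (Br _ Bx1) (Br _ Bx).
have -> : T x1 - T x - (x1 - x) = T x1 - y'.
  have gen (u v w : V) : u - v - (x + (w - v) - x) = u - w.
    by apply/rowP => j; rewrite !mxE; ring.
  exact: gen.
have -> : x1 - x = y' - T x by rewrite /x1 addrC addKr.
have : 0 < nrm (T x - y') by rewrite nrm_gt0 subr_eq0.
rewrite (nrmBC y' (T x)).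
move: (nrm (T x - y')) (nrm (T x1 - y')) => b1 b2.
lra.
Qed.

Lemma hol_inverse F g a : hol_at F a -> jac F a \in unitmx -> g (F a) = a ->
  cont_at g (F a) -> (\forall y \near F a, F (g y) = y) -> hol_at g (F a).
Proof.
move=> hF uJ gFa cg /nbhs_nrm[r r0 hr].
have [K K0 hK] := nrm_mulmx (invmx (jac F a)).
apply: (proj1 (@hol_introf R V V g (F a) (fun k => k *m invmx (jac F a)) K _ hK _)).
  by move=> c u v; rewrite mulmxDl scalemxAl.
move=> e e0.
pose e1 := Num.min (1 / (2 * K)) (e / (2 * K ^+ 2)).
have e10 : 0 < e1 by rewrite lt_min !divr_gt0// mulr_gt0// exprn_gt0.
have e1K : e1 * K <= 1 / 2.
  rewrite -ler_pdivlMr// /e1 ge_min; apply/orP; left.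
  by rewrite invfM mulrA.
have e1e : e1 * (2 * K ^+ 2) <= e.
  by rewrite -ler_pdivlMr ?mulr_gt0 ?exprn_gt0// /e1 ge_min lexx orbT.
have [d d0 hd] := hol_eps hF e10.
have [d2 d20 hd2] := cont_eps cg d0.
exists (Num.min r d2); first by rewrite lt_min r0.
move=> k; rewrite lt_min => /andP[kr kd].
pose h := g (F a + k) - a.
have Fk : F (a + h) = F a + k.
  by rewrite /h addrC subrK hr// [F a + k]addrC addrK.
have hh : nrm h < d.
  by have := hd2 (F a + k); rewrite gFa; apply; rewrite [F a + k]addrC addrK.
have H := hd h hh; rewrite Fk [F a + k]addrC addrK der_jac in H.
have E : h - k *m invmx (jac F a) = - ((k - h *m jac F a) *m invmx (jac F a)).
  by rewrite mulmxBl mulmxK// opprB.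
have N1 : nrm (h - k *m invmx (jac F a)) <= K * (e1 * nrm h).
  by rewrite E nrmN (le_trans (hK _))// ler_pM2l.
have N2 : nrm h <= 2 * K * nrm k.
  have := nrm_lerB h (h - k *m invmx (jac F a)); rewrite subKr => N3.
  have := hK k; have := nrm_ge0 h; nra.
rewrite gFa -/h (le_trans N1)//.
by have := nrm_ge0 k; have := nrm_ge0 h; nra.
Qed.

End InverseFunction.

Section MeanValue.
Context {R : realType}.
Local Notation C := R[i].

Lemma eps_is_derive (f : R -> R) (x df : R) :
  (forall e : R, 0 < e -> exists2 d : R, 0 < d & forall h, `|h| < d ->
    `|f (x + h) - f x - df * h| <= e * `|h|) -> is_derive x 1 f df.
Proof.
move=> H.
have lim_df : h^-1 *: (f (h *: 1 + x) - f x) @[h --> 0^'] --> df.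
  apply/cvgrPdist_le => e e0; have [d d0 hd] := H _ e0.
  apply/nbhs_ballP; exists d => //= h; rewrite /ball/= sub0r normrN => hh h0.
  rewrite /GRing.scale/= mulr1 [h + x]addrC.
  have -> : df - h^-1 * (f (x + h) - f x) = - (f (x + h) - f x - df * h) / h.
    by field.
  by rewrite normrM normrN normfV ler_pdivrMr ?normr_gt0// hd.
split; first by apply/cvg_ex; exists df.
exact: cvg_lim lim_df.
Qed.

Lemma mean_value_le (V : normedModType C) (f : V -> C) (x h : V) (K : R) :
  (forall t : R, 0 <= t <= 1 -> hol_at f (x + t%:C *: h) /\
     nrm (der f (x + t%:C *: h) h) <= K) -> nrm (f (x + h) - f x) <= K.
Proof.
move=> H; have [c c1 hc] := normc_rotate (f (x + h) - f x).
(* [c] rotates the total increment to a nonnegative real, so the real mean value theorem for this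
   real part loses nothing. *)
pose phi (t : R) := complex.Re (c * f (x + t%:C *: h)).
pose dphi (t : R) := complex.Re (c * der f (x + t%:C *: h) h).
have D (t : R) : 0 <= t <= 1 -> is_derive t 1 phi (dphi t).
  move=> /H[hf _]; apply: eps_is_derive => e e0.
  have h1 : 0 < nrm h + 1 by rewrite ltr_wpDl ?nrm_ge0.
  have [d d0 hd] := hol_eps hf (divr_gt0 e0 h1).
  exists (d / (nrm h + 1)); first exact: divr_gt0.
  move=> k hk; have kh : nrm (k%:C *: h) <= `|k| * (nrm h + 1).
    by rewrite nrmZ nrm_real ler_wpM2l// lerDl.
  have E : phi (t + k) - phi t - dphi t * k =
     complex.Re (c * (f (x + t%:C *: h + k%:C *: h) - f (x + t%:C *: h) -
       der f (x + t%:C *: h) (k%:C *: h))).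
    have -> : x + t%:C *: h + k%:C *: h = x + (t + k)%:C *: h.
      by rewrite rmorphD scalerDl addrA.
    rewrite derZ -[k%:C *: _]/(k%:C * _) /phi /dphi.
    have -> : complex.Re (c * der f (x + t%:C *: h) h) * k =
      complex.Re (k%:C * (c * der f (x + t%:C *: h) h)).
      by case: (c * _) => u v; simpc => /=; rewrite mulrC.
    by rewrite -!raddfB/=; congr (complex.Re _); ring.
  rewrite E (le_trans (nrm_Re _))// nrmM c1 mul1r.
  apply: (le_trans (hd _ _)); first by apply: le_lt_trans kh _; rewrite -ltr_pdivlMr.
  by rewrite mulrAC ler_pdivrMr// -mulrA ler_wpM2l// ltW.
have cphi : {within `[0, 1], continuous phi}.
  apply: derivable_within_continuous => t; rewrite in_itv/= => tI.
  by have [] := D t tI.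
have [|t tI E] := @MVT R phi dphi 0 1 ltr01 _ cphi.
  by move=> t; rewrite in_itv/= => /andP[t0 t1]; apply: D; rewrite !ltW.
have : nrm (f (x + h) - f x) = phi 1 - phi 0.
  by rewrite /phi scale1r scale0r addr0 -raddfB -mulrBr hc.
move=> ->; rewrite E subr0 mulr1; move: tI; rewrite in_itv/= => /andP[t0 t1].
have [|_ hK] := H t; first by rewrite !ltW.
by rewrite (le_trans (ler_norm _))// (le_trans (nrm_Re _))// nrmM c1 mul1r.
Qed.

Lemma der_eq_near (V W : normedModType C) (f g : V -> W) z h :
  (\forall w \near z, f w = g w) -> hol_at g z -> der f z h = der g z h.
Proof.
move=> /nbhs_nrm[e e0 fg] dg; have [K K0 hK] := der_bounded dg.
apply: (proj2 (@hol_introf R V W f z (der g z) K _ hK _)).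
  by move=> a u v; rewrite derD derZ.
move=> e' e'0; have [d d0 hd] := hol_eps dg e'0.
exists (Num.min d e); first by rewrite lt_min d0.
move=> k; rewrite lt_min => /andP[/hd h1 h2].
by rewrite !fg ?subrr ?nrm0// [z + k]addrC addrK.
Qed.

End MeanValue.

(** * Zeros of infinite order, analytic continuation and injectivity in one complex variable *)

Section OneVariable.
Context {R : realType}.
Local Notation C := R[i].
Implicit Types (f g : C -> C) (l w : C) (s r : R).

Lemma compact_circle s : compact [set l : C | nrm l = s].
Proof.
apply: (@subclosed_compact _ _ [set l : C | nrm (l - 0) <= s]).
- rewrite (_ : mkset _ = @nrm R C @^-1` [set s])//.
  apply: closed_comp; last exact: closed_eq.
  by move=> c _; exact: nrm_continuous.
- exact: compact_ballC.
by move=> l /= ls; rewrite subr0 ls.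
Qed.

Lemma circle_nonempty s : 0 <= s -> [set l : C | nrm l = s] !=set0.
Proof. by move=> s0; exists s%:C; rewrite /= nrm_pos. Qed.

Lemma within_circle s f : cont_circle s f ->
  {within [set l : C | nrm l = s], continuous (fun l => nrm (f l))}.
Proof.
move=> cf; apply: continuous_in_subspaceT => l; rewrite inE => /cf h.
by have /cont_atP := cont_nrm h.
Qed.

Lemma circle_max s f : 0 <= s -> cont_circle s f ->
  exists2 K : R, 0 < K & forall l, nrm l = s -> nrm (f l) <= K.
Proof.
move=> s0 cf.
have [c _ hc] := compact_EVT_max (circle_nonempty s0) (@compact_circle s) (within_circle cf).
exists (nrm (f c) + 1); first by rewrite ltr_wpDl ?nrm_ge0.
by move=> l ls; rewrite (le_trans (hc l _)) ?lerDl// inE.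
Qed.

Lemma circle_min s f : 0 <= s -> cont_circle s f ->
  (forall l, nrm l = s -> f l != 0) ->
  exists2 c : R, 0 < c & forall l, nrm l = s -> c <= nrm (f l).
Proof.
move=> s0 cf f0.
have [c cs hc] := compact_EVT_min (circle_nonempty s0) (@compact_circle s) (within_circle cf).
exists (nrm (f c)); first by rewrite nrm_gt0 f0//; move: cs; rewrite inE.
by move=> l ls; apply: hc; rewrite inE.
Qed.

Lemma le0_of_pow (a q K : R) : 0 <= q -> q < 1 ->
  (forall N, a <= q ^+ N * K) -> a <= 0.
Proof.
move=> q0 q1 h; rewrite leNgt; apply/negP => a0.
suff : 1 <= q by rewrite leNgt q1.
apply: (@le_of_pow R 1 q (K / a)) => // N.
by rewrite expr1n mulrA ler_pdivlMr// mul1r.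
Qed.

(** By the maximum principle for [f l / l ^+ N], the modulus of [f w] is at most
    [K * (nrm w / s) ^+ N] for every [N], and [nrm w < s]. *)
Lemma vanishing_order_eq0 s f : 0 < s -> (forall l, nrm l <= s -> hol_at f l) ->
  (forall N, bounded_near0 (fun l => f l / l ^+ N)) ->
  forall w, nrm w < s -> w != 0 -> f w = 0.
Proof.
move=> s0 df hb w ws w0; have wn : 0 < nrm w by rewrite nrm_gt0.
have [K K0 hK] := circle_max (ltW s0) (cont_circle_hol (fun l ls => df l (eq_ind_r (fun x => x <= s) (lexx s) ls))).
apply/eqP; rewrite -nrm_eq0 eq_le nrm_ge0 andbT.
apply: (@le0_of_pow _ (nrm w / s) K); first by rewrite divr_ge0 ?ltW.
  by rewrite ltr_pdivrMr// mul1r.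
move=> N; have : nrm (f w / w ^+ N) <= K / s ^+ N.
  apply: (@max_principle0 R s (fun l => f l / l ^+ N)) => //; last exact: ltW.
  - move=> l; rewrite nrm_gt0 => l0 ls; apply: hol_div; first exact: df.
      by apply: holX; exact: hol_id.
    by rewrite expf_neq0.
  - move=> l ls; rewrite nrmM nrmV nrmX ls ler_wpM2r ?invr_ge0 ?exprn_ge0 ?(ltW s0)//.
    exact: hK.
rewrite nrmM nrmV nrmX ler_pdivrMr ?exprn_gt0// => /le_trans; apply.
rewrite le_eqVlt expr_div_n; apply/orP; left; apply/eqP; field.
by rewrite expf_neq0// gt_eqF.
Qed.

Lemma identity_disc s f (d : R) : 0 < d -> (forall l, nrm l <= s -> hol_at f l) ->
  (forall l, nrm l < d -> f l = 0) -> forall w, nrm w < s -> f w = 0.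
Proof.
move=> d0 df f0 w ws; have [->|w0] := eqVneq w 0; first by apply: f0; rewrite nrm0.
have s0 : 0 < s by apply: le_lt_trans ws; exact: nrm_ge0.
apply: (vanishing_order_eq0 s0 df) => // N.
exists 1, d; split=> // l _ ld; rewrite f0// mul0r nrm0; exact: ler01.
Qed.

(** Near 0 the derivative is either 0 or bounded below: where [der f n 1 != 0], injectivity makes
    [l / (f (n + l) - f n)] holomorphic off 0 and bounded near it, and the maximum principle bounds
    its limit, the inverse of the derivative. If the derivative vanished at 0, continuity would make
    it vanish nearby, and [f] would be locally constant. *)
Lemma injective_deriv_neq0 r f : 0 < r -> (forall l, nrm l <= r -> hol_at f l) ->
  (forall l w, nrm l <= r -> nrm w <= r -> f l = f w -> l = w) ->
  der f 0 1 != 0.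
Proof.
move=> r0 df inj; apply/eqP => D0.
have ch : cont_circle r f by apply: cont_circle_hol => l lr; apply: df; rewrite lr.
have [K K0 hK] := circle_max (ltW r0) ch.
have fK l : nrm l <= r -> nrm (f l) <= K := max_principle r0 df hK.
pose e := r / 2; have e0 : 0 < e by rewrite divr_gt0.
have hb l : nrm l <= e -> hol_ball f l e K.
  move=> le w we; have wr : nrm w <= r.
    by have := nrmBD l w 0; rewrite !subr0 /e in le we *; lra.
  by split; [exact: df|exact: fK].
have [L L0 Lip] : exists2 L : R, 0 < L & forall l (k : C), nrm l <= e ->
    nrm k <= e -> nrm (f (l + k) - f l) <= L * nrm k.
  exists (2 * K / e); first by rewrite divr_gt0// mulr_gt0.
  by move=> l k le ke; exact: ball_lipschitz (hb l le) ke.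
have er : e <= r by rewrite /e; lra.
have [c c0 hc] : exists2 c : R, 0 < c & forall l, nrm l = e -> c <= nrm (f l - f 0).
  apply: (@circle_min e (fun l => f l - f 0)); first exact: ltW.
    by apply: cont_circle_hol => l le; apply: holB; [apply: df; rewrite le|exact: hol_cst].
  move=> l le; apply/eqP => /subr0_eq /inj E.
  have l0 : l = 0 by apply: E; rewrite ?le ?nrm0 ?(ltW r0).
  by move: e0; rewrite -le l0 nrm0 ltxx.
pose d := Num.min e (c / (4 * L)).
have d0 : 0 < d by rewrite lt_min e0 divr_gt0// mulr_gt0.
have de : d <= e by rewrite ge_min lexx.
have dc : L * d <= c / 4.
  have : d <= c / (4 * L) by rewrite ge_min lexx orbT.
  rewrite ler_pdivlMr ?mulr_gt0// => H; rewrite ler_pdivlMr//.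
  by apply: le_trans H; rewrite le_eqVlt; apply/orP; left; apply/eqP; ring.
have low n l : nrm n <= d -> nrm l = e -> c / 2 <= nrm (f (n + l) - f n).
  move=> nd le; have ne : nrm n <= e by exact: le_trans de.
  have h1 : nrm (f (l + n) - f l) <= L * nrm n by apply: Lip; rewrite ?le.
  have h2 : nrm (f n - f 0) <= L * nrm n.
    by have := Lip 0 n; rewrite nrm0 add0r; apply => //; exact: ltW.
  have h3 := hc l le.
  have Ld : L * nrm n <= c / 4 by apply: le_trans dc; rewrite ler_pM2l.
  have E : f (n + l) - f n = (f l - f 0) - ((f n - f 0) - (f (l + n) - f l)).
    by rewrite [n + l]addrC; ring.
  rewrite E; have := nrm_lerB (f l - f 0) ((f n - f 0) - (f (l + n) - f l)).
  have := nrmB (f n - f 0) (f (l + n) - f l).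
  lra.
(* The lower bound [c / 2] of [low], divided by the length [e] of the increment. *)
pose kap := c / (2 * e); have kap0 : 0 < kap by rewrite divr_gt0// mulr_gt0.
have gap n : nrm n <= d -> der f n 1 != 0 -> kap <= nrm (der f n 1).
  move=> nd dn0; have dn : 0 < nrm (der f n 1) by rewrite nrm_gt0.
  have ne : nrm n <= e by exact: le_trans de.
  have hn : hol_at f n by apply: df; exact: le_trans er.
  pose h l := l / (f (n + l) - f n).
  have nlr l : nrm l <= e -> nrm (n + l) <= r.
    by move=> le; have := nrmD n l; rewrite /e in le ne *; lra.
  have nz l : 0 < nrm l -> nrm l <= e -> f (n + l) - f n != 0.
    move=> l0 le; rewrite subr_eq0; apply: contraTneq l0 => /inj E.
    have := E (nlr _ le) (le_trans ne er).
    by move/eqP; rewrite addrC -subr_eq0 addrK => /eqP ->; rewrite nrm0 ltxx.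
  have hh l : 0 < nrm l -> nrm l <= e -> hol_at h l.
    move=> l0 le; apply: hol_div; [exact: hol_id| |exact: nz].
    apply: holB; last exact: hol_cst.
    by under eq_fun do rewrite addrC; apply: hol_shift; rewrite addrC; apply: df; exact: nlr.
  have hK' l : nrm l = e -> nrm (h l) <= kap^-1.
    move=> le; rewrite nrmM nrmV le; have := low n l nd le => H.
    have c2 : 0 < c / 2 by rewrite divr_gt0.
    have -> : kap^-1 = e / (c / 2) by rewrite /kap; field; rewrite !gt_eqF.
    by rewrite ler_pM2l// lef_pV2// posrE//; exact: lt_le_trans H.
  have bn : bounded_near0 h.
    have d20 : 0 < nrm (der f n 1) / 2 by rewrite divr_gt0.
    have [d1 d10 hd1] := hol_eps hn d20.
    exists (2 / nrm (der f n 1)), d1; split; rewrite ?divr_gt0// => l l0 ld.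
    have := hd1 l ld; rewrite derC => H.
    rewrite nrmM nrmV.
    have H2 : nrm (der f n 1) / 2 * nrm l <= nrm (f (n + l) - f n).
      have := nrm_lerB (l * der f n 1) (l * der f n 1 - (f (n + l) - f n)).
      rewrite subKr nrmM [nrm (_ - (f _ - _))]nrmBC; nra.
    rewrite ler_pdivrMr; last by apply: lt_le_trans H2; rewrite mulr_gt0.
    by rewrite -ler_pdivrMl ?divr_gt0// invf_div.
  apply/ler_addgt0Pr => e' e'0.
  have [d1 d10 hd1] := hol_eps hn e'0.
  pose t := Num.min (d1 / 2) e.
  have t0 : 0 < t by rewrite lt_min divr_gt0.
  have td1 : t < d1 by apply: (@le_lt_trans _ _ (d1 / 2)); [rewrite ge_min lexx|lra].
  have te : t <= e by rewrite ge_min lexx orbT.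
  have tn : nrm (t%:C : C) = t by rewrite nrm_pos// ltW.
  have := @max_principle0 R e h _ t%:C hh bn hK'; rewrite tn => /(_ t0 te).
  have nzt := nz t%:C; rewrite tn in nzt; have {}nzt := nzt t0 te.
  rewrite nrmM nrmV tn ler_pdivrMr ?nrm_gt0// => H.
  have := hd1 t%:C; rewrite tn => /(_ td1); rewrite derC => H2.
  have H3 := nrm_lerB (f (n + t%:C) - f n) (t%:C * der f n 1).
  rewrite nrmM tn in H3.
  have H4 : kap * t <= nrm (f (n + t%:C) - f n) by rewrite -ler_pdivlMl.
  rewrite -(ler_pM2r t0); lra.
have hnear : hol_near f 0 by exists r => // w; rewrite subr0 => /ltW /df.
have /hol_cont/cont_eps/(_ _ kap0)[d1 d10 hd1] := hol_der (1 : C) hnear.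
pose t := Num.min d (d1 / 2).
have t0 : 0 < t by rewrite lt_min d0 divr_gt0.
have td : t <= d by rewrite ge_min lexx.
have td1 : t < d1.
  by apply: (@le_lt_trans _ _ (d1 / 2)); [rewrite ge_min lexx orbT|lra].
have der0' l : nrm l <= t -> der f l 1 = 0.
  move=> lt; apply/eqP; apply: contraT => /(gap _ (le_trans lt td)).
  have := hd1 l; rewrite subr0 D0 subr0 => /(_ (le_lt_trans lt td1)).
  by move=> a b; have := lt_le_trans a b; rewrite ltxx.
have tn : nrm (t%:C : C) = t by rewrite nrm_pos// ltW.
have : f t%:C = f 0.
  apply/eqP; rewrite -subr_eq0 -nrm_eq0 eq_le nrm_ge0 andbT.
  have := @mean_value_le R C f 0 t%:C 0; rewrite add0r; apply => u uI.
  have ut : nrm (0 + u%:C *: (t%:C : C)) <= t.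
    have /andP[u0 u1] := uI.
    by rewrite add0r nrmZ tn nrm_pos// ler_piMl// ltW.
  split; first by apply: df; rewrite (le_trans ut)// (le_trans td)// (le_trans de).
  by rewrite derC der0'// mulr0 nrm0.
move/inj; rewrite tn nrm0 (ltW r0) => /(_ _ isT).
rewrite (le_trans td) ?(le_trans de)// => /(_ isT) /(congr1 (@nrm R C)).
by rewrite tn nrm0 => tt; move: t0; rewrite tt ltxx.
Qed.

End OneVariable.

(** * Critical points of injective maps: the two-dimensional case *)

Section VanishingOrder.
Context {R : realType} {V : normedModType R[i]}.
Local Notation C := R[i].
Implicit Types (j : V -> C) (e p : V).

Definition dpow j e k : V -> C := iter k (fun g z => der g z e) j.

Definition hol_in (W : normedModType C) (f : V -> W) p (r : R) :=
  forall z, nrm (z - p) < r -> hol_at f z.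

Lemma hol_in_near (W : normedModType C) (f : V -> W) p (r : R) z :
  hol_in f p r -> nrm (z - p) < r -> hol_near f z.
Proof.
move=> hf zr; exists (r - nrm (z - p)); first by rewrite subr_gt0.
move=> w wz; apply: hf; rewrite (le_lt_trans (nrmBD z w p))//; lra.
Qed.

Lemma hol_dpow j e k p r : hol_in j p r -> hol_in (dpow j e k) p r.
Proof.
move=> hj; elim: k => [//|k IH] z zr.
by apply: hol_der; exact: hol_in_near IH zr.
Qed.

Lemma line_in_ball e p (r : R) (l : C) : nrm l < r / (nrm e + 1) ->
  nrm (p + l *: e - p) < r.
Proof.
move=> lr; rewrite addrAC subrr add0r nrmZ.
have e1 : 0 < nrm e + 1 by rewrite ltr_wpDl ?nrm_ge0.
move: lr; rewrite ltr_pdivlMr//; apply: le_lt_trans.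
by rewrite ler_wpM2l ?nrm_ge0// lerDl.
Qed.

(** Induction on the order: along the segment from [p] the directional derivative is of order
    [nrm l ^+ N], and the mean value inequality contributes one more factor. *)
Lemma vanishing_order_le j e p r N : 0 < r -> hol_in j p r ->
  (forall i, (i < N)%N -> dpow j e i p = 0) ->
  exists K d : R, [/\ 0 < K, 0 < d & forall l : C, nrm l < d ->
    nrm (j (p + l *: e)) <= K * nrm l ^+ N].
Proof.
move=> r0; have e1 : 0 < nrm e + 1 by rewrite ltr_wpDl ?nrm_ge0.
elim: N j => [|N IH] j hj h0.
  have hn : hol_near j p by apply: (hol_in_near hj); rewrite subrr nrm0.
  have [s [M [s0 M0 hM]]] := hol_near_ball hn.
  exists M, (s / (nrm e + 1)); split=> //; first exact: divr_gt0.
  by move=> l /(@line_in_ball e p s) /ltW /hM[_]; rewrite expr0 mulr1.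
have hj1 : hol_in (fun z => der j z e) p r by exact: (@hol_dpow j e 1).
have [|K [d [K0 d0 hK]]] := IH _ hj1.
  by move=> i iN; have := h0 i.+1 iN; rewrite /dpow iterSr.
exists K, (Num.min d (r / (nrm e + 1))); split=> //.
  by rewrite lt_min d0 divr_gt0.
move=> l; rewrite lt_min => /andP[ld lr].
have -> : j (p + l *: e) = j (p + l *: e) - j p.
  by have := h0 0%N isT; rewrite /dpow/= => ->; rewrite subr0.
apply: mean_value_le => t /andP[t0 t1].
rewrite scalerA; have tl : nrm (t%:C * l) <= nrm l.
  by rewrite nrmM nrm_pos// ler_piMl ?nrm_ge0.
split; first by apply: hj; apply: line_in_ball; exact: le_lt_trans lr.
rewrite derZ -[l *: _]/(l * _) nrmM exprS mulrCA ler_wpM2l ?nrm_ge0//.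
apply: (le_trans (hK _ (le_lt_trans tl ld))); rewrite ler_pM2l//.
by rewrite lerXn2r ?nnegrE ?nrm_ge0.
Qed.

Lemma vanishing_order_exists j e p r : 0 < r -> hol_in j p r ->
  (forall d : R, 0 < d -> exists2 l : C, nrm l < d & j (p + l *: e) != 0) ->
  exists k, dpow j e k p != 0.
Proof.
move=> r0 hj hne; apply/not_existsP => H.
have {}H k : dpow j e k p = 0 by apply/eqP/negPn/negP; exact: H.
have e1 : 0 < nrm e + 1 by rewrite ltr_wpDl ?nrm_ge0.
pose s := r / 2 / (nrm e + 1); have s0 : 0 < s by rewrite !divr_gt0.
have sr : s < r / (nrm e + 1) by rewrite ltr_pM2r ?invr_gt0//; lra.
have [w ws] := hne s s0; apply/negP/negPn/eqP.
have [->|w0] := eqVneq w 0; first by rewrite scale0r addr0; exact: (H 0%N).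
apply: (@vanishing_order_eq0 R s (fun l => j (p + l *: e))) => //.
  move=> l ls; case: (@hol_line R V j p e l) => //.
  by apply: hj; apply: line_in_ball; exact: le_lt_trans sr.
move=> N; have [K [d [K0 d0 hK]]] := vanishing_order_le r0 hj (fun i (_ : (i < N)%N) => H i).
exists K, d; split=> // l l0 ld; rewrite nrmM nrmV nrmX.
by rewrite ler_pdivrMr ?exprn_gt0// hK.
Qed.

End VanishingOrder.

Section CriticalPlane.
Context {R : realType} {n : nat}.
Local Notation C := R[i].
Local Notation V2 := 'rV[C]_2.
Local Notation e0 := (delta_mx 0 0 : V2).
Local Notation e1 := (delta_mx 0 1 : V2).
Implicit Types (j : V2 -> C) (H : V2 -> 'rV[C]_n) (p x y : V2) (l m : C).

Lemma nrm_e0 : nrm e0 <= 1.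
Proof.
apply: nrm_rV_le => // k; rewrite mxE eqxx/=.
by case: (k == 0); rewrite ?nrm1 ?nrm0.
Qed.

Lemma nrm_e1 : nrm e1 <= 1.
Proof.
apply: nrm_rV_le => // k; rewrite mxE eqxx/=.
by case: (k == 1); rewrite ?nrm1 ?nrm0.
Qed.

Lemma plane_coord (l m : C) : l *: e0 + m *: e1 = \row_k (if k == 0 then l else m).
Proof.
apply/rowP => k; rewrite !mxE/=; case: k => [[|[|k]] hk] //=.
  by rewrite mulr1 mulr0 addr0.
by rewrite mulr0 mulr1 add0r.
Qed.

Lemma plane_eta x : x = x 0 0 *: e0 + x 0 1 *: e1.
Proof.
rewrite plane_coord; apply/rowP => k; rewrite mxE.
by case: k => [[|[|k]] hk] //=; congr (x _ _); apply/val_inj.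
Qed.

Lemma nrm_plane (l m : C) : nrm (l *: e0 + m *: e1) <= nrm l + nrm m.
Proof.
rewrite (le_trans (nrmD _ _))// !nrmZ.
by rewrite lerD// ler_piMr ?nrm_ge0 ?nrm_e0 ?nrm_e1.
Qed.

Lemma quadratic_le (B x y L : R) : 0 <= B -> 0 <= x -> x <= L * y ->
  B * x ^+ 2 <= B * L ^+ 2 * y ^+ 2.
Proof.
move=> B0 x0 xy; rewrite -mulrA -exprMn ler_wpM2l// lerXn2r ?nnegrE//.
exact: le_trans xy.
Qed.

(** Over [N] equal steps the increments add up to at most [B * T ^+ 2 / N%:R]. This takes the place
    of a vanishing derivative along curves that are merely Lipschitz. *)
Lemma quadratic_constant (u : R -> C) (T B d : R) : 0 < T -> 0 < d -> 0 <= B ->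
  (forall t t', 0 <= t <= T -> 0 <= t' <= T -> `|t - t'| <= d ->
    nrm (u t - u t') <= B * `|t - t'| ^+ 2) -> u T = u 0.
Proof.
move=> T0 d0 B0 hu; apply/eqP; rewrite -subr_eq0 -nrm_eq0 eq_le nrm_ge0 andbT.
apply/ler_addgt0Pr => e ep; rewrite add0r.
pose x := Num.max (T / d) (B * T ^+ 2 / e).
have x0 : 0 <= x by rewrite le_max divr_ge0// ltW.
have xN := archi_boundP x0; set N := Num.bound x in xN.
have N0 : 0 < N%:R :> R by exact: le_lt_trans xN.
pose t k : R := T * k%:R / N%:R.
have tI k : (k <= N)%N -> 0 <= t k <= T.
  move=> kN; rewrite /t divr_ge0 ?mulr_ge0 ?(ltW T0)//= ler_pdivrMr//.
  by rewrite ler_pM2l// ler_nat.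
have ts k : t k.+1 - t k = T / N%:R.
  by rewrite /t -mulrBl -mulrBr -natrB// subSnn mulr1.
have TN : 0 < T / N%:R by rewrite divr_gt0.
have step k : (k < N)%N -> nrm (u (t k.+1) - u (t k)) <= B * (T / N%:R) ^+ 2.
  move=> kN; have := hu (t k.+1) (t k) (tI _ kN) (tI _ (ltnW kN)).
  rewrite ts (ger0_norm (ltW TN)); apply.
  rewrite ler_pdivrMr// mulrC -ler_pdivrMr// ltW//.
  by apply: le_lt_trans xN; rewrite le_max lexx.
have tele k : (k <= N)%N -> nrm (u (t k) - u (t 0%N)) <= k%:R * (B * (T / N%:R) ^+ 2).
  elim: k => [_|k IH kN]; first by rewrite subrr nrm0 mul0r.
  rewrite (le_trans (nrmBD (u (t k)) _ _))// -natr1 mulrDl mul1r addrC.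
  by apply: lerD; [apply: IH; exact: ltnW|exact: step].
have := tele N (leqnn N); rewrite /t mulr0 mul0r mulfK ?gt_eqF// => /le_trans; apply.
have -> : N%:R * (B * (T / N%:R) ^+ 2) = B * T ^+ 2 / N%:R.
  by field; rewrite gt_eqF.
rewrite ler_pdivrMr// [e * _]mulrC -ler_pdivrMr// ltW//.
by apply: le_lt_trans xN; rewrite le_max lexx orbT.
Qed.

(* At a zero of j of minimal order k in the direction e0, the derivative of
   order k - 1 of j vanishes on the zeros of j nearby and is transversal to e0,
   so that these zeros form a Lipschitz graph over the second coordinate.  H is
   critical, hence constant, along that graph. *)
Lemma zero_graph j H r : 0 < r -> hol_in j 0 r -> hol_in H 0 r ->
  (forall x, nrm x < r -> j x = 0 -> forall h, der H x h = 0) ->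
  (forall x y, nrm x < r -> nrm y < r -> H x = H y -> x = y) ->
  j 0 = 0 ->
  (forall d : R, 0 < d -> exists2 l : C, nrm l < d & j (l *: e0) != 0) -> False.
Proof.
move=> r0 hj hH hcrit inj j0 hne.
have br x : nrm (x - 0) < r <-> nrm x < r by rewrite subr0.
have ex0 : exists k, `[<exists p, [/\ nrm p < r, j p = 0 & dpow j e0 k p != 0]>].
  have [|k hk] := @vanishing_order_exists R _ j e0 0 r r0 hj.
    by move=> d /hne[l ld jl]; exists l; rewrite ?add0r.
  by exists k; apply/asboolP; exists 0; rewrite nrm0.
have [k /asboolP[p [pr jp kp]] kmin] := ex_minnP ex0.
case: k => [|k] in kp kmin; first by move: kp; rewrite /dpow/= jp eqxx.
pose h := dpow j e0 k.
have hZ x : nrm x < r -> j x = 0 -> h x = 0.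
  move=> xr jx; apply/eqP; apply: contraT => hx.
  have := kmin k; rewrite ltnn; apply; apply/asboolP; by exists x.
pose a := der h p e0; have an : 0 < nrm a by rewrite nrm_gt0; exact: kp.
have hh : hol_near h p by apply: (hol_in_near (hol_dpow _ _ hj)); apply/br.
have hjp : hol_near j p by apply: (hol_in_near hj); apply/br.
have [d1 d10 hd1] := strict_diff hh (divr_gt0 an (ltr0n _ 2)).
have [d2 d20 hd2] := strict_diff hjp ltr01.
have [K2 K20 hK2] := der_bounded (hol_near_at hjp).
pose b := der h p e1.
(* Obtained by solving [nrm a * nrm u <= nrm b * nrm v + nrm a / 2 * (nrm u + nrm v)] for [nrm u],
   with [u] and [v] the two coordinates of a difference of zeros. *)
pose L := 2 * (nrm b + nrm a / 2) / nrm a.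
have L0 : 0 <= L by rewrite divr_ge0 ?nrm_ge0// mulr_ge0// addr_ge0 ?divr_ge0 ?nrm_ge0.
have [rho0 rho00 hrho0] : exists2 d : R, 0 < d & forall i,
    exists M, hol_ball (fun x => H x 0 i) p d M.
  apply: (@ex_common_delta R n (fun i d => exists M, hol_ball (fun x => H x 0 i) p d M)).
    move=> i d d' dd [M hM]; exists M => w wd; apply: hM; exact: le_trans dd.
  move=> i; have hi : hol_near (fun x => H x 0 i) p.
    have [s s0 hs] := hol_in_near hH (proj2 (br p) pr).
    by exists s => // w /hs; exact: hol_coord.
  by have [s [M [s0 _ hM]]] := hol_near_ball hi; exists s => //; exists M.
pose rho := Num.min (Num.min d1 d2) (Num.min (r - nrm p) (rho0 / 2)).
have rho_gt0 : 0 < rho by rewrite !lt_min d10 d20 subr_gt0 pr divr_gt0.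
have Zgraph x y : nrm (x - p) < rho -> nrm (y - p) < rho -> j x = 0 -> j y = 0 ->
   nrm (x - y) <= (L + 1) * nrm ((x - y) 0 1).
  rewrite !lt_min => /andP[/andP[x1 _] /andP[xr _]] /andP[/andP[y1 _] /andP[yr _]] jx jy.
  have nr z : nrm (z - p) < r - nrm p -> nrm z < r.
    by move=> zp; have := nrmD (z - p) p; rewrite subrK; lra.
  have := hd1 x y x1 y1; rewrite (hZ x) ?(hZ y) ?nr// subrr sub0r nrmN.
  rewrite {1 2 3}[x - y]plane_eta derD !derZ -/a -/b.
  set u := (x - y) 0 0; set v := (x - y) 0 1 => E.
  have N := nrm_plane u v.
  have E2 : nrm a * nrm u <= nrm b * nrm v + nrm a / 2 * (nrm u + nrm v).
    have := nrm_lerD (u *: a) (v *: b); rewrite !nrmZ => E3.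
    have E4 : nrm a / 2 * nrm (u *: e0 + v *: e1) <= nrm a / 2 * (nrm u + nrm v).
      by rewrite ler_wpM2l// divr_ge0// nrm_ge0.
    rewrite [nrm b * _]mulrC [nrm a * nrm u]mulrC.
    by move: E E3 E4; lra.
  have U : nrm u <= L * nrm v.
    rewrite /L mulrAC ler_pdivlMr//.
    by move: E2; move: (nrm u) (nrm v) (nrm a) (nrm b) => *; lra.
  by rewrite (le_trans N)// mulrDl mul1r lerD2r.
pose s := rho / 2.
have s0 : 0 < s by rewrite divr_gt0.
have line (l m : C) : nrm l <= s -> nrm m < s -> nrm (p + (l *: e0 + m *: e1) - p) < rho.
  move=> ls ms; rewrite addrAC subrr add0r (le_lt_trans (nrm_plane _ _))//.
  by rewrite /s in ls ms; lra.
have sub1 x y : (x + y) 0 1 = x 0 1 + y 0 1 by rewrite mxE.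
have pl1 l m : (l *: e0 + m *: e1) 0 1 = m by rewrite plane_coord mxE.
have nzs l : nrm l = s -> j (p + (l *: e0 + 0 *: e1)) != 0.
  move=> ls; apply/eqP => jl.
  have := Zgraph _ _ (line l 0 _ _) (_ : nrm (p - p) < rho) jl jp.
  rewrite ls lexx nrm0 subrr nrm0 => /(_ isT s0 rho_gt0).
  rewrite addrAC subrr add0r pl1 nrm0 mulr0 scale0r addr0 => l0.
  have := nrm_coord (l *: e0) 0; rewrite !mxE/= mulr1 ls => l1.
  by move: s0; rewrite ltNge (le_trans l1 l0).
have rhod2 : rho <= d2 by rewrite !ge_min lexx !orbT.
have rhor : rho <= r - nrm p by rewrite !ge_min lexx !orbT.
have inr x : nrm (x - p) < rho -> nrm x < r.
  by move=> xp; have := nrmD (x - p) p; rewrite subrK; lra.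
have hjl m l : nrm l <= s -> nrm m < s ->
    hol_at (fun l => j (p + (l *: e0 + m *: e1))) l.
  move=> ls ms; have E : (fun l => j (p + (l *: e0 + m *: e1))) =
      fun l => j ((p + m *: e1) + l *: e0).
    by apply/funext => t; rewrite [t *: _ + _]addrC addrA.
  rewrite E; apply: (proj1 (@hol_line R _ j _ _ _ _)).
  have := line l m ls ms; rewrite [l *: _ + _]addrC addrA => lm.
  by apply: hj; apply/br; apply: inr.
have [c c0 hc] : exists2 c : R, 0 < c & forall l, nrm l = s -> c <= nrm (j (p + (l *: e0 + 0 *: e1))).
  apply: (@circle_min R s (fun l => j (p + (l *: e0 + 0 *: e1)))) => //; first exact: ltW.
  by apply: cont_circle_hol => l ls; apply: hjl; rewrite ?ls ?nrm0.
have jLip x y : nrm (x - p) < rho -> nrm (y - p) < rho ->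
    nrm (j x - j y) <= (1 + K2) * nrm (x - y).
  move=> xp yp; have := hd2 x y (lt_le_trans xp rhod2) (lt_le_trans yp rhod2).
  have := hK2 (x - y); have := nrm_lerB (j x - j y) (der j p (x - y)).
  by rewrite mulrDl; lra.
pose eta := Num.min (s / (2 * (L + 1))) (c / (4 * (1 + K2))).
have eta0 : 0 < eta by rewrite lt_min !divr_gt0// mulr_gt0// ltr_wpDl// ?ltW//.
have K21 : 0 < 1 + K2 by rewrite addr_gt0.
have L1 : 0 < L + 1 by rewrite ltr_wpDl.
have etas : eta < s.
  have : eta <= s / (2 * (L + 1)) by rewrite ge_min lexx.
  rewrite ler_pdivlMr ?mulr_gt0// => ?; nra.
have etac : (1 + K2) * eta <= c / 4.
  have : eta <= c / (4 * (1 + K2)) by rewrite ge_min lexx orbT.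
  by rewrite ler_pdivlMr ?mulr_gt0//; lra.
(* A zero exists over every small [m]: otherwise the inverse of [j] would be holomorphic on the disc
   over [m] and violate the maximum principle, [j] being at most [c / 4] at the centre and at least
   [3 * c / 4] on the boundary. *)
have exz m : nrm m <= eta -> exists l : C, nrm l <= s /\ j (p + (l *: e0 + m *: e1)) = 0.
  move=> me; have ms : nrm m < s by exact: le_lt_trans etas.
  apply: contrapT => /forallNP Hn.
  have nz l : nrm l <= s -> j (p + (l *: e0 + m *: e1)) != 0.
    by move=> ls; apply/eqP => jl; apply: (Hn l).
  have diff l : nrm l <= s -> nrm (j (p + (l *: e0 + m *: e1)) - j (p + (l *: e0 + 0 *: e1))) <= c / 4.
    move=> ls; apply: le_trans etac; have := jLip _ _ (line l m ls ms) (line l 0 ls _).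
    rewrite nrm0 => /(_ s0) /le_trans; apply; rewrite ler_pM2l//.
    rewrite (_ : _ - _ = m *: e1); last by apply/rowP => i; rewrite !mxE; ring.
    by rewrite nrmZ (le_trans _ me)// ler_piMr ?nrm_ge0 ?nrm_e1.
  have c34 : 0 < 3 * c / 4 by lra.
  have := @max_principle R s (fun l => (j (p + (l *: e0 + m *: e1)))^-1) (3 * c / 4)^-1 0 s0.
  have hV l : nrm l <= s -> hol_at (fun l => (j (p + (l *: e0 + m *: e1)))^-1) l.
    by move=> ls; apply: holV; [exact: hjl|exact: nz].
  have hb l : nrm l = s -> nrm (j (p + (l *: e0 + m *: e1)))^-1 <= (3 * c / 4)^-1.
    move=> ls; have ls' : nrm l <= s by rewrite ls.
    have := hc l ls; have := diff l ls'; move: (nz l ls').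
    rewrite -nrm_gt0 nrmV => n1 n2 n3; rewrite lef_pV2 ?posrE//.
    have := nrm_lerB (j (p + (l *: e0 + 0 *: e1))) (j (p + (l *: e0 + m *: e1))).
    by rewrite nrmBC; lra.
  move=> /(_ hV hb); rewrite nrm0 (ltW s0) => /(_ isT).
  have := nz 0; have := diff 0; rewrite nrm0 (ltW s0) => /(_ isT) n1 /(_ isT) n2.
  rewrite nrmV lef_pV2 ?posrE ?nrm_gt0//.
  have : nrm (j (p + (0 *: e0 + m *: e1))) <= c / 4.
    by move: n1; rewrite [j (p + (0 *: e0 + 0 *: e1))](_ : _ = 0) ?subr0// !scale0r !addr0.
  by move=> ? ?; lra.
have [z hz] : exists z : C -> C, forall m, nrm m <= eta ->
    nrm (z m) <= s /\ j (p + (z m *: e0 + m *: e1)) = 0.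
  have [z hz] : {z : C -> C & forall m, nrm m <= eta ->
      nrm (z m) <= s /\ j (p + (z m *: e0 + m *: e1)) = 0}.
    apply: (@choice _ _ (fun m l => nrm m <= eta ->
      nrm l <= s /\ j (p + (l *: e0 + m *: e1)) = 0)) => m.
    have [me|_] := boolP (nrm m <= eta); last by exists 0.
    by have [l hl] := exz m me; exists l.
  by exists z.
pose q m := p + (z m *: e0 + m *: e1).
have qrho m : nrm m <= eta -> nrm (q m - p) < rho.
  by move=> me; apply: line; [case: (hz m me)|exact: le_lt_trans etas].
have q1 m m' : (q m - q m') 0 1 = m - m'.
  have -> : q m - q m' = (z m - z m') *: e0 + (m - m') *: e1.
    by apply/rowP => i; rewrite !mxE; ring.
  exact: pl1.
have qLip m m' : nrm m <= eta -> nrm m' <= eta ->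
    nrm (q m - q m') <= (L + 1) * nrm (m - m').
  move=> me me'; rewrite -q1; apply: Zgraph; [exact: qrho|exact: qrho| |].
    by case: (hz m me).
  by case: (hz m' me').
(* The derivative of [H] vanishes at the points of the graph, so the Taylor remainder and the
   Lipschitz bound [qLip] make the increments of [H] along the graph quadratically small. *)
have H0 : H (q eta%:C) = H (q 0).
  apply/rowP => i; have [M hM] := hrho0 i.
  pose u x := H x 0 i.
  have M0 : 0 <= M.
    have pp : nrm (p - p) <= rho0 by rewrite subrr nrm0 ltW.
    by have [_] := hM p pp; apply: le_trans; exact: nrm_ge0.
  pose B := 2 * M / (rho0 / 2) ^+ 2.
  have B0 : 0 <= B by rewrite divr_ge0 ?sqr_ge0// mulr_ge0.
  have := @quadratic_constant (fun t => u (q t%:C)) eta (B * (L + 1) ^+ 2) (rho0 / 4 / (L + 1)) eta0.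
  apply.
  - by rewrite !divr_gt0.
  - by rewrite mulr_ge0// sqr_ge0.
  move=> t t' /andP[t0 t1] /andP[t0' t1'].
  rewrite ler_pdivlMr// => tt.
  have te : nrm (t%:C : C) <= eta by rewrite nrm_pos.
  have te' : nrm (t'%:C : C) <= eta by rewrite nrm_pos.
  have Q := qLip _ _ te te'; rewrite -rmorphB nrm_real in Q.
  have hq : nrm (q t'%:C - q t%:C) <= rho0 / 2 / 2.
    rewrite nrmBC (le_trans Q)// mulrC (le_trans tt)//; lra.
  have hb : hol_ball u (q t%:C) (rho0 / 2) M.
    apply: (hol_ball_sub hM); have := qrho _ te; rewrite !lt_min.
    by move=> /and3P[_ _ /ltW h1]; rewrite [leRHS]splitr lerD2r.
  have r2 : 0 < rho0 / 2 by rewrite divr_gt0.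
  have := ball_taylor2 r2 hb hq.
  have Hh : hol_at H (q t%:C) by apply: hH; apply/br; apply: inr; exact: qrho.
  rewrite der_coord// hcrit; [|by apply: inr; exact: qrho|by case: (hz _ te)].
  have zi : (0 : 'rV[C]_n) 0 i = 0 by rewrite mxE.
  rewrite zi subr0 (subrKC (q t%:C)) => T2; rewrite nrmBC; apply: (le_trans T2).
  by apply: (quadratic_le B0 (nrm_ge0 _)); rewrite nrmBC; exact: Q.
have eta1 : nrm (eta%:C : C) <= eta by rewrite (nrm_pos (ltW eta0)).
have eta2 : nrm (0 : C) <= eta by rewrite nrm0 ltW.
have E := inj _ _ (inr _ (qrho eta%:C eta1)) (inr _ (qrho 0 eta2)) H0.
have := q1 eta%:C 0; rewrite E subrr mxE subr0 => /(congr1 (@nrm R C)).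
by rewrite nrm0 (nrm_pos (ltW eta0)) => E0; move: eta0; rewrite -E0 ltxx.
Qed.

(** If [j] vanished identically, [H] would be constant. Otherwise a linear change of coordinates
    takes [e0] to a point [v] with [j v != 0], and the identity theorem on the line through [v]
    supplies the nonzero values near 0 that [zero_graph] requires. *)
Lemma no_critical_plane j H r : 0 < r -> hol_in j 0 r -> hol_in H 0 r ->
  (forall x, nrm x < r -> j x = 0 -> forall h, der H x h = 0) ->
  (forall x y, nrm x < r -> nrm y < r -> H x = H y -> x = y) ->
  j 0 = 0 -> False.
Proof.
move=> r0 hj hH hcrit inj j0.
have [v vr jv] : exists2 v, nrm v < r & j v != 0.
  apply: contrapT => Hn.
  have jz x : nrm x < r -> j x = 0.
    by move=> xr; apply/eqP; apply: contraT => jx; exfalso; apply: Hn; exists x.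
  pose x := (r / 2)%:C *: e0.
  have r2 : 0 < r / 2 by rewrite divr_gt0.
  have xr : nrm x < r.
    rewrite nrmZ nrm_pos ?(ltW r2)//; apply: (@le_lt_trans _ _ (r / 2)); last lra.
    by rewrite ler_piMr ?nrm_e0// ltW.
  have : H x = H 0.
    apply/rowP => i; apply/eqP; rewrite -subr_eq0 -nrm_eq0 eq_le nrm_ge0 andbT.
    have := @mean_value_le R _ (fun z => H z 0 i) 0 x 0; rewrite add0r; apply.
    move=> t /andP[t0 t1]; rewrite add0r.
    have tx : nrm (t%:C *: x) < r.
      by apply: le_lt_trans xr; rewrite nrmZ nrm_pos// ler_piMl ?nrm_ge0.
    have ht : hol_at H (t%:C *: x) by apply: hH; rewrite subr0.
    split; first exact: hol_coord.
    by rewrite der_coord// hcrit ?jz// mxE nrm0.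
  move/inj; rewrite nrm0 => /(_ xr r0) /(congr1 (fun u : V2 => u 0 0)).
  rewrite !mxE/= mulr1 => /(congr1 (@nrm R C)).
  by rewrite nrm0 nrm_pos ?(ltW r2)// => E; move: r2; rewrite E ltxx.
have v0 : v != 0 by apply: contraNneq jv => ->; rewrite j0.
have vn : 0 < nrm v by rewrite nrm_gt0.
pose w := if v 0 0 != 0 then e1 else e0.
pose M : 'M[C]_2 := \matrix_(i, k) (if i == 0 then v 0 k else w 0 k).
have uM : M \in unitmx.
  apply: unitmx_inj => u.
  have -> : u *m M = u 0 0 *: v + u 0 1 *: w.
    apply/rowP => k; rewrite !mxE big_ord_recl big_ord1 !mxE/=.
    by congr (_ + u 0 _ * _); apply/val_inj.
  move=> /rowP E; move: (E 0) (E 1); rewrite !mxE => E0 E1.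
  rewrite [u]plane_eta; move: E0 E1; rewrite /w; case: ifPn => [v00|].
    rewrite !mxE/= mulr0 mulr1 addr0 => /eqP; rewrite mulf_eq0 (negbTE v00) orbF.
    by move=> /eqP -> ; rewrite mul0r add0r => ->; rewrite !scale0r addr0.
  rewrite negbK => /eqP v00; rewrite v00 !mxE/= mulr0 mulr1 mulr0 add0r addr0.
  move=> -> /eqP; rewrite mulf_eq0 => /orP[/eqP ->|/eqP v01].
    by rewrite !scale0r addr0.
  by move: v0; rewrite [v]plane_eta v00 v01 !scale0r addr0 eqxx.
have eM : e0 *m M = v.
  rewrite -rowE; apply/rowP => k; rewrite !mxE//.
have [K K0 hK] := nrm_mulmx M.
have rK : 0 < r / K by rewrite divr_gt0.
have xM x : nrm x < r / K -> nrm (x *m M) < r.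
  by move=> xr; rewrite (le_lt_trans (hK x))// mulrC -ltr_pdivlMr.
have hM x := hol_mulmx M x.
apply: (@zero_graph (fun x => j (x *m M)) (fun x => H (x *m M)) (r / K)) => //.
- move=> x; rewrite subr0 => /xM xr; apply: hol_comp; first by case: (hM x).
  by apply: hj; rewrite subr0.
- move=> x; rewrite subr0 => /xM xr; apply: hol_comp; first by case: (hM x).
  by apply: hH; rewrite subr0.
- move=> x /xM xr jx h; rewrite (@der_comp _ _ _ _ (fun x => x *m M) H).
  + by rewrite hcrit.
  + by case: (hM x).
  by apply: hH; rewrite subr0.
- move=> x y /xM xr /xM yr /(inj _ _ xr yr) E.
  by have := congr1 (fun u => u *m invmx M) E; rewrite !mulmxK.
- by rewrite mul0mx.
move=> d d0; apply: contrapT => Hn.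
have jl l : nrm l < d -> j (l *: v) = 0.
  move=> ld; apply/eqP; apply: contraT => jx; exfalso; apply: Hn.
  by exists l; rewrite // -scalemxAl eM.
(* A radius beyond 1 for which the disc [l *: v] still lies in the ball, so that 1 is interior in
   [identity_disc]. *)
pose s := (1 + r / nrm v) / 2.
have rv : 1 < r / nrm v by rewrite ltr_pdivlMr// mul1r.
have s1 : 1 < s by rewrite /s; lra.
have sv : s * nrm v < r by rewrite -ltr_pdivlMr// /s; lra.
have hl l : nrm l <= s -> hol_at (fun l => j (l *: v)) l.
  move=> ls; have E : (fun l => j (l *: v)) = fun l => j (0 + l *: v).
    by apply/funext => t; rewrite add0r.
  rewrite E; apply: (proj1 (@hol_line R _ j _ _ _ _)).
  by apply: hj; rewrite add0r subr0 nrmZ (le_lt_trans _ sv)// ler_wpM2r ?nrm_ge0.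
have := @identity_disc R s (fun l => j (l *: v)) d d0 hl jl 1.
by rewrite nrm1 scale1r => /(_ s1) E; move: jv; rewrite E eqxx.
Qed.

End CriticalPlane.

(** * Osgood's theorem *)

Section LocalInverse.
Context {R : realType} {n : nat}.
Local Notation C := R[i].
Local Notation V := 'rV[C]_n.
Implicit Types (F g : V -> V) (a x y : V).

Lemma unitmx_lower (J : 'M[C]_n) (c : R) : 0 < c ->
  (forall h : V, c * nrm h <= nrm (h *m J)) -> J \in unitmx.
Proof.
move=> c0 hJ; apply: unitmx_inj => u uJ.
apply/eqP; rewrite -nrm_eq0 eq_le nrm_ge0 andbT.
by have := hJ u; rewrite uJ nrm0 pmulr_rle0.
Qed.

(** A linear lower bound on the increments of [F] passes to the derivative, with half the constant,
    and so makes the matrix injective. *)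
Lemma jac_unit_lower F x c r : 0 < c -> 0 < r -> hol_at F x ->
  (forall y, nrm (y - x) < r -> c * nrm (y - x) <= nrm (F y - F x)) ->
  jac F x \in unitmx.
Proof.
move=> c0 r0 hF hc; have c2 : 0 < c / 2 by rewrite divr_gt0.
have [d d0 hd] := hol_eps hF c2.
apply: (unitmx_lower c2) => h; rewrite -der_jac.
have h1 : 0 < nrm h + 1 by rewrite ltr_wpDl ?nrm_ge0.
pose t := Num.min r d / 2 / (nrm h + 1).
have m0 : 0 < Num.min r d by rewrite lt_min r0.
have t0 : 0 < t by rewrite !divr_gt0.
pose k := t%:C *: h.
have nk : nrm k = t * nrm h by rewrite nrmZ nrm_pos// ltW.
have km : nrm k < Num.min r d.
  rewrite nk; apply: (@le_lt_trans _ _ (t * (nrm h + 1))).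
    by rewrite ler_pM2l// lerDl.
  by rewrite /t mulfVK ?gt_eqF//; lra.
move: (km); rewrite lt_min => /andP[kr kd].
have xk : x + k - x = k by rewrite addrC addKr.
have := hc (x + k); rewrite xk => /(_ kr) H1; have := hd k kd => H2.
have := nrm_lerB (F (x + k) - F x) (F (x + k) - F x - der F x k).
have dk : der F x k = t%:C *: der F x h by exact: derZ.
rewrite dk in H2 *; rewrite subKr nrmZ nrm_pos ?(ltW t0)// => H3.
by rewrite -(ler_pM2l t0) mulrCA -nk; lra.
Qed.

Lemma local_inverse F a r : 0 < r -> hol_in F a r -> jac F a \in unitmx ->
  exists g e, [/\ 0 < e, g (F a) = a, hol_in g (F a) e &
    forall y, nrm (y - F a) < e ->
      [/\ F (g y) = y, nrm (g y - a) < r & jac F (g y) \in unitmx]].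
Proof.
move=> r0 hF uJ.
have hn : hol_near F a by apply: (hol_in_near hF); rewrite subrr nrm0.
have [s [c [s0 c0 _ [low onto]]]] := local_lipschitz_inverse hn uJ.
pose p := Num.min s r / 2.
have m0 : 0 < Num.min s r by rewrite lt_min s0.
have p0 : 0 < p by rewrite divr_gt0.
have pm : p < Num.min s r by rewrite /p; lra.
move: (pm); rewrite lt_min => /andP[ps pr].
have [e e0 he] := onto p p0 ps.
have [g hg] : {g : V -> V & forall y, nrm (y - F a) < e ->
    nrm (g y - a) <= p /\ F (g y) = y}.
  apply: (@choice _ _ (fun y x => nrm (y - F a) < e -> nrm (x - a) <= p /\ F x = y)) => y.
  have [ye|_] := boolP (nrm (y - F a) < e); last by exists a.
  by have [x xp Fx] := he y ye; exists x.
have ap : nrm (a - a) < s by rewrite subrr nrm0.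
have Fae : nrm (F a - F a) < e by rewrite subrr nrm0.
have gs y : nrm (y - F a) < e -> nrm (g y - a) < s.
  by move=> /hg[h _]; exact: le_lt_trans ps.
have gr y : nrm (y - F a) < e -> nrm (g y - a) < r.
  by move=> /hg[h _]; exact: le_lt_trans pr.
have gl y y' : nrm (y - F a) < e -> nrm (y' - F a) < e ->
    c * nrm (g y - g y') <= nrm (y - y').
  by move=> ye ye'; have := low _ _ (gs y ye) (gs y' ye'); rewrite (hg y ye).2 (hg y' ye').2.
have unitg y : nrm (y - F a) < e -> jac F (g y) \in unitmx.
  move=> ye; have yr := gr y ye; have ys := gs y ye.
  apply: (@jac_unit_lower F (g y) c (s - nrm (g y - a)) c0); first by rewrite subr_gt0.
    exact: hF.
  move=> x xs; apply: low => //; rewrite (le_lt_trans (nrmBD (g y) x a))//; lra.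
have gFa : g (F a) = a.
  have := low _ _ (gs (F a) Fae) ap; rewrite (hg _ Fae).2 subrr nrm0 pmulr_rle0// => H.
  by apply/eqP; rewrite -subr_eq0 -nrm_eq0 eq_le nrm_ge0 H.
exists g, e; split=> //; last by move=> y ye; split; [case: (hg y ye)|exact: gr|exact: unitg].
move=> y ye.
have Fgy : F (g y) = y by case: (hg y ye).
rewrite -Fgy; apply: hol_inverse; rewrite ?Fgy.
- by apply: hF; exact: gr.
- exact: unitg.
- by [].
- apply: cont_at_eps => e' e'0.
  exists (Num.min (e - nrm (y - F a)) (c * e')); first by rewrite lt_min subr_gt0 ye mulr_gt0.
  move=> y'; rewrite lt_min => /andP[y1 y2].
  have y'e : nrm (y' - F a) < e by rewrite (le_lt_trans (nrmBD y y' (F a)))//; lra.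
  by have := gl y' y y'e ye; rewrite -(ltr_pM2l c0); lra.
apply: (@near_nrm _ _ _ _ (e - nrm (y - F a))); first by rewrite subr_gt0.
move=> y' yy; have y'e : nrm (y' - F a) < e by rewrite (le_lt_trans (nrmBD y y' (F a)))//; lra.
by case: (hg y' y'e).
Qed.

End LocalInverse.

Section Osgood.
Context {R : realType}.
Local Notation C := R[i].

Lemma hol_add (V : normedModType C) n (F G : V -> 'rV[C]_n) z :
  hol_at F z -> hol_at G z -> hol_at (fun x => F x + G x) z.
Proof. by move=> [df] [dg]; split; exact: (differentiableD df dg). Qed.

Lemma der_add (V : normedModType C) n (F G : V -> 'rV[C]_n) z h :
  hol_at F z -> hol_at G z ->
  der (fun x => F x + G x) z h = der F z h + der G z h.
Proof.
move=> [df] [dg]; rewrite !derE.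
by have := congr1 (fun u => u h) (diffD df dg).
Qed.

Lemma hol_sum (V : normedModType C) I (s : seq I) (f : I -> V -> C) z :
  (forall i, hol_at (f i) z) -> hol_at (fun x => \sum_(i <- s) f i x) z.
Proof.
move=> hf; elim: s => [|i s IH].
  by under eq_fun do rewrite big_nil; exact: hol_cst.
by under eq_fun do rewrite big_cons; exact: holD.
Qed.

Lemma hol_prod (V : normedModType C) I (s : seq I) (f : I -> V -> C) z :
  (forall i, hol_at (f i) z) -> hol_at (fun x => \prod_(i <- s) f i x) z.
Proof.
move=> hf; elim: s => [|i s IH].
  by under eq_fun do rewrite big_nil; exact: hol_cst.
by under eq_fun do rewrite big_cons; exact: holM.
Qed.

Lemma hol_jac n (F : 'rV[C]_n -> 'rV[C]_n) z i k :
  hol_near F z -> hol_at (fun x => jac F x i k) z.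
Proof.
move=> hF; under eq_fun do rewrite mxE.
have hz : hol_near (fun x => F x 0 k) z.
  by case: hF => r r0 hr; exists r => // w /hr; exact: hol_coord.
have [r r0 hr] := hF.
apply: (@hol_eq_near R _ _ _ (fun x => der (fun x => F x 0 k) x (delta_mx 0 i))).
  by apply: (near_nrm r0) => w /hr hw; rewrite (der_coord _ _ hw).
exact: hol_der.
Qed.

Lemma hol_det_jac n (F : 'rV[C]_n -> 'rV[C]_n) z :
  hol_near F z -> hol_at (fun x => \det (jac F x)) z.
Proof.
move=> hF; rewrite /determinant; apply: hol_sum => s.
apply: holM; first exact: hol_cst.
by apply: hol_prod => i; exact: hol_jac.
Qed.

Lemma jac_mulmx n (M N : 'M[C]_n) (F : 'rV[C]_n -> 'rV[C]_n) (a x : 'rV[C]_n) :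
  hol_at F (a + x *m M) ->
  hol_at (fun x => F (a + x *m M) *m N) x /\
  jac (fun x => F (a + x *m M) *m N) x = M *m jac F (a + x *m M) *m N.
Proof.
move=> hF; have [h1 d1] := hol_mulmx M x.
have h2 : hol_at (fun x => a + x *m M) x.
  by apply: hol_add h1; split; exact: differentiable_cst.
have d2 h : der (fun x => a + x *m M) x h = h *m M.
  have h0 : hol_at (fun _ : 'rV[C]_n => a) x by split; exact: differentiable_cst.
  by rewrite (der_add h h0 h1) d1 derE diff_cst add0r.
have h3 := hol_comp h2 hF; have [h4 d4] := hol_mulmx N (F (a + x *m M)).
split; first exact: hol_comp h3 h4.
apply/row_matrixP => i; apply/rowP => k.
rewrite [LHS]mxE [LHS]mxE (der_comp _ h3 h4) d4 (der_comp _ h2 hF) d2 der_jac.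
by rewrite -!mulmxA -rowE.
Qed.

(** Rank count: invertibility forces [B *m pid_mx k] to have rank at least [k], while [B] has rank
    at most [k]; thus [pid_mx k] is injective on the row space of [B], and it kills [u *m B]. *)
Lemma complement_kernel n k (B : 'M[C]_n) (u h : 'rV[C]_n) : (k <= n)%N ->
  B *m pid_mx k + copid_mx k \in unitmx -> (\rank B <= k)%N ->
  u *m (B *m pid_mx k + copid_mx k) = h -> h *m copid_mx k = h -> u *m B = 0.
Proof.
move=> kn uJ rB uh hQ.
have BP : u *m B *m (pid_mx k : 'M[C]_n) = 0.
  have := congr1 (mulmx^~ (pid_mx k : 'M[C]_n)) uh.
  rewrite /= mulmxDr mulmxDl -!mulmxA pid_mx_id// mul_copid_mx_pid// mulmx0 addr0.
  by move=> ->; rewrite -hQ -mulmxA mul_copid_mx_pid// mulmx0.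
have := mxrank_add (B *m (pid_mx k : 'M[C]_n)) (copid_mx k).
rewrite (mxrank_unit uJ) rank_copid_mx// => rJ.
have rP : (k <= \rank (B *m (pid_mx k : 'M[C]_n)))%N by lia.
have := mxrank_mul_ker B (pid_mx k : 'M[C]_n) => rK.
have : (\rank (B :&: kermx (pid_mx k : 'M[C]_n))%MS <= 0)%N.
  rewrite -(leq_add2l (\rank (B *m (pid_mx k : 'M[C]_n)))) rK addn0.
  exact: leq_trans rP.
rewrite leqn0.
rewrite mxrank_eq0 => /eqP K0; apply/eqP; rewrite -submx0 -K0 sub_capmx submxMl.
exact/sub_kermxP.
Qed.

Lemma hol_affine m n (M : 'M[C]_(m, n)) a x : hol_at (fun x : 'rV[C]_m => a + x *m M) x
  /\ forall h, der (fun x : 'rV[C]_m => a + x *m M) x h = h *m M.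
Proof.
have [h1 d1] := hol_mulmx M x.
have h0 : hol_at (fun _ : 'rV[C]_m => a) x by split; exact: differentiable_cst.
split; first by apply: hol_add h1.
by move=> h; rewrite (der_add h h0 h1) d1 derE diff_cst add0r.
Qed.

(** The first [k] components of [G] and the last [n - k] coordinates form a chart [Psi]. Read in
    this chart, the first [k] components of [G] are coordinates, and at zeros of the determinant the
    rank bound kills the derivative in the remaining directions. Fixing the first [k] coordinates
    leaves a slice on which [G] is still injective. *)
Lemma osgood_normal n (G : 'rV[C]_n -> 'rV[C]_n) k s : 0 < s -> (k < n)%N ->
  hol_in G 0 s ->
  (forall x y, nrm x < s -> nrm y < s -> G x = G y -> x = y) ->
  jac G 0 = pid_mx k ->
  (forall x, nrm x < s -> \det (jac G x) = 0 -> (\rank (jac G x) <= k)%N) -> False.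
Proof.
move=> s0 kn hG injG JG rkG; have kn' := ltnW kn.
pose P : 'M[C]_n := pid_mx k; pose Q : 'M[C]_n := copid_mx k.
have PQ1 : P + Q = 1%:M by rewrite /P /Q /copid_mx addrC subrK.
pose Psi x := G x *m P + x *m Q.
have hPsi x : nrm x < s -> hol_at Psi x /\ forall h, der Psi x h = h *m (jac G x *m P + Q).
  move=> xs; have hx : hol_at G x by apply: hG; rewrite subr0.
  have [h1 d1] := hol_mulmx P (G x); have [h2 d2] := hol_mulmx Q x.
  have h3 := hol_comp hx h1; split; first exact: hol_add h3 h2.
  move=> h; rewrite (der_add h h3 h2) d2 (der_comp _ hx h1) d1 der_jac.
  by rewrite (mulmxDr h (jac G x *m P) Q) mulmxA.
have jPsi x : nrm x < s -> jac Psi x = jac G x *m P + Q.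
  move=> xs; apply/row_matrixP => i; rewrite [RHS]rowE -(hPsi x xs).2.
  by apply/rowP => c; rewrite !mxE.
have s00 : nrm (0 : 'rV[C]_n) < s by rewrite nrm0.
have hPsiB : hol_in Psi 0 s by move=> x; rewrite subr0 => /hPsi[].
have J0 : jac Psi 0 \in unitmx by rewrite jPsi// JG pid_mx_id// PQ1 unitmx1.
have [g [e [e0 g0 hg gP]]] := local_inverse s0 hPsiB J0.
set y0 := Psi 0 in g0 hg gP.
have gs y : nrm (y - y0) < e -> nrm (g y) < s by move=> /gP[_]; rewrite subr0.
have hH y : nrm (y - y0) < e -> hol_at (fun y => G (g y)) y.
  move=> ye; apply: hol_comp (hg y ye) _; apply: hG; rewrite subr0; exact: gs.
have dH y h : nrm (y - y0) < e -> h *m Q = h -> \det (jac G (g y)) = 0 ->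
    der (fun y => G (g y)) y h = 0.
  move=> ye hQ d0; have gy := gs y ye.
  have hGy : hol_at G (g y) by apply: hG; rewrite subr0.
  rewrite (der_comp _ (hg y ye) hGy) der_jac.
  apply: (@complement_kernel n k _ _ h) => //.
  - by rewrite -jPsi//; case: (gP y ye).
  - exact: rkG.
  rewrite -(hPsi _ gy).2 -(der_comp _ (hg y ye) (hPsi _ gy).1).
  have [hi di] := hol_mulmx (1%:M : 'M[C]_n) y.
  rewrite (@der_eq_near _ _ _ _ (fun v => v *m 1%:M) y h) ?di ?mulmx1//.
  apply: (@near_nrm _ _ _ _ (e - nrm (y - y0))); first by rewrite subr_gt0.
  move=> y' yy; rewrite mulmx1; suff /gP[] : nrm (y' - y0) < e by [].
  by rewrite (le_lt_trans (nrmBD y y' y0))//; lra.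
have injH y y' : nrm (y - y0) < e -> nrm (y' - y0) < e -> G (g y) = G (g y') -> y = y'.
  move=> ye ye' /(injG _ _ (gs y ye) (gs y' ye')) gg.
  by case: (gP y ye) => <- _ _; case: (gP y' ye') => <- _ _; rewrite gg.
have HP y t : nrm (y - y0) < e -> y = y0 + t -> t *m Q = t -> G (g y) *m P = y0 *m P.
  move=> ye yt tQ; case: (gP y ye) => Py _ _.
  have := congr1 (mulmx^~ P) Py; rewrite /= /Psi mulmxDl -!mulmxA.
  rewrite pid_mx_id// mul_copid_mx_pid// mulmx0 addr0 => ->.
  by rewrite yt mulmxDl -{1}tQ -mulmxA mul_copid_mx_pid// mulmx0 addr0.
have hJ y : nrm (y - y0) < e -> hol_at (fun y => \det (jac G (g y))) y.
  move=> ye; apply: (@hol_comp _ _ _ _ g (fun x => \det (jac G x)) _ (hg y ye)).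
  apply: hol_det_jac.
  by apply: hol_in_near hG _; rewrite subr0; exact: gs.
have det0 : \det (jac G (g y0)) = 0.
  rewrite /y0 g0 JG; apply/eqP/negPn/negP => d0.
  have : (pid_mx k : 'M[C]_n) \in unitmx by rewrite unitmxE unitfE.
  by move/mxrank_unit; rewrite rank_pid_mx//; lia.
have delQ (i : 'I_n) : (k <= i)%N -> (delta_mx 0 i : 'rV[C]_n) *m Q = delta_mx 0 i.
  move=> ki; rewrite mulmxBr mulmx1 -rowE; apply/rowP => c.
  by rewrite !mxE [(i < k)%N]ltnNge ki andbF subr0.
(* Two free directions give a plane excluded by [no_critical_plane]. With a single one, only the
   component [i] of [G] varies along the slice: a function of one variable, injective and with zero
   derivative at the centre. *)
have [k2|k2] := ltnP k.+1 n.
  pose i0 := Ordinal kn; pose i1 := Ordinal k2.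
  pose E : 'M[C]_(2, n) := \matrix_i (if i == 0 then delta_mx 0 i0 else delta_mx 0 i1).
  have EQ : E *m Q = E.
    apply/row_matrixP => i; rewrite row_mul rowK; case: (i == 0); exact: delQ.
  have [K K0 hK] := nrm_mulmx E.
  have eK : 0 < e / K by rewrite divr_gt0.
  have inb v : nrm v < e / K -> nrm (y0 + v *m E - y0) < e.
    move=> vK; rewrite addrAC subrr add0r (le_lt_trans (hK v))//.
    by rewrite mulrC -ltr_pdivlMr.
  have Ei (v : 'rV[C]_2) : (v *m E) 0 i0 = v 0 0 /\ (v *m E) 0 i1 = v 0 1.
    have h01 : (i0 == i1) = false by rewrite -val_eqE/= ltn_eqF.
    have h10 : (i1 == i0) = false by rewrite eq_sym.
    have E00 : E 0 i0 = 1 by rewrite mxE/= mxE !eqxx.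
    have E01 : E 0 i1 = 0 by rewrite mxE/= mxE h10 andbF.
    have E10 : E 1 i0 = 0 by rewrite mxE/= mxE h01 andbF.
    have E11 : E 1 i1 = 1 by rewrite mxE/= mxE !eqxx.
    have l1 : lift ord0 ord0 = 1 :> 'I_2 by exact/val_inj.
    have l0 : ord0 = 0 :> 'I_2 by exact/val_inj.
    split; rewrite mxE big_ord_recl big_ord1 l1 l0.
      by rewrite E00 E10 mulr1 mulr0 addr0.
    by rewrite E01 E11 mulr1 mulr0 add0r.
  apply: (@no_critical_plane _ n (fun v => \det (jac G (g (y0 + v *m E))))
    (fun v => G (g (y0 + v *m E))) (e / K) eK).
  - move=> v; rewrite subr0 => /inb vb.
    exact: (hol_comp (proj1 (hol_affine E y0 v)) (hJ _ vb)).
  - move=> v; rewrite subr0 => /inb vb.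
    exact: (hol_comp (proj1 (hol_affine E y0 v)) (hH _ vb)).
  - move=> v /inb vb jv h; have [ha da] := hol_affine E y0 v.
    rewrite (der_comp h ha (hH _ vb)) da dH// -mulmxA EQ//.
  - move=> v w /inb vb /inb wb vw; have /addrI vwE := injH _ _ vb wb vw.
    apply/rowP => i; have [a0 a1] := Ei v; have [b0 b1] := Ei w.
    have [i00|i0'] := eqVneq i 0; first by rewrite i00 -a0 -b0 vwE.
    suff -> : i = 1 by rewrite -a1 -b1 vwE.
    by apply/val_inj; case: i i0' => [[|[|i]] hi].
  - by rewrite mul0mx addr0.
pose i := Ordinal kn; pose d : 'rV[C]_n := delta_mx 0 i.
have dQ : d *m Q = d by apply: delQ.
have e2 : 0 < e / 2 by rewrite divr_gt0.
have nd : nrm d <= 1.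
  by apply: nrm_rV_le => // c; rewrite mxE eqxx/=; case: (c == i); rewrite ?nrm1 ?nrm0.
have inb (l : C) : nrm l <= e / 2 -> nrm (y0 + l *: d - y0) < e.
  move=> le; rewrite addrAC subrr add0r nrmZ.
  by have := ler_wpM2l (nrm_ge0 l) nd; lra.
have hHi y : nrm (y - y0) < e -> hol_at (fun y => G (g y) 0 i) y.
  by move=> ye; apply: (@hol_coord _ _ _ (fun y => G (g y))); exact: hH.
have := @injective_deriv_neq0 R (e / 2) (fun l => G (g (y0 + l *: d)) 0 i) e2.
move=> inj; suff d0 : der (fun l : C => G (g (y0 + l *: d)) 0 i) 0 1 = 0.
  move: inj; rewrite d0 eqxx => inj; suff : is_true false by [].
  move: {d0} inj; apply.
- by move=> l le; exact: (proj1 (hol_line (hHi _ (inb l le)))).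
- move=> l w le we lw.
  have : G (g (y0 + l *: d)) = G (g (y0 + w *: d)).
    apply/rowP => c; have [->//|ci] := eqVneq c i.
    have ck : (c < k)%N.
      by move: ci (ltn_ord c); rewrite -val_eqE/= => ci cn; lia.
    have coordP (v : 'rV[C]_n) : (v *m P) 0 c = v 0 c.
      rewrite mxE (bigD1 c)//= big1 => [|j jc]; rewrite !mxE ?eqxx ?ck ?mulr1 ?addr0//.
      by rewrite val_eqE (negbTE jc) mulr0.
    rewrite -[LHS]coordP -[RHS]coordP.
    rewrite (HP _ (l *: d) (inb l le))// ?(HP _ (w *: d) (inb w we))//.
      by rewrite -scalemxAl dQ.
    by rewrite -scalemxAl dQ.
  move=> /(injH _ _ (inb l le) (inb w we))/addrI/rowP/(_ i).
  by rewrite !mxE !eqxx !mulr1.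
have z0 : nrm (0 : C) <= e / 2 by rewrite nrm0 ltW.
have zz : y0 + (0 : C) *: d = y0 by rewrite scale0r addr0.
rewrite (proj2 (hol_line (hHi _ (inb 0 z0)))) zz.
have y0e : nrm (y0 - y0) < e by rewrite subrr nrm0.
by rewrite (der_coord d i (hH _ y0e)) (dH y0 d y0e dQ det0) mxE.
Qed.

(** Among the zeros of the determinant a point [p] of maximal rank [k] is chosen; the elimination
    bases of [jac F p] bring it to the form [pid_mx k], and maximality is the rank bound that
    [osgood_normal] asks for. *)
Theorem osgood n (F : 'rV[C]_n -> 'rV[C]_n) a r : hol_in F a r ->
  (forall x y, nrm (x - a) < r -> nrm (y - a) < r -> F x = F y -> x = y) ->
  forall x, nrm (x - a) < r -> jac F x \in unitmx.
Proof.
move=> hF injF x xr; case: (boolP (jac F x \in unitmx)) => // xu; exfalso.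
have detN y : (jac F y \in unitmx) = (\det (jac F y) != 0) by rewrite unitmxE unitfE.
have [k k0 kmax] : exists2 k, (exists y, [/\ nrm (y - a) < r, \det (jac F y) = 0 &
      \rank (jac F y) = k]) &
    forall y, nrm (y - a) < r -> \det (jac F y) = 0 -> (\rank (jac F y) <= k)%N.
  pose Q k := `[< exists y, [/\ nrm (y - a) < r, \det (jac F y) = 0 &
      \rank (jac F y) = k] >].
  have Q0 : exists k, Q k.
    exists (\rank (jac F x)); apply/asboolP; exists x; split=> //.
    by apply/eqP; move: xu; rewrite detN negbK.
  have Qb k : Q k -> (k <= n)%N by move=> /asboolP[y [_ _ <-]]; exact: rank_leq_row.
  case: (ex_maxnP Q0 Qb) => k /asboolP Qk km; exists k => // y yr y0.
  by apply: km; apply/asboolP; exists y.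
case: k0 => p [pr p0 pk].
have kn : (k < n)%N.
  rewrite ltn_neqAle -{2}pk rank_leq_row andbT; apply/negP => /eqP kn.
  have : jac F p \in unitmx by rewrite -row_free_unit /row_free pk kn.
  by rewrite detN p0 eqxx.
pose L := invmx (col_ebase (jac F p)); pose M := invmx (row_ebase (jac F p)).
have uL : L \in unitmx by rewrite unitmx_inv col_ebase_unit.
have uM : M \in unitmx by rewrite unitmx_inv row_ebase_unit.
have [K K0 hK] := nrm_mulmx L.
pose s := (r - nrm (p - a)) / K.
have s0 : 0 < s by rewrite divr_gt0// subr_gt0.
have inb y : nrm y < s -> nrm (p + y *m L - a) < r.
  move=> ys; rewrite addrAC (le_lt_trans (nrmD _ _))//.
  have := hK y; have : K * nrm y < r - nrm (p - a).
    by rewrite mulrC -ltr_pdivlMr.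
  lra.
have hJ y : nrm y < s -> hol_at F (p + y *m L) by move=> /inb; exact: hF.
apply: (@osgood_normal n (fun y => F (p + y *m L) *m M) k s s0 kn).
- by move=> y; rewrite subr0 => /hJ hy; have [] := jac_mulmx M hy.
- move=> y z ys zs /(can_inj (mulmxK uM)) /(injF _ _ (inb y ys) (inb z zs)).
  by move=> /addrI/(can_inj (mulmxK uL)).
- have z0 : nrm (0 : 'rV[C]_n) < s by rewrite nrm0.
  rewrite (proj2 (jac_mulmx M (hJ 0 z0))) mul0mx addr0 /L /M.
  rewrite -{2}(mulmx_ebase (jac F p)) pk -!mulmxA mulmxV ?row_ebase_unit// mulmx1.
  by rewrite mulKmx ?col_ebase_unit.
move=> y ys; rewrite (proj2 (jac_mulmx M (hJ y ys))) !det_mulmx.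
have dL : \det L != 0 by move: uL; rewrite unitmxE unitfE.
have dM : \det M != 0 by move: uM; rewrite unitmxE unitfE.
move/eqP; rewrite !mulf_eq0 (negbTE dL) (negbTE dM) orbF/= => /eqP dF.
rewrite mxrankMfree ?row_free_unit//.
by rewrite (leq_trans (mxrankM_maxr _ _))// kmax// inb.
Qed.

End Osgood.

(** * Convex balanced domains *)

Section Minkowski.
Context {R : realType} {n : nat}.
Local Notation C := R[i].
Local Notation V := 'rV[C]_n.
Local Notation minkowski := Defs.minkowski.
Implicit Types (x y z w : V) (Omega : set V) (t r : R).

Definition convex_balanced Omega : Prop :=
  [/\ domain Omega, bounded_set Omega, balanced Omega & convex_set Omega].

Lemma convex_balanced_ball Omega : convex_balanced Omega ->
  exists2 r, 0 < r & forall z, nrm z < r -> Omega z.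
Proof.
move=> [[oO _ [z Oz]] _ bal _].
have O0 : Omega 0 by rewrite -(scale0r z); apply: bal Oz; rewrite normr0 ler01.
have /open_nrm/(_ 0 O0)[r r0 hr] := oO.
by exists r => // w wr; apply: hr; rewrite subr0.
Qed.

Lemma convex_balanced_bound Omega : convex_balanced Omega ->
  exists2 M : R, 0 < M & forall z, Omega z -> nrm z <= M.
Proof.
move=> [_ [M [Mr hM]] _ _].
have M1 : `|complex.Re M| + 1 > 0 by rewrite ltr_wpDl.
exists (`|complex.Re M| + 1) => // z Oz.
have ME : M = (complex.Re M)%:C by move: Mr => /complex_realP[k ->].
have := hM ((`|complex.Re M| + 1)%:C); rewrite {1}ME ltcR => /(_ _ z Oz)/=.
rewrite nrmE lecR; apply; rewrite (le_lt_trans (ler_norm _))// ltrDl.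
exact: ltr01.
Qed.

Lemma balanced_nrm Omega (c : C) z : convex_balanced Omega -> nrm c <= 1 ->
  Omega z -> Omega (c *: z).
Proof.
by move=> [_ _ bal _] c1; apply: bal; rewrite nrmE lecR.
Qed.

Lemma scale_real_inv t : ((t%:C)^-1 : C) = (t^-1)%:C.
Proof. by rewrite fmorphV. Qed.

Lemma minkowski_up Omega z t t' : convex_balanced Omega -> 0 < t -> t <= t' ->
  Omega ((t%:C)^-1 *: z) -> Omega ((t'%:C)^-1 *: z).
Proof.
move=> hO t0 tt' Oz; have t'0 : 0 < t' by exact: lt_le_trans tt'.
have -> : (t'%:C)^-1 *: z = (t / t')%:C *: ((t%:C)^-1 *: z).
  by rewrite scalerA !scale_real_inv -rmorphM/= mulrAC divff ?gt_eqF// mul1r.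
apply: balanced_nrm => //; rewrite nrm_pos ?divr_ge0 ?(ltW t0) ?(ltW t'0)//.
by rewrite ler_pdivrMr// mul1r.
Qed.

Lemma minkowski_has_inf Omega z : convex_balanced Omega ->
  has_inf [set t : R | 0 < t /\ Omega ((t%:C)^-1 *: z)].
Proof.
move=> hO; have [r r0 hr] := convex_balanced_ball hO.
split; last by exists 0 => t [/ltW].
have a0 : 0 < (nrm z + 1) / r by rewrite divr_gt0// ltr_wpDl ?nrm_ge0.
exists ((nrm z + 1) / r); split => //; apply: hr.
rewrite scale_real_inv nrmZ nrm_pos ?invr_ge0 ?(ltW a0)// invf_div mulrAC.
by rewrite ltr_pdivrMr ?ltr_wpDl ?nrm_ge0// ltr_pM2l// ltrDl.
Qed.

Lemma minkowski_ge0 Omega z : convex_balanced Omega -> 0 <= minkowski Omega z.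
Proof.
by move=> hO; apply: lb_le_inf => [|t [/ltW]//]; case: (minkowski_has_inf z hO).
Qed.

Lemma minkowski_lt Omega z t : convex_balanced Omega -> 0 < t ->
  minkowski Omega z < t <-> Omega ((t%:C)^-1 *: z).
Proof.
move=> hO t0; split=> [h|Oz].
  have [t' [t'0 Oz] /ltW tt'] := inf_lt (minkowski_has_inf z hO).1 h.
  exact: minkowski_up t'0 tt' Oz.
have [[oO _ _] _ _ _] := hO.
have /open_nrm/(_ _ Oz)[e e0 he] := oO.
pose a := nrm z + 1.
have a0 : 0 < a by rewrite ltr_wpDl ?nrm_ge0.
(* A slightly larger scaling factor keeps [z] in the open set [Omega], which makes the inequality
   strict. *)
pose s := t^-1 + e / a / 2.
have ea : 0 < e / a by rewrite divr_gt0.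
have s0 : t^-1 < s by rewrite /s ltrDl divr_gt0.
have ti : 0 < t^-1 by rewrite invr_gt0.
have sp : 0 < s by exact: lt_trans s0.
apply: (@le_lt_trans _ _ s^-1).
  apply: ge_inf; first by case: (minkowski_has_inf z hO).
  split; first by rewrite invr_gt0.
  apply: he; rewrite !scale_real_inv invrK -scalerBl -rmorphB/= nrmZ.
  rewrite nrm_pos ?subr_ge0 ?(ltW s0)// /s addrAC subrr add0r.
  apply: (@le_lt_trans _ _ (e / a / 2 * a)).
    by apply: ler_wpM2l; [lra|rewrite /a; lra].
  have -> : e / a / 2 * a = e / 2 by field; rewrite gt_eqF.
  lra.
by rewrite -[t]invrK ltf_pV2 ?posrE.
Qed.

Lemma minkowski_domain Omega z : convex_balanced Omega ->
  Omega z <-> minkowski Omega z < 1.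
Proof.
by move=> hO; rewrite (minkowski_lt z hO ltr01) invr1 scale1r.
Qed.

Lemma minkowski_le Omega z a : convex_balanced Omega -> 0 <= a ->
  (forall t, a < t -> Omega ((t%:C)^-1 *: z)) -> minkowski Omega z <= a.
Proof.
move=> hO a0 h; apply/ler_addgt0Pr => e e0; apply/ltW/minkowski_lt => //.
  by rewrite ltr_wpDl.
by apply: h; rewrite ltrDl.
Qed.

Lemma minkowskiZ_le Omega (c : C) z : convex_balanced Omega ->
  minkowski Omega (c *: z) <= nrm c * minkowski Omega z.
Proof.
move=> hO; have m0 := minkowski_ge0 z hO.
apply: minkowski_le => //; first by rewrite mulr_ge0 ?nrm_ge0.
move=> t ct; have t0 : 0 < t by rewrite (le_lt_trans _ ct)// mulr_ge0 ?nrm_ge0.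
have [c0|c0] := eqVneq c 0.
  rewrite c0 scale0r scaler0; have [r r0 hr] := convex_balanced_ball hO.
  by apply: hr; rewrite nrm0.
have nc : 0 < nrm c by rewrite nrm_gt0.
have s0 : 0 < t / nrm c by rewrite divr_gt0.
have /minkowski_lt-/(_ hO s0) Oz : minkowski Omega z < t / nrm c.
  by rewrite ltr_pdivlMr// mulrC.
have -> : (t%:C)^-1 *: (c *: z) = (c / (nrm c)%:C) *: (((t / nrm c)%:C)^-1 *: z).
  rewrite !scalerA; congr (_ *: z); rewrite rmorphM/= fmorphV invfM invrK.
  have : (nrm c)%:C != 0 :> C by rewrite fmorph_eq0 gt_eqF.
  have : t%:C != 0 :> C by rewrite fmorph_eq0 gt_eqF.
  by move=> h1 h2; field; rewrite h1 h2.
apply: balanced_nrm => //; rewrite nrmM nrmV (nrm_pos (ltW nc)).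
by rewrite divff// gt_eqF.
Qed.

Lemma minkowskiZ Omega (c : C) z : convex_balanced Omega ->
  minkowski Omega (c *: z) = nrm c * minkowski Omega z.
Proof.
move=> hO; apply/eqP; rewrite eq_le minkowskiZ_le//=.
have [->|c0] := eqVneq c 0; first by rewrite nrm0 mul0r minkowski_ge0.
have nc : 0 < nrm c by rewrite nrm_gt0.
rewrite -ler_pdivlMl// -{1}(scalerK c0 z) -nrmV.
exact: minkowskiZ_le.
Qed.

Lemma minkowskiN Omega z : convex_balanced Omega ->
  minkowski Omega (- z) = minkowski Omega z.
Proof. by move=> hO; rewrite -scaleN1r minkowskiZ// nrmN nrm1 mul1r. Qed.

Lemma minkowski0 Omega : convex_balanced Omega -> minkowski Omega 0 = 0.
Proof. by move=> hO; rewrite -(scale0r 0) minkowskiZ// nrm0 mul0r. Qed.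

Lemma convex_real Omega x y t : convex_balanced Omega -> 0 <= t -> t <= 1 ->
  Omega x -> Omega y -> Omega (t%:C *: x + (1 - t)%:C *: y).
Proof.
move=> [_ _ _ cvx] t0 t1 Ox Oy.
have l01 : Itv.spec (@Itv.num_sem C) (Itv.Real `[Posz 0, Posz 1]%Z) (t%:C : C).
  rewrite /Itv.spec /Itv.num_sem /= in_itv/= !lecR t0 t1 andbT.
  by rewrite andbT; apply/complex_realP; exists t.
have := cvx x y (Itv.Def l01); rewrite !inE => /(_ Ox Oy).
by rewrite /conv/= rmorphB.
Qed.

Lemma minkowskiD Omega x y : convex_balanced Omega ->
  minkowski Omega (x + y) <= minkowski Omega x + minkowski Omega y.
Proof.
move=> hO; apply/ler_addgt0Pr => e e0.
have e2 : 0 < e / 2 by rewrite divr_gt0.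
pose a := minkowski Omega x + e / 2; pose b := minkowski Omega y + e / 2.
have a0 : 0 < a by rewrite ltr_wpDl ?minkowski_ge0.
have b0 : 0 < b by rewrite ltr_wpDl ?minkowski_ge0.
have Ox : Omega ((a%:C)^-1 *: x) by apply/minkowski_lt => //; rewrite ltrDl.
have Oy : Omega ((b%:C)^-1 *: y) by apply/minkowski_lt => //; rewrite ltrDl.
have ab : 0 < a + b by rewrite addr_gt0.
have -> : minkowski Omega x + minkowski Omega y + e = a + b.
  by rewrite /a /b; lra.
apply/ltW/minkowski_lt => //.
(* (x + y) / (a + b) is the convex combination of x / a and y / b with weights a / (a + b) and b /
   (a + b). *)
have := @convex_real Omega _ _ (a / (a + b)) hO _ _ Ox Oy.
rewrite divr_ge0 ?(ltW a0) ?(ltW ab)// ler_pdivrMr// mul1r lerDl (ltW b0).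
move=> /(_ isT isT); congr Omega; rewrite scalerDr !scalerA !scale_real_inv.
have ab0 : a + b != 0 by rewrite gt_eqF.
have an : a != 0 by rewrite gt_eqF.
have bn : b != 0 by rewrite gt_eqF.
by congr (_ *: x + _ *: y); rewrite -rmorphM/=; congr (_%:C); field; rewrite ?ab0 ?an ?bn.
Qed.

Lemma minkowskiB_le Omega x y : convex_balanced Omega ->
  minkowski Omega x - minkowski Omega y <= minkowski Omega (x - y).
Proof.
by move=> hO; rewrite lerBlDr -{1}(subrK y x) minkowskiD.
Qed.

Lemma minkowski_dist Omega x y : convex_balanced Omega ->
  `|minkowski Omega x - minkowski Omega y| <= minkowski Omega (x - y).
Proof.
move=> hO; rewrite ler_norml minkowskiB_le// andbT lerNl opprB.
by rewrite -(minkowskiN (x - y))// opprB minkowskiB_le.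
Qed.

Lemma minkowski_le_nrm Omega : convex_balanced Omega ->
  exists2 K : R, 0 < K & forall z, minkowski Omega z <= K * nrm z.
Proof.
move=> hO; have [r r0 hr] := convex_balanced_ball hO.
exists r^-1; first by rewrite invr_gt0.
move=> z; apply: minkowski_le => //; first by rewrite mulr_ge0 ?invr_ge0 ?nrm_ge0 ?(ltW r0).
move=> t zt; have t0 : 0 < t.
  by rewrite (le_lt_trans _ zt)// mulr_ge0 ?invr_ge0 ?nrm_ge0 ?(ltW r0).
apply: hr; rewrite scale_real_inv nrmZ nrm_pos ?invr_ge0 ?(ltW t0)//.
by rewrite mulrC ltr_pdivrMr// mulrC -ltr_pdivrMr// mulrC.
Qed.

Lemma nrm_le_minkowski Omega : convex_balanced Omega ->
  exists2 M : R, 0 < M & forall z, nrm z <= M * minkowski Omega z.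
Proof.
move=> hO; have [M M0 hM] := convex_balanced_bound hO.
exists M => // z; apply/ler_addgt0Pr => e e0.
pose t := minkowski Omega z + e / M.
have t0 : 0 < t by rewrite ltr_wpDl ?minkowski_ge0 ?divr_gt0.
have Oz : Omega ((t%:C)^-1 *: z).
  by apply/minkowski_lt => //; rewrite ltrDl divr_gt0.
have := hM _ Oz; rewrite scale_real_inv nrmZ nrm_pos ?invr_ge0 ?(ltW t0)//.
by rewrite mulrC ler_pdivrMr// /t mulrDr mulrCA divff ?gt_eqF// mulr1.
Qed.

Lemma minkowski_eq0 Omega z : convex_balanced Omega ->
  (minkowski Omega z == 0) = (z == 0).
Proof.
move=> hO; apply/eqP/eqP => [z0|->]; last exact: minkowski0.
have [M M0 hM] := nrm_le_minkowski hO.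
by apply/eqP; rewrite -nrm_eq0 eq_le nrm_ge0 andbT; have := hM z; rewrite z0 mulr0.
Qed.

Lemma minkowski_continuous Omega : convex_balanced Omega ->
  continuous (minkowski Omega).
Proof.
move=> hO z; have [K K0 hK] := minkowski_le_nrm hO.
apply/continuous_nrmR => e e0; exists (e / K); first by rewrite divr_gt0.
move=> w; rewrite ltr_pdivlMr// mulrC => wz.
apply: (le_lt_trans (minkowski_dist w z hO)).
exact: le_lt_trans wz.
Qed.

Lemma compact_minkowski Omega (q : R) : convex_balanced Omega -> 0 <= q ->
  compact [set w | minkowski Omega w <= q].
Proof.
move=> hO q0; have [M M0 hM] := nrm_le_minkowski hO.
apply: (@subclosed_compact _ _ [set v : V | nrm (v - 0) <= M * q]).
- rewrite (_ : mkset _ = minkowski Omega @^-1` [set t | t <= q])//.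
  by apply: closed_comp (@closed_le R q) => w _; exact: minkowski_continuous.
- by apply: compact_ball; rewrite mulr_ge0// ltW.
by move=> w /= wq; rewrite subr0 (le_trans (hM w))// ler_pM2l.
Qed.

End Minkowski.

Section Separation.
Context {R : realType} {n : nat}.
Local Notation C := R[i].
Local Notation V := 'rV[C]_n.
Local Notation minkowski := Defs.minkowski.
Implicit Types (x y z w u : V) (Omega : set V) (t r : R).

Definition lform (a : 'cV[C]_n) z : C := (z *m a) 0 0.

Lemma lformD a z w : lform a (z + w) = lform a z + lform a w.
Proof. by rewrite /lform mulmxDl mxE. Qed.

Lemma lformZ a (c : C) z : lform a (c *: z) = c * lform a z.
Proof. by rewrite /lform -scalemxAl mxE. Qed.

Lemma lformB a z w : lform a (z - w) = lform a z - lform a w.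
Proof. by rewrite lformD -scaleN1r lformZ mulN1r. Qed.

Lemma lform0 a : lform a 0 = 0.
Proof. by rewrite /lform mul0mx mxE. Qed.

Lemma lform_scale (c : C) a z : lform (c *: a) z = c * lform a z.
Proof. by rewrite /lform -scalemxAr mxE. Qed.

Lemma hol_lform (U : normedModType C) (F : U -> V) a (p : U) : hol_at F p ->
  hol_at (fun t : U => lform a (F t)) p.
Proof.
move=> hF; have [h _] := hol_mulmx a (F p).
exact: (@hol_coord _ _ _ (fun t : U => F t *m a) p 0 (hol_comp hF h)).
Qed.

Definition euclid z : R := \sum_j nrm (z 0 j) ^+ 2.
(** The real part of the Hermitian product, that is the Euclidean inner product of C^n as a real
    space; [euclid] is the associated squared norm. *)
Definition rdot w u : R := complex.Re (lform (map_mx conjc u^T) w).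

Lemma euclid_expand u v t :
  euclid (u - t%:C *: v) = euclid u - 2 * t * rdot v u + t ^+ 2 * euclid v.
Proof.
rewrite /euclid /rdot /lform mxE raddf_sum/= !mulr_sumr -sumrB -big_split/=.
apply: eq_bigr => j _; rewrite !mxE !nrm_sqr.
case: (u 0 j) => a b; case: (v 0 j) => c d /=; ring.
Qed.

Lemma euclid_dot u : rdot u u = euclid u.
Proof.
rewrite /euclid /rdot /lform mxE raddf_sum/=.
apply: eq_bigr => j _; rewrite !mxE nrm_sqr; case: (u 0 j) => a b /=; ring.
Qed.

Lemma euclid_gt0 u : u != 0 -> 0 < euclid u.
Proof.
move=> u0; rewrite lt_neqAle eq_sym sumr_ge0 ?andbT; last by move=> j _; rewrite sqr_ge0.
apply/negP; rewrite psumr_eq0 => [/allP h|j _]; last exact: sqr_ge0.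
move/negP: u0; apply; apply/eqP/rowP => j; rewrite mxE.
have /h : j \in index_enum 'I_n by rewrite mem_index_enum.
by rewrite /= sqrf_eq0 nrm_eq0 => /eqP.
Qed.

Lemma le0_of_linear (a b : R) : 0 <= b -> (forall t, 0 < t -> t <= 1 -> a <= t * b) -> a <= 0.
Proof.
move=> b0 h; apply/ler_addgt0Pr => e e0; rewrite add0r.
pose t := Num.min 1 (e / (b + 1)).
have b1 : 0 < b + 1 by rewrite ltr_wpDl.
have t0 : 0 < t by rewrite lt_min ltr01 divr_gt0.
have t1 : t <= 1 by rewrite ge_min lexx.
have tb : t <= e / (b + 1) by rewrite ge_min lexx orbT.
have := h t t0 t1; have : t * b <= e / (b + 1) * (b + 1).
  by apply: ler_pM => //; [exact: ltW|rewrite lerDl].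
by rewrite divfK ?gt_eqF//; lra.
Qed.

Lemma euclid_continuous : continuous (euclid : V -> R).
Proof.
move=> z; apply/cont_atP; rewrite /euclid.
elim: (index_enum _) => [|j s IH].
  by under eq_fun do rewrite big_nil; exact: cont_cst.
under eq_fun do rewrite big_cons.
have hc : cont_at (fun w : V => nrm (w 0 j)) z.
  exact: cont_nrm (hol_cont (hol_coordinate z j)).
case: IH hc => h1 [h2]; split.
exact: (continuousD (continuousM h2 h2) h1).
Qed.

(* Nearest points of the compact convex set [rho <= q] give supporting
   functionals, without the Hahn-Banach theorem. *)
Lemma separation Omega z (q : R) : convex_balanced Omega ->
  q < minkowski Omega z ->
  exists2 a, (forall w, nrm (lform a w) <= minkowski Omega w) & q < nrm (lform a z).
Proof.
wlog q0 : q / 0 < q => [wl hO qz|hO qz].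
  have [q0|q0] := ltP 0 q; first exact: wl.
  have [m0|m0] := ltP 0 (minkowski Omega z).
    have h1 : 0 < minkowski Omega z / 2 by rewrite divr_gt0.
    have h2 : minkowski Omega z / 2 < minkowski Omega z by lra.
    have [a ha qa] := wl _ h1 hO h2.
    by exists a => //; apply: lt_trans qa; rewrite (le_lt_trans q0)// divr_gt0.
  exists 0 => [w|]; rewrite /lform mulmx0 mxE nrm0 ?minkowski_ge0//.
  exact: lt_le_trans m0.
have q0' := ltW q0.
have ne : [set w | minkowski Omega w <= q] !=set0.
  by exists 0; rewrite /= minkowski0.
have [p pq pmin] : exists2 p, minkowski Omega p <= q &
    forall w, minkowski Omega w <= q -> euclid (z - p) <= euclid (z - w).
  have := @compact_EVT_min _ _ (fun w => euclid (z - w)) _ ne (compact_minkowski hO q0').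
  case.
    apply: continuous_in_subspaceT => w _.
    have h : cont_at (fun w : V => z - w) w by apply: contB; [exact: cont_cst|exact: cont_id].
    case: h => h; apply: (@continuous_comp _ _ _ (fun w : V => z - w) euclid) => //.
    exact: euclid_continuous.
  by move=> p; rewrite inE => pq pm; exists p => // w wq; apply: pm; rewrite inE.
pose u := z - p.
have u0 : u != 0.
  by apply/negP => /eqP/eqP; rewrite subr_eq0 => /eqP zp; move: pq; rewrite -zp leNgt qz.
pose a0 : 'cV[C]_n := map_mx conjc u^T.
have reE w : complex.Re (lform a0 w) = rdot w u by [].
have dotB w w' : rdot (w - w') u = rdot w u - rdot w' u.
  by rewrite /rdot lformB raddfB.
(* First-order variation: moving from the nearest point [p] towards [w] inside the convex set cannot
   shorten the distance to [z]. *)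
have half w : minkowski Omega w <= q -> rdot w u <= rdot p u.
  move=> wq; rewrite -subr_le0 -dotB.
  suff : 2 * rdot (w - p) u <= 0 by rewrite pmulr_rle0.
  apply: (@le0_of_linear _ (euclid (w - p))).
    by apply: sumr_ge0 => j _; exact: sqr_ge0.
  move=> t t0 t1; have := pmin (p + t%:C *: (w - p)).
  rewrite opprD addrA -/u euclid_expand.
  have /[swap] /[apply] : minkowski Omega (p + t%:C *: (w - p)) <= q.
    have -> : p + t%:C *: (w - p) = (1 - t)%:C *: p + t%:C *: w.
      by apply/rowP => j; rewrite !mxE rmorphB/=; ring.
    rewrite (le_trans (minkowskiD _ _ hO))// !minkowskiZ// !nrm_pos ?subr_ge0 ?(ltW t0)//.
    have h1 : (1 - t) * minkowski Omega p <= (1 - t) * q by rewrite ler_wpM2l// subr_ge0.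
    have h2 : t * minkowski Omega w <= t * q by rewrite ler_wpM2l// ltW.
    lra.
  rewrite -subr_ge0 => h; rewrite -(ler_pM2l t0).
  have -> : t * (t * euclid (w - p)) = t ^+ 2 * euclid (w - p) by ring.
  lra.
pose m := rdot p u.
(* The set is balanced, so [w] may be rotated until [lform a0 w] is a nonnegative real; the bound on
   real parts becomes one on moduli. *)
have bound w : minkowski Omega w <= q -> nrm (lform a0 w) <= m.
  move=> wq; have [c c1 cE] := normc_rotate (lform a0 w).
  have := half (c *: w); rewrite minkowskiZ// c1 mul1r => /(_ wq).
  by rewrite /rdot lformZ cE.
have mz : rdot z u = m + euclid u by rewrite -euclid_dot dotB /m; lra.
have eu := euclid_gt0 u0.
have m0 : 0 < m.
  have [K K0 hK] := minkowski_le_nrm hO.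
  have nu : 0 < nrm u by rewrite nrm_gt0.
  have s0 : 0 < q / K / nrm u by rewrite !divr_gt0.
  have := half ((q / K / nrm u)%:C *: u); rewrite minkowskiZ// nrm_pos ?(ltW s0)//.
  have hu : q / K / nrm u * minkowski Omega u <= q.
    have := hK u; rewrite -(ler_pM2l s0) => /le_trans; apply.
    suff -> : q / K / nrm u * (K * nrm u) = q by [].
    by field; rewrite !gt_eqF.
  move=> /(_ hu); rewrite /rdot lformZ.
  have -> (x : R) (c : C) : complex.Re (x%:C * c) = x * complex.Re c.
    by case: c => c d /=; ring.
  by rewrite -/(rdot u u) euclid_dot; apply: lt_le_trans; rewrite mulr_gt0.
have qm : 0 <= q / m by rewrite divr_ge0// ltW.
(* Normalised so that the modulus is at most [q] on the level set of [q]; homogeneity then gives the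
   bound by the Minkowski function everywhere. *)
exists ((q / m)%:C *: a0) => [w|]; rewrite lform_scale nrmM nrm_pos//.
  have [->|w0] := eqVneq w 0; first by rewrite lform0 nrm0 mulr0 minkowski_ge0.
  have mw : 0 < minkowski Omega w.
    by rewrite lt_neqAle eq_sym minkowski_eq0// w0 minkowski_ge0.
  have s0 : 0 < q / minkowski Omega w by rewrite divr_gt0.
  have := bound ((q / minkowski Omega w)%:C *: w).
  rewrite minkowskiZ// lformZ nrmM nrm_pos ?(ltW s0)// divfK ?gt_eqF//.
  move=> /(_ (lexx q)); rewrite mulrAC ler_pdivrMr// => h.
  by rewrite mulrAC ler_pdivrMr// [_ * m]mulrC.
have zl : m < nrm (lform a0 z).
  rewrite (lt_le_trans _ (le_trans (ler_norm _) (nrm_Re _)))//.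
  by rewrite -/(rdot z u) mz ltrDl.
by rewrite mulrAC ltr_pdivlMr// ltr_pM2l.
Qed.

End Separation.

(** * Hartogs extension *)

Section Shell.
Context {R : realType} {n : nat}.
Local Notation C := R[i].
Local Notation V := 'rV[C]_n.
Local Notation minkowski := Defs.minkowski.
Implicit Types (x y z w u : V) (Omega : set V) (t r : R) (l : C).

Lemma hol_ray (W : normedModType C) (f : V -> W) z l : hol_at f (l *: z) ->
  hol_at (fun l => f (l *: z)) l.
Proof.
move=> hf; apply: (@hol_comp _ _ _ _ (fun l : C => l *: z) f) hf.
apply: (proj1 (@hol_introf R _ _ (fun l : C => l *: z) l (fun h => h *: z) (nrm z) _ _ _)).
- by move=> a u v; rewrite scalerDl scalerA.
- by move=> h; rewrite nrmZ mulrC.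
move=> e e0; exists 1 => // h _; rewrite scalerDl [_ + h *: z]addrC addrK subrr nrm0.
by rewrite mulr_ge0 ?nrm_ge0// ltW.
Qed.

Lemma hol_scaling (W : normedModType C) (f : V -> W) l z : hol_at f (l *: z) ->
  hol_at (fun w => f (l *: w)) z.
Proof.
move=> hf; apply: (@hol_comp _ _ _ _ (fun w : V => l *: w) f) hf.
have [h _] := hol_mulmx (l%:M : 'M[C]_n) z.
apply: hol_eq_near h; apply: (@near_nrm _ _ _ _ 1) => // w _.
by rewrite mul_mx_scalar.
Qed.

Lemma mul_near (a b q : R) : q < a * b -> a * b < 1 ->
  exists2 e : R, 0 < e & forall s p, `|s - a| <= e -> `|p - b| <= e ->
    q < s * p < 1.
Proof.
move=> qab ab1; pose m := Num.min (a * b - q) (1 - a * b).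
have m0 : 0 < m by rewrite lt_min !subr_gt0 qab.
have K0 : 0 < `|a| + `|b| + 1 by rewrite ltr_wpDl// addr_ge0.
pose e := Num.min 1 (m / 2 / (`|a| + `|b| + 1)).
have e0 : 0 < e by rewrite lt_min ltr01 !divr_gt0.
have e1 : e <= 1 by rewrite ge_min lexx.
exists e => // s p sa pb.
have H : `|s * p - a * b| < m.
  have -> : s * p - a * b = (s - a) * (p - b) + (s - a) * b + a * (p - b) by ring.
  apply: (@le_lt_trans _ _ (e * (`|a| + `|b| + 1))).
    rewrite (le_trans (ler_normD _ _))// (le_trans (lerD (ler_normD _ _) (lexx _)))//.
    rewrite !normrM.
    have h1 : `|s - a| * `|p - b| <= e * 1 by apply: ler_pM => //; exact: le_trans e1.
    have h2 : `|s - a| * `|b| <= e * `|b| by apply: ler_pM.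
    have h3 : `|a| * `|p - b| <= `|a| * e by apply: ler_pM.
    by move: h1 h2 h3; lra.
  apply: (@le_lt_trans _ _ (m / 2 / (`|a| + `|b| + 1) * (`|a| + `|b| + 1))).
    by rewrite ler_pM2r// ge_min lexx orbT.
  by rewrite divfK ?gt_eqF//; lra.
have ma : m <= a * b - q by rewrite ge_min lexx.
have mb : m <= 1 - a * b by rewrite ge_min lexx orbT.
by move: H; rewrite ltr_norml => /andP[H1 H2]; apply/andP; split; lra.
Qed.

Context (Omega : set V) (f : V -> C) (B q : R) (hO : convex_balanced Omega)
  (q0 : 0 <= q) (hf : forall z, q < minkowski Omega z -> minkowski Omega z < 1 ->
  hol_at f z /\ nrm (f z) <= B).
Local Notation rho := (minkowski Omega).

(** The Cauchy integral of [l |-> f (l *: z)] over the circle of radius [s], evaluated at 1. Radii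
    above 1 give the extension at [z]; radii below 1 give the inner term of [cauchy_annulus]. *)
Definition jmean (s : R) z : C := cmean s (fun l => f (l *: z) * kern l).

Lemma jmean_hol_at z l : q < nrm l * rho z -> nrm l * rho z < 1 -> nrm l != 1 ->
  hol_at (fun l => f (l *: z) * kern l) l.
Proof.
move=> ql l1 ln; apply: (@holM _ C); last by apply: hol_kern; exact: nrm_neq1.
by apply: hol_ray; apply: (proj1 (hf _ _)); rewrite minkowskiZ.
Qed.

Lemma jmean_const s1 s2 z : 0 < s1 -> s1 <= s2 -> (s2 < 1) || (1 < s1) ->
  q < s1 * rho z -> s2 * rho z < 1 -> jmean s1 z = jmean s2 z.
Proof.
move=> s10 s12 s1s q1 q2; apply: cmean_const => // l /andP[l1 l2].
have r0 := minkowski_ge0 z hO.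
apply: jmean_hol_at.
- by rewrite (lt_le_trans q1)// ler_wpM2r.
- by rewrite (le_lt_trans _ q2)// ler_wpM2r.
by case/orP: s1s => h; [rewrite lt_eqF// (le_lt_trans l2)|rewrite gt_eqF// (lt_le_trans h)].
Qed.

Lemma kern_le (s : R) l (e : R) : s != 1 -> 0 < e -> e <= `|s - 1| / 2 ->
  `|nrm l - s| <= e -> nrm (kern l) <= (s + e) / (`|s - 1| / 2).
Proof.
move=> s1 e0 es le; rewrite nrmM nrmV.
have d0 : 0 < `|s - 1| / 2 by rewrite divr_gt0// normr_gt0 subr_eq0.
have h1 : `|s - 1| / 2 <= nrm (l - 1).
  have := nrm_lerB l (1 : C); have := nrm_lerB (1 : C) l; rewrite (nrmBC (1 : C)) nrm1.
  move: le es; rewrite !ler_norml => /andP[a b].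
  by case: (ger0P (s - 1)) => h; lra.
apply: ler_pM; rewrite ?nrm_ge0 ?invr_ge0 ?nrm_ge0//.
  by move: le; rewrite ler_norml => /andP[]; lra.
by rewrite lef_pV2 ?posrE// (lt_le_trans d0).
Qed.

Lemma jmean_hol s z : 0 < s -> s != 1 -> q < s * rho z -> s * rho z < 1 ->
  hol_at (jmean s) z.
Proof.
move=> s0 s1 qs sq; have [e e0 he] := mul_near qs sq.
have [K K0 hK] := minkowski_le_nrm hO.
have d0 : 0 < `|s - 1| / 2 by rewrite divr_gt0// normr_gt0 subr_eq0.
pose d := Num.min e (`|s - 1| / 2).
have dp : 0 < d by rewrite lt_min e0.
have de : d <= e by rewrite ge_min lexx.
have ds : d <= `|s - 1| / 2 by rewrite ge_min lexx orbT.
have eK : 0 < e / K by rewrite divr_gt0.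
have rw w : nrm (w - z) <= e / K -> `|rho w - rho z| <= e.
  rewrite ler_pdivlMr// mulrC => wz.
  by rewrite (le_trans _ wz)// (le_trans _ (hK _))// minkowski_dist.
have sh l w : `|nrm l - s| <= d -> nrm (w - z) <= e / K -> q < nrm l * rho w < 1.
  by move=> ls wz; apply: he; [exact: le_trans de|exact: rw].
pose O := [set l : C | `|nrm l - s| <= d].
apply: (@hol_cmean R V s (e / K) (B * ((s + d) / (`|s - 1| / 2))) O
  (fun l w => f (l *: w) * kern l) z s0 eK).
- move=> l ls; exists d => // l' ll; rewrite /O /= -ls.
  by rewrite ler_norml; have := nrm_lerB l l'; have := nrm_lerB l' l;
    rewrite [nrm (l - _)]nrmBC; lra.
- move=> l ls w wz; have /andP[h1 h2] := sh l w ls wz.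
  have [||hw bw] := @hf (l *: w); rewrite ?minkowskiZ//; split.
    apply: (@holM _ V); last exact: hol_cst.
    exact: hol_scaling.
  rewrite nrmM; apply: ler_pM; rewrite ?nrm_ge0//.
  exact: (kern_le s1 dp).
move=> w wz l ls; have ll : `|nrm l - s| <= d by rewrite ls subrr normr0 ltW.
have /andP[h1 h2] := sh l w ll wz.
by apply: hol_cont; apply: jmean_hol_at; rewrite ?ls//; rewrite -ls.
Qed.

Lemma jmean_le s z : 0 < s -> s < 1 -> q < s * rho z -> s * rho z < 1 ->
  nrm (jmean s z) <= B * (s / (1 - s)).
Proof.
move=> s0 s1 qs sq; apply: cmean_nrm; first exact: ltW.
  by move=> l ls; apply: hol_cont; apply: jmean_hol_at; rewrite ls// lt_eqF.
move=> l ls; rewrite nrmM.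
have [||_ bl] := @hf (l *: z); rewrite ?minkowskiZ// ?ls//.
apply: ler_pM; rewrite ?nrm_ge0//.
by have := @kern_nrm_lt1 _ l; rewrite ls => /(_ s1).
Qed.

Context (n2 : (2 <= n)%N).

(** Adding multiples of [b] to a point does not change the value of the form, so a separating form
    keeps a whole complex line away from the hole. *)
Lemma kernel_vector (a : 'cV[C]_n) : exists2 b : V, b != 0 & lform a b = 0.
Proof.
have : kermx a != 0.
  rewrite -mxrank_eq0 mxrank_ker subn_eq0 -ltnNge (leq_ltn_trans (rank_leq_col a))//.
move=> /rowV0Pn[b /sub_kermxP ba b0]; exists b => //.
by rewrite /lform ba mxE.
Qed.

(** A form of Liouville's theorem: the bound tends to 0 on large circles, and the maximum principle
    carries it to the centre. *)
Lemma hol_eq0_of_decay (g : C -> C) (M a b : R) : 0 < b -> 0 <= M ->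
  (forall l, hol_at g l) ->
  (forall l, 0 < b * nrm l - a -> nrm (g l) <= M / (b * nrm l - a)) -> g 0 = 0.
Proof.
move=> b0 M0 hg hM; apply: nrm_small_eq0 => e e0.
pose d := M / e + 1.
have d0 : 0 < d by rewrite ltr_wpDl// divr_ge0// ltW.
pose T := (`|a| + d) / b.
have T0 : 0 < T by rewrite divr_gt0// ltr_wpDl.
have bT : b * T = `|a| + d by rewrite mulrC divfK ?gt_eqF.
have dT : d <= b * T - a by rewrite bT; have := ler_norm a; lra.
apply: (@max_principle R T g e 0 T0) => [l _|l lT|]; last by rewrite nrm0 ltW.
  exact: hg.
have h : 0 < b * nrm l - a by rewrite lT; exact: lt_le_trans dT.
apply: (le_trans (hM l h)); rewrite ler_pdivrMr// lT.
apply: (@le_trans _ _ (e * d)); last by rewrite ler_pM2l.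
by rewrite /d mulrDr mulr1 mulrCA divff ?gt_eqF// mulr1; lra.
Qed.

(** A form [a] separates [z] from the level set [rho <= q]. Along [z + l *: b], with [b] in the
    kernel of [a], the inner mean glued over all admissible radii is entire in [l]; by [jmean_le] it
    is at most [B * (c / (rho w - c))] far out, so it vanishes. *)
Lemma jmean_inner s z : q < 1 -> 0 < s -> s < 1 -> q < s * rho z -> s * rho z < 1 ->
  jmean s z = 0.
Proof.
move=> q1 s0 s1 qs sq.
(* A level strictly between [q] and 1: when [rho w > c], the radius [c / rho w] is below 1 and puts
   the circle through the multiples of [w] on this level. *)
pose c := (q + 1) / 2.
have qc : q < c by rewrite /c; lra.
have c1 : c < 1 by rewrite /c; lra.
have c0 : 0 < c by exact: le_lt_trans qc.
(* By [jmean_const] the value does not depend on the admissible radius, so one function serves for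
   all radii; [w] itself may lie outside [Omega]. Where no radius is admissible the value is set to
   0. *)
have [N hN] : {N : V -> C & forall w (s : R), 0 < s -> s < 1 -> q < s * rho w -> s * rho w < 1 ->
    N w = jmean s w}.
  apply: (@choice _ _ (fun (w : V) (y : C) => forall s : R, 0 < s -> s < 1 -> q < s * rho w ->
    s * rho w < 1 -> y = jmean s w)) => w.
  have [[s' [a1 a2 a3 a4]]|h] := pselect (exists s : R, [/\ 0 < s, s < 1, q < s * rho w & s * rho w < 1]).
    exists (jmean s' w) => t t0 t1 qt tq.
    have [st|/ltW ts] := leP s' t; first by apply: jmean_const; rewrite ?t1.
    by symmetry; apply: jmean_const; rewrite ?a2.
  by exists 0 => t t0 t1 qt tq; exfalso; apply: h; exists t.
have exs w : q < rho w -> exists s, [/\ 0 < s, s < 1, q < s * rho w & s * rho w < 1].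
  move=> qw; have w0 : 0 < rho w by exact: le_lt_trans qw.
  have [cw|cw] := leP (rho w) c.
    pose t := (q / rho w + 1) / 2.
    have h1 : 0 <= q / rho w by rewrite divr_ge0// ltW.
    have h2 : q / rho w < 1 by rewrite ltr_pdivrMr// mul1r.
    exists t; split; [rewrite /t; lra|rewrite /t; lra| |].
      by rewrite -ltr_pdivrMr// /t; lra.
    by rewrite (lt_le_trans _ (ltW c1))// (lt_le_trans _ cw)// gtr_pMl// /t; lra.
  exists (c / rho w); rewrite divfK ?gt_eqF//; split => //; first by rewrite divr_gt0.
  by rewrite ltr_pdivrMr// mul1r.
have Nhol w : q < rho w -> hol_at N w.
  move=> /exs[t [t0 t1 qt tq]].
  apply: (@hol_eq_near _ _ _ _ (jmean t)); last first.
    by apply: jmean_hol => //; rewrite lt_eqF.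
  have [e e0 he] := mul_near qt tq.
  have [K K0 hK] := minkowski_le_nrm hO.
  apply: (@near_nrm _ _ _ _ (e / K)); first by rewrite divr_gt0.
  move=> v; rewrite ltr_pdivlMr// mulrC => wz.
  have /andP[h1 h2] : q < t * rho v < 1.
    apply: he; first by rewrite subrr normr0 ltW.
    by rewrite (le_trans _ (ltW wz))// (le_trans _ (hK _))// minkowski_dist.
  exact: hN.
have r0 := minkowski_ge0 z hO.
have qz : q < rho z.
  by rewrite (lt_le_trans qs)// ler_piMl// ltW.
have [a ha qa] := separation hO qz.
have [b b0 ab] := kernel_vector a.
have qb l : q < rho (z + l *: b).
  by apply: (lt_le_trans qa); rewrite (le_trans _ (ha _))// lformD lformZ ab mulr0 addr0.
rewrite -(hN z s)//.
have rb : 0 < rho b by rewrite lt_neqAle eq_sym minkowski_eq0// b0 minkowski_ge0.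
have B0 : 0 <= B.
  have [||_] := @hf ((s%:C) *: z); rewrite ?minkowskiZ// ?nrm_pos// ?(ltW s0)//.
  exact: le_trans (nrm_ge0 _).
have -> : z = z + 0 *: b by rewrite scale0r addr0.
apply: (@hol_eq0_of_decay (fun l => N (z + l *: b)) (B * c) (rho z + c) (rho b)) => //.
- by rewrite mulr_ge0// ltW.
- by move=> l; case: (hol_line (Nhol _ (qb l))).
move=> l h; set w := z + l *: b in qb *.
have rw : rho b * nrm l - rho z <= rho w.
  have -> : w = l *: b - (- z) by rewrite opprK addrC.
  rewrite mulrC -(minkowskiZ l b hO) -[rho z](minkowskiN z hO).
  exact: minkowskiB_le.
have cw : c < rho w by lra.
have w0 : 0 < rho w by exact: lt_trans cw.
have s1' : c / rho w < 1 by rewrite ltr_pdivrMr// mul1r.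
have s0' : 0 < c / rho w by rewrite divr_gt0.
have := @jmean_le (c / rho w) w s0' s1'; rewrite divfK ?gt_eqF// => /(_ qc c1).
rewrite -(hN w (c / rho w))// ?divfK ?gt_eqF// => /le_trans; apply.
rewrite -mulrA ler_wpM2l//.
have -> : c / rho w / (1 - c / rho w) = c / (rho w - c).
  by field; rewrite (gt_eqF w0) subr_eq0 gt_eqF.
rewrite ler_pM2l// lef_pV2 ?posrE//; lra.
Qed.

Lemma jmean_outer s z : q < 1 -> 1 < s -> q < rho z -> s * rho z < 1 ->
  jmean s z = f z.
Proof.
move=> q1 s1 qz sz; have s0 : 0 < s by exact: lt_trans s1.
have r0 : 0 < rho z by exact: le_lt_trans qz.
pose t := (q / rho z + 1) / 2.
have h1 : 0 <= q / rho z by rewrite divr_ge0// ltW.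
have h2 : q / rho z < 1 by rewrite ltr_pdivrMr// mul1r.
have t0 : 0 < t by rewrite /t; lra.
have t1 : t < 1 by rewrite /t; lra.
have qt : q < t * rho z by rewrite -ltr_pdivrMr// /t; lra.
have z1 : rho z < 1 by rewrite (le_lt_trans _ sz)// ler_peMl ?(ltW r0)// ltW.
have tz : t * rho z < 1 by rewrite (lt_trans _ z1)// gtr_pMl.
have := @cauchy_annulus R t s (fun l => f (l *: z)) t0 t1 s1.
rewrite scale1r => ->; last first.
  move=> l /andP[l1 l2]; apply: hol_ray; apply: (proj1 (hf _ _)); rewrite minkowskiZ//.
    by rewrite (lt_le_trans qt)// ler_wpM2r// ltW.
  by rewrite (le_lt_trans _ sz)// ler_wpM2r// ltW.
by rewrite -![cmean _ _]/(jmean _ _) (@jmean_inner t z)// subr0.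
Qed.

(** [F z] is the outer mean [jmean s z] for any [s > 1] such that [s%:C *: z] lies in the shell.
    Scaling never moves the origin, which is why it is excluded. *)
Theorem hartogs_shell : q < 1 -> exists F : V -> C,
  (forall z, z != 0 -> rho z < 1 -> hol_at F z) /\
  (forall z, q < rho z -> rho z < 1 -> F z = f z).
Proof.
move=> q1.
have [F hF] : {F : V -> C & forall w (s : R), 1 < s -> q < s * rho w -> s * rho w < 1 ->
    F w = jmean s w}.
  apply: (@choice _ _ (fun (w : V) (y : C) => forall s : R, 1 < s -> q < s * rho w ->
    s * rho w < 1 -> y = jmean s w)) => w.
  have [[s' [a2 a3 a4]]|h] := pselect (exists s : R, [/\ 1 < s, q < s * rho w & s * rho w < 1]).
    exists (jmean s' w) => t t1 qt tq.
    have [st|/ltW ts] := leP s' t.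
      by apply: jmean_const; rewrite ?a2 ?orbT// (lt_trans ltr01).
    by symmetry; apply: jmean_const; rewrite ?t1 ?orbT// (lt_trans ltr01).
  by exists 0 => t t1 qt tq; exfalso; apply: h; exists t.
exists F; split=> z.
  move=> z0 z1; have rz : 0 < rho z.
    by rewrite lt_neqAle eq_sym minkowski_eq0// z0 minkowski_ge0.
  pose m := Num.max q (rho z).
  have mq : q <= m by rewrite le_max lexx.
  have mz : rho z <= m by rewrite le_max lexx orbT.
  have m1 : m < 1 by rewrite gt_max q1.
  pose t := ((m + 1) / 2) / rho z.
  have t1 : 1 < t by rewrite ltr_pdivlMr// mul1r; lra.
  have tz : t * rho z = (m + 1) / 2 by rewrite divfK// gt_eqF.
  have qt : q < t * rho z by rewrite tz; lra.
  have tq : t * rho z < 1 by rewrite tz; lra.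
  apply: (@hol_eq_near _ _ _ _ (jmean t)); last first.
    by apply: jmean_hol => //; [exact: lt_trans t1|rewrite gt_eqF].
  have [e e0 he] := mul_near qt tq.
  have [K K0 hK] := minkowski_le_nrm hO.
  apply: (@near_nrm _ _ _ _ (e / K)); first by rewrite divr_gt0.
  move=> v; rewrite ltr_pdivlMr// mulrC => wz.
  have /andP[h1 h2] : q < t * rho v < 1.
    apply: he; first by rewrite subrr normr0 ltW.
    by rewrite (le_trans _ (ltW wz))// (le_trans _ (hK _))// minkowski_dist.
  exact: hF.
move=> qz z1; have rz : 0 < rho z by exact: le_lt_trans qz.
pose t := ((rho z + 1) / 2) / rho z.
have t1 : 1 < t by rewrite ltr_pdivlMr// mul1r; lra.
have tz : t * rho z = (rho z + 1) / 2 by rewrite divfK// gt_eqF.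
rewrite (hF z t)// ?tz; [|lra|lra].
by apply: jmean_outer; rewrite ?tz//; lra.
Qed.

End Shell.

Section Identity.
Context {R : realType} {n : nat}.
Local Notation C := R[i].
Local Notation V := 'rV[C]_n.
Implicit Types (a x y z w u b : V) (l : C).

Lemma independent_vector w : (2 <= n)%N -> w != 0 ->
  exists b, forall l, b != l *: w.
Proof.
move=> n2 w0.
have [j wj] : exists j, w 0 j != 0.
  apply: contrapT => h; move/negP: w0; apply; apply/eqP/rowP => j; rewrite mxE.
  by apply/eqP/negPn/negP => wj; apply: h; exists j.
have [k kj] : exists k : 'I_n, k != j.
  have n0 : (0 < n)%N by exact: leq_trans n2.
  pose i0 := Ordinal n0; pose i1 := Ordinal n2.
  have [ij|ij] := eqVneq j i0; last by exists i0; rewrite eq_sym.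
  by exists i1; rewrite ij -val_eqE.
exists (delta_mx 0 k) => l; apply/negP => /eqP/rowP h.
have := h j; rewrite !mxE eqxx [j == k]eq_sym (negbTE kj)/= => /esym/eqP.
rewrite mulf_eq0 (negbTE wj) orbF => /eqP l0.
by have /eqP := h k; rewrite !mxE !eqxx l0 mul0r oner_eq0.
Qed.

(** When [b] is not a multiple of [w], the complex line through [b] and [w] misses 0. This allows
    continuation of functions that are not known to be holomorphic at 0. *)
Lemma avoiding_segment a w (e : R) : (2 <= n)%N -> w != 0 -> 0 < e ->
  exists2 b, nrm (b - a) < e & forall l, b + l *: (w - b) != 0.
Proof.
move=> n2 w0 e0.
suff [b be bw] : exists2 b, nrm (b - a) < e & forall l, b != l *: w.
  exists b => // l; apply/negP => /eqP h.
  have [l1|l1] := eqVneq l 1.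
    by move: h w0; rewrite l1 scale1r addrC subrK => ->; rewrite eqxx.
  have /negP := bw (l / (l - 1)); apply; apply/eqP.
  apply: (@scalerI _ _ (l - 1)); first by rewrite subr_eq0.
  rewrite scalerA mulrC divfK ?subr_eq0// scalerBl scale1r.
  move: h; rewrite scalerBr addrCA => /eqP; rewrite addr_eq0 => /eqP ->.
  by rewrite opprB.
have [h|h] := pselect (forall l, a != l *: w).
  by exists a => //; rewrite subrr nrm0.
have [l0 al] : exists l, a = l *: w.
  apply: contrapT => h'; apply: h => l; apply/negP => /eqP al; apply: h'.
  by exists l.
have [b hb] := independent_vector n2 w0.
have b1 : 0 < nrm b + 1 by rewrite ltr_wpDl ?nrm_ge0.
pose t := e / 2 / (nrm b + 1).
have t0 : 0 < t by rewrite !divr_gt0.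
have tC : t%:C != 0 :> C by rewrite fmorph_eq0 gt_eqF.
exists (a + t%:C *: b).
  rewrite addrAC subrr add0r nrmZ nrm_pos ?(ltW t0)//.
  apply: (@le_lt_trans _ _ (t * (nrm b + 1))).
    by rewrite ler_wpM2l ?(ltW t0)//; lra.
  by rewrite /t divfK ?gt_eqF//; lra.
move=> l; apply/negP => /eqP h2; have /negP := hb ((t%:C)^-1 * (l - l0)); apply; apply/eqP.
apply: (@scalerI _ _ t%:C) => //.
rewrite scalerA mulrA divff// mul1r scalerBl -h2 al addrC.
by rewrite addKr.
Qed.

Lemma identity_theorem (U : set V) (g : V -> C) a (r : R) : (2 <= n)%N ->
  open U -> connected U -> (forall z, U z -> z != 0 -> hol_at g z) ->
  U a -> 0 < r -> (forall z, nrm (z - a) < r -> z != 0 -> g z = 0) ->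
  forall z, U z -> z != 0 -> g z = 0.
Proof.
move=> n2 oU cU hg Ua r0 ga.
pose Z z := exists2 e : R, 0 < e & forall w, nrm (w - z) < e -> w != 0 -> g w = 0.
suff BU : [set z | U z /\ Z z] = U.
  move=> z Uz z0; have [_ [e e0 ->//]] : [set z | U z /\ Z z] z by rewrite BU.
  by rewrite subrr nrm0.
apply: cU; first by exists a; split => //; exists r.
  exists [set z | Z z]; last by [].
  apply/open_nrm => z [e e0 he]; exists e => // w we.
  exists (e - nrm (w - z)); first by rewrite subr_gt0.
  by move=> v vw; apply: he; rewrite (le_lt_trans (nrmBD w v z))//; lra.
exists (closure [set z | U z /\ Z z]); first exact: closed_closure.
apply/seteqP; split=> z; first by move=> [Uz Zz]; split => //; exact: subset_closure.
move=> [Uz cz]; split => //.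
have /open_nrm/(_ _ Uz)[e e0 he] := oU.
have e8 : 0 < e / 8 by rewrite divr_gt0.
have [p [[Up [d d0 hd]] pz]] : [set z | U z /\ Z z] `&` [set w | nrm (w - z) < e / 8] !=set0.
  by apply: cz; apply/nbhs_nrm; exists (e / 8).
exists (e / 8) => // w wz w0.
pose m := Num.min (d / 2) (e / 8).
have m0 : 0 < m by rewrite lt_min !divr_gt0.
have md : m <= d / 2 by rewrite ge_min lexx.
have me : m <= e / 8 by rewrite ge_min lexx orbT.
have [b bp bl] := avoiding_segment p n2 w0 m0.
have bz : nrm (b - z) < e / 4.
  by rewrite (le_lt_trans (nrmBD p b z))//; move: pz => /=; lra.
have wb : nrm (w - b) < 3 / 8 * e.
  by rewrite (le_lt_trans (nrmBD z w b))// (nrmBC z); lra.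
(* The parameters 0 and 1 give [b] and [w]; the radius [3 / 2] makes 1 an interior point, and
   [e / 4 + 3 / 2 * (3 / 8 * e) < e] keeps the disc near [z]. *)
have inU l : nrm l <= 3 / 2 -> U (b + l *: (w - b)).
  move=> l2; apply: he; rewrite addrAC (le_lt_trans (nrmD _ _))// nrmZ.
  have : nrm l * nrm (w - b) <= 3 / 2 * (3 / 8 * e).
    by apply: ler_pM; rewrite ?nrm_ge0// ltW.
  lra.
have wb1 : 0 < nrm (w - b) + 1 by rewrite ltr_wpDl ?nrm_ge0.
pose s := d / 2 / (nrm (w - b) + 1).
have s0 : 0 < s by rewrite !divr_gt0.
have := @identity_disc R (3 / 2) (fun l => g (b + l *: (w - b))) s s0.
have E : b + 1 *: (w - b) = w by rewrite scale1r addrC subrK.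
move=> /(_ _ _ 1); rewrite E nrm1; apply; last by lra.
- by move=> l l2; case: (hol_line (hg _ (inU l l2) (bl l))).
move=> l ls; apply: hd => //; rewrite addrAC (le_lt_trans (nrmD _ _))// nrmZ.
have : nrm l * nrm (w - b) <= d / 2.
  apply: (@le_trans _ _ (s * (nrm (w - b) + 1))).
    by apply: ler_pM; rewrite ?nrm_ge0 ?(ltW ls)//; lra.
  by rewrite /s divfK ?gt_eqF.
lra.
Qed.

End Identity.

Section Extension.
Context {R : realType} {n : nat}.
Local Notation C := R[i].
Local Notation V := 'rV[C]_n.
Local Notation minkowski := Defs.minkowski.
Implicit Types (x y z w u : V) (Omega L : set V) (l : C).

(** A value above [K] would be detected by a linear form bounded by the Minkowski function, against
    the scalar maximum principle. *)
Lemma max_principle_minkowski Omega (s : R) (h : C -> V) (K : R) l :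
  convex_balanced Omega -> 0 < s -> (forall l, nrm l <= s -> hol_at h l) ->
  (forall l, nrm l = s -> minkowski Omega (h l) <= K) -> nrm l <= s ->
  minkowski Omega (h l) <= K.
Proof.
move=> hO s0 hh hK ls; rewrite leNgt; apply/negP => /(separation hO)[a ha Ka].
suff : nrm (lform a (h l)) <= K by rewrite leNgt Ka.
apply: (@max_principle R s (fun l => lform a (h l))) => // w ws.
  by apply: hol_lform; exact: hh.
exact: le_trans (ha _) (hK w ws).
Qed.

Lemma circle_minkowski_lt1 Omega (s : R) (h : C -> V) : convex_balanced Omega ->
  0 <= s -> (forall l, nrm l = s -> cont_at h l /\ Omega (h l)) ->
  exists2 K : R, K < 1 & forall l, nrm l = s -> minkowski Omega (h l) <= K.
Proof.
move=> hO s0 hh.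
have := @compact_EVT_max _ _ (fun l => minkowski Omega (h l)) _ (circle_nonempty s0)
  (@compact_circle _ s).
case.
  apply: continuous_in_subspaceT => l; rewrite inE => /hh[[ch] _].
  apply: (@continuous_comp _ _ _ h (minkowski Omega)) => //.
  exact: minkowski_continuous.
move=> p; rewrite inE => ps pm; exists (minkowski Omega (h p)).
  by apply/minkowski_domain => //; case: (hh p ps).
by move=> l ls; apply: pm; rewrite inE.
Qed.

Lemma punctured_domain_open Omega L : convex_balanced Omega -> closed L ->
  open (Omega `\` L).
Proof.
move=> [[oO _ _] _ _ _] cL; rewrite setDE; apply: openI => //.
exact: closed_openC.
Qed.

Lemma minkowski_levels Omega (q : R) : convex_balanced Omega -> (0 < n)%N ->
  0 <= q -> exists z, minkowski Omega z = q.
Proof.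
move=> hO n0 q0; pose e : V := delta_mx 0 (Ordinal n0).
have e0 : e != 0.
  apply/negP => /eqP/rowP/(_ (Ordinal n0))/eqP.
  by rewrite !mxE !eqxx oner_eq0.
have m0 : 0 < minkowski Omega e.
  by rewrite lt_neqAle eq_sym minkowski_eq0// e0 minkowski_ge0.
exists ((q / minkowski Omega e)%:C *: e).
by rewrite minkowskiZ// nrm_pos ?divr_ge0 ?(ltW m0)// divfK ?gt_eqF.
Qed.

Lemma hartogs_extension Omega L (f : V -> C) (B q : R) : convex_balanced Omega ->
  (2 <= n)%N -> closed L -> ~ L 0 -> 0 <= q -> q < 1 ->
  (forall z, L z -> minkowski Omega z <= q) -> connected (Omega `\` L) ->
  (forall z, (Omega `\` L) z -> hol_at f z /\ nrm (f z) <= B) ->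
  exists2 F : V -> C, (forall z, Omega z -> hol_at F z) &
    forall z, (Omega `\` L) z -> F z = f z.
Proof.
move=> hO n2 cL L0 q0 q1 Lq cD hf.
have inD z : q < minkowski Omega z -> minkowski Omega z < 1 -> (Omega `\` L) z.
  move=> qz z1; split; first exact/minkowski_domain.
  by move=> /Lq; rewrite leNgt qz.
have oD := punctured_domain_open hO cL.
have hshell z : q < minkowski Omega z -> minkowski Omega z < 1 ->
    hol_at f z /\ nrm (f z) <= B by move=> qz z1; exact: hf (inD z qz z1).
have [F [hF Ff]] := hartogs_shell hO q0 hshell n2 q1.
have FfD z : (Omega `\` L) z -> z != 0 -> F z = f z.
  move=> Dz z0; apply/eqP; rewrite -subr_eq0; apply/eqP.
  have n0 : (0 < n)%N by exact: leq_trans n2.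
  have q2 : 0 <= (q + 1) / 2 by lra.
  have [a aE] := minkowski_levels hO n0 q2.
  have [qa a1] : q < minkowski Omega a /\ minkowski Omega a < 1 by rewrite aE; split; lra.
  have oS : open [set z | q < minkowski Omega z < 1].
    rewrite (_ : mkset _ = minkowski Omega @^-1` [set t | q < t < 1])//.
    apply: open_comp => [w _|]; first exact: minkowski_continuous.
    rewrite (_ : [set t | q < t < 1] = [set` `]q, 1[%R]); first exact: interval_open.
    by apply/seteqP; split=> t /=; rewrite in_itv.
  have /open_nrm/(_ a)[|e e0 he] := oS; first by rewrite /= qa.
  apply: (@identity_theorem R n (Omega `\` L) (fun z => F z - f z) a e n2 oD cD
    _ (inD a qa a1) e0 _ z Dz z0).
  - move=> w Dw w0; apply: holB; last by case: (hf w Dw).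
    by apply: hF => //; apply/minkowski_domain => //; case: Dw.
  - by move=> w /he/andP[h1 h2] _; rewrite Ff// subrr.
(* [F] is holomorphic only away from 0, and 0 is not in [L]: keeping [f] off [L] repairs the
   origin. *)
exists (fun z => if `[< L z >] then F z else f z) => z; last first.
  by move=> [Oz Lz]; rewrite asboolF.
move=> Oz; have [Lz|Lz] := pselect (L z).
  have z0 : z != 0 by apply/negP => /eqP z0; apply: L0; rewrite -z0.
  apply: (@hol_eq_near _ _ _ _ F); last by apply: hF => //; exact/minkowski_domain.
  have [[oO _ _] _ _ _] := hO.
  have /open_nrm/(_ _ Oz)[e e0 he] := oO.
  have nz : 0 < nrm z by rewrite nrm_gt0.
  have m0 : 0 < Num.min e (nrm z) by rewrite lt_min e0.
  apply: (near_nrm m0) => w; rewrite lt_min => /andP[we wz].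
  case: asboolP => // Lw; rewrite FfD//; first by split => //; exact: he.
  by apply/negP => /eqP w0; move: wz; rewrite w0 sub0r nrmN ltxx.
have Dz : (Omega `\` L) z by [].
apply: (@hol_eq_near _ _ _ _ f); last by case: (hf z Dz).
have /open_nrm/(_ _ Dz)[e e0 he] := oD.
by apply: (near_nrm e0) => w /he[_ Lw]; rewrite asboolF.
Qed.

(* Across the hole, values stay in [Omega] by the maximum principle on the
   complex lines through the origin. *)
Theorem hartogs_extension_map Omega L (f : V -> V) (q : R) : convex_balanced Omega ->
  (2 <= n)%N -> closed L -> ~ L 0 -> 0 <= q -> q < 1 ->
  (forall z, L z -> minkowski Omega z <= q) -> connected (Omega `\` L) ->
  holo (Omega `\` L) Omega f ->
  exists2 F : V -> V, (forall z, Omega z -> hol_at F z /\ Omega (F z)) &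
    forall z, (Omega `\` L) z -> F z = f z.
Proof.
move=> hO n2 cL L0 q0 q1 Lq cD hf.
have [M M0 hM] := convex_balanced_bound hO.
have [F hF] : {F : 'I_n -> V -> C & forall j, (forall z, Omega z -> hol_at (F j) z) /\
    forall z, (Omega `\` L) z -> F j z = f z 0 j}.
  apply: (@choice _ _ (fun j (F : V -> C) => (forall z, Omega z -> hol_at F z) /\
    forall z, (Omega `\` L) z -> F z = f z 0 j)) => j.
  have [|F h1 h2] := @hartogs_extension Omega L (fun z => f z 0 j) M q hO n2 cL L0 q0 q1 Lq cD.
    move=> z /hf[Of df]; split; first by apply: hol_coord; split.
    exact: le_trans (nrm_coord _ _) (hM _ Of).
  by exists F.
exists (fun z => \row_j F j z) => z; last first.
  by move=> Dz; apply/rowP => j; rewrite mxE; exact: (hF j).2.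
have hFz w : Omega w -> hol_at (fun z => \row_j F j z) w.
  move=> Ow; apply: hol_rV => j; under eq_fun do rewrite mxE.
  exact: (hF j).1.
have Ff w : (Omega `\` L) w -> (\row_j F j w) = f w.
  by move=> Dw; apply/rowP => j; rewrite mxE; exact: (hF j).2.
move=> Oz; split; first exact: hFz.
have [Lz|Lz] := pselect (L z); last by rewrite Ff//; case: (hf z).
have z0 : z != 0 by apply/negP => /eqP z0; apply: L0; rewrite -z0.
have rz : 0 < minkowski Omega z.
  by rewrite lt_neqAle eq_sym minkowski_eq0// z0 minkowski_ge0.
(* On the line through [z], the circle of radius [s] lies at the level [(q + 1) / 2], above the hole
   and inside [Omega], and it encloses [z] because [s >= 1]. *)
pose s := (q + 1) / 2 / minkowski Omega z.
have sz : s * minkowski Omega z = (q + 1) / 2 by rewrite divfK// gt_eqF.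
have s1 : 1 <= s by rewrite ler_pdivlMr// mul1r; have := Lq z Lz; lra.
have s0 : 0 < s by exact: lt_le_trans s1.
have inO l : nrm l <= s -> Omega (l *: z).
  move=> ls; apply/minkowski_domain => //; rewrite minkowskiZ//.
  have : nrm l * minkowski Omega z <= s * minkowski Omega z by rewrite ler_pM2r.
  by rewrite sz; lra.
have hl l : nrm l <= s -> hol_at (fun l => \row_j F j (l *: z)) l.
  by move=> /inO Ol; exact: hol_ray (hFz _ Ol).
have [l ls|K K1 hK] := @circle_minkowski_lt1 Omega s (fun l => \row_j F j (l *: z)) hO (ltW s0).
  have ls' : nrm l <= s by rewrite ls.
  split; first exact: hol_cont (hl l ls').
  have Dl : (Omega `\` L) (l *: z).
    split; first exact: inO.
    by move=> /Lq; rewrite minkowskiZ// ls sz; lra.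
  by rewrite Ff//; case: (hf _ Dl).
apply/minkowski_domain => //; apply: le_lt_trans K1.
have := @max_principle_minkowski Omega s _ K 1 hO s0 hl hK.
by rewrite nrm1 scale1r; apply.
Qed.

End Extension.

(** * The Schwarz lemma and the Caratheodory distance *)

Section HyperbolicTangent.
Context {R : realType}.
Implicit Types x r s : R.
Local Notation tanh := Defs.tanh.
Local Notation atanh := Defs.atanh.

Lemma tanhE r : tanh r = 1 - 2 / (expR (2 * r) + 1).
Proof.
have E : expR (2 * r) = expR r ^+ 2 by rewrite mulr2n mulrDl mul1r expRD expr2.
have e0 : 0 < expR r := expR_gt0 r.
have d0 : 0 < expR r ^+ 2 + 1 by rewrite addr_gt0 ?exprn_gt0.
rewrite /Defs.tanh expRN E; field.
by rewrite (gt_eqF d0) (gt_eqF e0).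
Qed.

Lemma tanh_lt r s : r < s -> tanh r < tanh s.
Proof.
move=> rs; rewrite !tanhE ltrD2l ltrN2 ltr_pM2l// ltf_pV2 ?posrE ?addr_gt0 ?expR_gt0//.
by rewrite ltrD2r ltr_expR ltr_pM2l.
Qed.

Lemma tanhK x : -1 < x -> x < 1 -> tanh (atanh x) = x.
Proof.
move=> x1 x2; rewrite tanhE /Defs.atanh.
have -> (y : R) : 2 * (y / 2) = y by lra.
rewrite lnK; last first.
  by rewrite posrE divr_gt0; lra.
have d : 1 - x != 0 by rewrite gt_eqF ?subr_gt0.
have -> : (1 + x) / (1 - x) + 1 = 2 / (1 - x) by field.
by rewrite invf_div mulrCA divff// mulr1; ring.
Qed.

Lemma tanh_inj : injective (@Defs.tanh R).
Proof.
move=> r s rs; apply/eqP; rewrite eq_le !leNgt; apply/andP; split; apply/negP => /tanh_lt.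
  by rewrite rs ltxx.
by rewrite rs ltxx.
Qed.

Lemma atanh_lt x r : -1 < x -> x < 1 -> (atanh x < r) = (x < tanh r).
Proof.
move=> x1 x2; apply/idP/idP => [/tanh_lt|h]; first by rewrite tanhK.
rewrite ltNge; apply/negP; rewrite le_eqVlt => /orP[/eqP rx|/tanh_lt].
  by move: h; rewrite rx tanhK// ltxx.
by rewrite tanhK//; move: h; lra.
Qed.

Lemma atanh_le x r : -1 < x -> x < 1 -> (atanh x <= r) = (x <= tanh r).
Proof.
move=> x1 x2; apply/idP/idP.
  rewrite le_eqVlt => /orP[/eqP <-|]; first by rewrite tanhK.
  by rewrite atanh_lt// => /ltW.
move=> h; move: h; rewrite le_eqVlt => /orP[/eqP xr|]; last by rewrite -atanh_lt// => /ltW.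
by rewrite (_ : atanh x = r)//; apply: tanh_inj; rewrite tanhK.
Qed.

End HyperbolicTangent.

Section Schwarz.
Context {R : realType} {n : nat}.
Local Notation C := R[i].
Local Notation V := 'rV[C]_n.
Local Notation minkowski := Defs.minkowski.
Implicit Types (x y z w u : V) (Omega L : set V) (l : C).

Lemma schwarz_scalar (s : R) (g : C -> C) : 1 < s ->
  (forall l, nrm l <= s -> hol_at g l) -> (forall l, nrm l = s -> nrm (g l) <= 1) ->
  g 0 = 0 -> nrm (g 1) <= s^-1.
Proof.
move=> s1 hg g1 g0; have s0 : 0 < s by exact: lt_trans s1.
have := @max_principle1 R s (fun l => g l / l) s^-1 s1.
rewrite divr1; apply.
- move=> l l0 ls; apply: hol_div; [exact: hg|exact: hol_id|by rewrite -nrm_gt0].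
- have z0 : nrm (0 : C) <= s by rewrite nrm0 ltW.
  have [K K0 hK] := der_bounded (hg 0 z0).
  have [d d0 hd] := hol_eps (hg 0 z0) ltr01.
  exists (K + 1), d; split => // [|l l0 ld]; first by rewrite addr_gt0.
  rewrite nrmM nrmV ler_pdivrMr//.
  have := hd l ld; rewrite add0r g0 subr0 mul1r => h1.
  have := hK l; have := nrm_lerB (g l) (g l - der g 0 l).
  by rewrite subKr mulrDl mul1r => a b; have := nrm_lerB (g l) (der g 0 l); lra.
by move=> l ls; rewrite nrmM nrmV ls ler_piMl ?invr_ge0 ?(ltW s0)// g1.
Qed.

(** A larger value would be seen by a linear form [a] bounded by the Minkowski function; the scalar
    Schwarz lemma along [l *: u] on the disc of radius [t^-1], with [t] above the Minkowski value of
    [u], excludes this. *)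
Lemma schwarz Omega (F : V -> V) u : convex_balanced Omega ->
  (forall z, Omega z -> hol_at F z /\ Omega (F z)) -> F 0 = 0 -> Omega u ->
  minkowski Omega (F u) <= minkowski Omega u.
Proof.
move=> hO hF F0 Ou; rewrite leNgt; apply/negP => /(separation hO)[a ha ua].
have u0 := minkowski_ge0 u hO.
have u1 : minkowski Omega u < 1 by apply/minkowski_domain.
(* The minimum with 1 keeps [t < 1], since [schwarz_scalar] needs a radius above 1. *)
pose q := Num.min 1 (nrm (lform a (F u))).
have uq : minkowski Omega u < q by rewrite lt_min u1.
have q0 : 0 < q by exact: le_lt_trans uq.
pose t := (minkowski Omega u + q) / 2.
have t0 : 0 < t by rewrite /t; lra.
have q1 : q <= 1 by rewrite ge_min lexx.
have qF : q <= nrm (lform a (F u)) by rewrite ge_min lexx orbT.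
have tu : minkowski Omega u < t by rewrite /t; lra.
have tq : t < q by rewrite /t; lra.
have inO l : nrm l <= t^-1 -> Omega (l *: u).
  move=> ls; apply/minkowski_domain => //; rewrite minkowskiZ//.
  apply: (@le_lt_trans _ _ (t^-1 * minkowski Omega u)); first by rewrite ler_wpM2r.
  by rewrite mulrC ltr_pdivrMr// mul1r.
have := @schwarz_scalar t^-1 (fun l => lform a (F (l *: u))).
rewrite scale1r scale0r F0 lform0 invrK => /(_ _ _ _ erefl) H.
suff : nrm (lform a (F u)) <= t by lra.
apply: H.
- by rewrite -[1]invr1 ltf_pV2 ?posrE// (lt_le_trans tq).
- move=> l /inO Ol; apply: (@hol_lform _ _ _ (fun l => F (l *: u))).
  by apply: hol_ray; case: (hF _ Ol).
move=> l ls; have Ol : Omega (l *: u) by apply: inO; rewrite ls.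
apply: (le_trans (ha _)); apply: ltW; apply/minkowski_domain => //.
by case: (hF _ Ol).
Qed.

End Schwarz.

(** * Moving the base point to the origin; the Caratheodory distance of the domain with a hole *)

Section Transport.
Context {R : realType} {n : nat}.
Local Notation C := R[i].
Local Notation V := 'rV[C]_n.
Local Notation minkowski := Defs.minkowski.
Implicit Types (x y w u : V) (l : C).

Lemma unit_diskE l : unit_disk l <-> nrm l < 1.
Proof. by rewrite /unit_disk/= nrmE (_ : 1 = 1%:C)// ltcR. Qed.

Lemma holo_hol (U W : normedModType C) (A : set U) (B : set W) f p :
  holo A B f -> A p -> hol_at f p /\ B (f p).
Proof. by move=> hf /hf[Bp df]; split. Qed.

Context (Omega L : set V) (hO : convex_balanced Omega) (n2 : (2 <= n)%N)
  (cL : compact L) (LO : L `<=` Omega) (cD : connected (Omega `\` L)).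
Local Notation D := (Omega `\` L).

Lemma closed_hole : closed L.
Proof. by apply: compact_closed => //; exact: norm_hausdorff. Qed.

Lemma D_open : open D.
Proof. exact: punctured_domain_open closed_hole. Qed.

Context (z0 : V) (Dz0 : D z0) (phi psi : V -> V) (hphi : holo Omega Omega phi)
  (hpsi : holo Omega Omega psi) (phiK : forall z, Omega z -> psi (phi z) = z)
  (psiK : forall z, Omega z -> phi (psi z) = z) (phiz0 : phi z0 = 0).

Lemma image_phi_hole : phi @` D = Omega `\` (phi @` L).
Proof.
apply/seteqP; split=> [_ [w [Ow Lw] <-]|w [Ow Lw]].
  split; first by case: (hphi Ow).
  by move=> [v Lv vw]; apply: Lw; rewrite -(phiK Ow) -vw phiK//; exact: LO.
have Op : Omega (psi w) by case: (hpsi Ow).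
exists (psi w); last by rewrite psiK.
by split => // Lp; apply: Lw; exists (psi w) => //; rewrite psiK.
Qed.

Lemma image_hole_compact : compact (phi @` L).
Proof.
apply: continuous_compact => //; apply: continuous_in_subspaceT => w.
by rewrite inE => /LO/hphi[_ /differentiable_continuous].
Qed.

Lemma hole_level : exists q : R, [/\ 0 <= q, q < 1 &
  forall w, (phi @` L) w -> minkowski Omega w <= q].
Proof.
have [L0|L0] := pselect (phi @` L !=set0); last first.
  by exists 0; split => // w Lw; exfalso; apply: L0; exists w.
have := @compact_EVT_max _ _ (minkowski Omega) _ L0 image_hole_compact.
case; first by apply: continuous_in_subspaceT => w _; exact: minkowski_continuous.
move=> p; rewrite inE => -[v Lv vp] pm; exists (minkowski Omega p); split.
- exact: minkowski_ge0.
- apply/minkowski_domain => //; rewrite -vp.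
  by case: (hphi (LO Lv)).
by move=> w Lw; apply: pm; rewrite inE.
Qed.

Lemma extension (f : V -> V) : holo D Omega f ->
  exists2 F : V -> V, (forall w, Omega w -> hol_at F w /\ Omega (F w)) &
    forall w, D w -> F w = f w.
Proof.
move=> hf; have [q [q0 q1 hq]] := hole_level.
have L0 : ~ (phi @` L) 0.
  have [Oz Lz] := Dz0.
  by move=> [w Lw w0]; apply: Lz; rewrite -(phiK Oz) phiz0 -w0 phiK//; exact: LO.
have clL : closed (phi @` L).
  by apply: compact_closed image_hole_compact; exact: norm_hausdorff.
have cD' : connected (Omega `\` (phi @` L)).
  rewrite -image_phi_hole; apply: connected_continuous_connected => //.
  apply: continuous_in_subspaceT => w; rewrite inE => -[Ow _].
  by have [_ /differentiable_continuous] := hphi Ow.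
have psiD w : (Omega `\` (phi @` L)) w -> D (psi w).
  by rewrite -image_phi_hole => -[v Dv <-]; rewrite phiK//; case: Dv.
have hfpsi : holo (Omega `\` (phi @` L)) Omega (fun w => f (psi w)).
  move=> w Dw; have [Off dff] := holo_hol hf (psiD w Dw).
  have [Ow _] := Dw; have [hw _] := holo_hol hpsi Ow.
  by split => //; apply/hol_atP; exact: hol_comp hw Off.
have [F hF Ff] := hartogs_extension_map hO n2 clL L0 q0 q1 hq cD' hfpsi.
exists (fun w => F (phi w)) => w.
  move=> Ow; have [hw Opw] := holo_hol hphi Ow; have [hFw OFw] := hF _ Opw.
  by split => //; exact: hol_comp hw hFw.
move=> Dw; have [Ow _] := Dw; rewrite Ff ?phiK//.
by rewrite -image_phi_hole; exists w.
Qed.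

Lemma schwarz_extension F w : (forall w, Omega w -> hol_at F w /\ Omega (F w)) ->
  F z0 = 0 -> Omega w -> minkowski Omega (F w) <= minkowski Omega (phi w).
Proof.
move=> hF F0 Ow; have [_ Opw] := holo_hol hphi Ow; have [Oz _] := Dz0.
have := @schwarz _ _ Omega (fun u => F (psi u)) (phi w) hO.
have p0 : psi 0 = z0 by rewrite -phiz0 phiK.
rewrite phiK// p0; apply => // u Ou.
have [hu Opu] := holo_hol hpsi Ou; have [hFu OFu] := hF _ Opu.
by split => //; exact: hol_comp hu hFu.
Qed.

(** Upper bound: a function to the disc, multiplied by a vector [e] of Minkowski value 1, becomes a
    map to [Omega], which extends and obeys the Schwarz lemma. Lower bound: the linear forms of
    [separation], composed with [phi], are competitors that come arbitrarily close. *)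
Lemma caratheodory_hole w : D w ->
  caratheodory D z0 w = (Defs.atanh (minkowski Omega (phi w)))%:E.
Proof.
move=> Dw; have [Ow _] := Dw; have [Oz _] := Dz0.
have [hw Opw] := holo_hol hphi Ow.
have r0 := minkowski_ge0 (phi w) hO.
have r1 : minkowski Omega (phi w) < 1 by apply/minkowski_domain.
have rN : -1 < minkowski Omega (phi w) by lra.
have [e eE] := minkowski_levels hO (leq_trans (ltn0Sn 1) n2) (@ler01 R).
apply/eqP; rewrite eq_le; apply/andP; split.
  apply: ge_ereal_sup => _ [f hf [fz ->]]; rewrite lee_fin.
  have hfe : holo D Omega (fun v => f v *: e).
    move=> v Dv; have [fv dv] := holo_hol hf Dv; split.
      apply/minkowski_domain => //; rewrite minkowskiZ// eE mulr1.
      exact/unit_diskE.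
    by apply/hol_atP; apply: (@hol_comp _ _ _ _ f (fun l => l *: e)) fv _;
       apply: (@hol_ray _ _ _ id); split.
  have [F hF Ff] := extension hfe.
  have Fz : F z0 = 0 by rewrite Ff// fz scale0r.
  have := schwarz_extension hF Fz Ow; rewrite Ff// minkowskiZ// eE mulr1 => h.
  have h1 : nrm (f w) < 1 by exact: le_lt_trans r1.
  rewrite -/(nrm (f w)) atanh_le//; first by rewrite tanhK.
  by have := nrm_ge0 (f w); lra.
rewrite leNgt; apply/negP => h.
(* Competing with the zero function rules out the value minus infinity in the case analysis
   below. *)
have z0f : holo D (@unit_disk R) (fun=> 0).
  by move=> v _; split; [rewrite /unit_disk/= normr0 ltr01|exact: differentiable_cst].
have z0le : (0%:E <= caratheodory D z0 w)%E.
  apply: ereal_sup_ubound; exists (fun=> 0) => //; split => //.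
  by rewrite normr0/= /Defs.atanh addr0 subr0 divr1 ln1 mul0r.
move: h z0le; case E : (caratheodory D z0 w) => [c| |] //; rewrite lte_fin => h _.
have h' : Defs.tanh c < minkowski Omega (phi w).
  by rewrite ltNge -atanh_le//; rewrite -ltNge.
have [a ha ca] := separation hO h'.
have hf : holo D (@unit_disk R) (fun v => lform a (phi v)).
  move=> v [Ov _]; have [hv Opv] := holo_hol hphi Ov; split.
    apply/unit_diskE; apply: (le_lt_trans (ha _)).
    exact/minkowski_domain.
  by apply/hol_atP; exact: hol_lform.
have : ((Defs.atanh (nrm (lform a (phi w))))%:E <= caratheodory D z0 w)%E.
  apply: ereal_sup_ubound; exists (fun v => lform a (phi v)) => //.
  by rewrite phiz0 lform0.
have l1 : nrm (lform a (phi w)) < 1 by exact: le_lt_trans r1.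
rewrite E lee_fin atanh_le//; first by rewrite leNgt ca.
by have := nrm_ge0 (lform a (phi w)); lra.
Qed.

End Transport.

(** * Second-order Taylor expansion of real functions *)

Section Taylor.
Context {R : realType} {n : nat}.
Local Notation C := R[i].
Local Notation V := 'rV[C]_n.
Implicit Types (z w v h a Q : V) (f : V -> R) (t s : R) (U : set V).

Lemma mvt_le (phi dphi : R -> R) (K : R) :
  (forall t, 0 <= t <= 1 -> is_derive t 1 phi (dphi t)) ->
  (forall t, 0 <= t <= 1 -> `|dphi t| <= K) -> `|phi 1 - phi 0| <= K.
Proof.
move=> D hK.
have cphi : {within `[0, 1], continuous phi}.
  apply: derivable_within_continuous => t; rewrite in_itv/= => tI.
  by have [] := D t tI.
have [|t tI E] := @MVT R phi dphi 0 1 ltr01 _ cphi.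
  by move=> t; rewrite in_itv/= => /andP[t0 t1]; apply: D; rewrite !ltW.
rewrite E subr0 mulr1; move: tI; rewrite in_itv/= => /andP[t0 t1].
by apply: hK; rewrite !ltW.
Qed.

Lemma derivable_eps (g : R -> R) : derivable g 0 1 -> forall e : R, 0 < e ->
  exists2 d : R, 0 < d & forall k, `|k| < d -> `|g k - g 0 - derive1 g 0 * k| <= e * `|k|.
Proof.
move=> dg e e0; rewrite derive1E.
have /cvgrPdist_le/(_ _ e0)/nbhs_ballP[d /= d0 hd] := dg : _ --> 'D_1 g 0.
exists d => // k kd; have [->|k0] := eqVneq k 0.
  by rewrite subrr mulr0 subr0 normr0 mulr0.
have := hd k; rewrite /ball/= sub0r normrN => /(_ kd k0).
rewrite /GRing.scale/= mulr1 addr0 => h.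
have -> : g k - g 0 - 'D_1 g 0 * k = - ('D_1 g 0 - k^-1 * (g k - g 0)) * k by field.
by rewrite normrM normrN ler_wpM2r.
Qed.

Lemma partial_eps v f z : derivable (fun t : R => f (z + t%:C *: v)) 0 1 ->
  forall e : R, 0 < e -> exists2 d : R, 0 < d & forall k : R, `|k| < d ->
    `|f (z + k%:C *: v) - f z - real_partial v f z * k| <= e * `|k|.
Proof.
move=> /derivable_eps h e /h[d d0 hd]; exists d => // k /hd.
by rewrite scale0r addr0.
Qed.

Lemma axis_step v f a t (c e : R) :
  (forall s, 0 <= s <= 1 ->
    derivable (fun k : R => f (a + (s * t)%:C *: v + k%:C *: v)) 0 1 /\
    `|real_partial v f (a + (s * t)%:C *: v) - c| <= e) ->
  `|f (a + t%:C *: v) - f a - t * c| <= e * `|t|.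
Proof.
move=> H.
pose phi s := f (a + (s * t)%:C *: v) - s * t * c.
have := @mvt_le phi (fun s => t * (real_partial v f (a + (s * t)%:C *: v) - c)) (e * `|t|).
rewrite /phi mul1r mul0r scale0r addr0 mul0r subr0 addrAC; apply.
  move=> s /H[ds _]; apply: eps_is_derive => e' e'0.
  have t1 : 0 < `|t| + 1 by rewrite ltr_wpDl.
  have [d d0 hd] := partial_eps ds (divr_gt0 e'0 t1).
  exists (d / (`|t| + 1)); first exact: divr_gt0.
  move=> k kd; have ktd : `|k * t| < d.
    rewrite normrM (@le_lt_trans _ _ (`|k| * (`|t| + 1)))//.
      by rewrite ler_wpM2l// lerDl.
    by rewrite -ltr_pdivlMr.
  have E : a + (s * t)%:C *: v + (k * t)%:C *: v = a + ((s + k) * t)%:C *: v.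
    by rewrite -addrA -scalerDl -rmorphD/= -mulrDl.
  have := hd _ ktd; rewrite E.
  set p := real_partial _ _ _; set A := f _; set B := f _ => h.
  have -> : A - (s + k) * t * c - (B - s * t * c) - t * (p - c) * k = A - B - p * (k * t).
    by ring.
  apply: (le_trans h); rewrite normrM mulrAC ler_pdivrMr// -!mulrA ler_wpM2l ?(ltW e'0)//.
  by rewrite ler_wpM2l// lerDl.
by move=> s /H[_ h]; rewrite normrM mulrC ler_wpM2r.
Qed.

Definition bvec (i : 'I_n * bool) : V :=
  if i.2 then 'i%C *: delta_mx 0 i.1 else delta_mx 0 i.1.

Definition rcoord h (i : 'I_n * bool) : R :=
  if i.2 then complex.Im (h 0 i.1) else complex.Re (h 0 i.1).

Lemma bvec_basis i : real_basis (bvec i).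
Proof. by exists i.1; case: i => j [] /=; [right|left]. Qed.

Lemma nrm_bvec i : nrm (bvec i) <= 1.
Proof.
have d1 : nrm (delta_mx 0 i.1 : V) <= 1.
  by apply: nrm_rV_le => // c; rewrite mxE eqxx/=; case: (c == _); rewrite ?nrm1 ?nrm0.
by rewrite /bvec; case: (i.2) => //; rewrite nrmZ nrm_i mul1r.
Qed.

Lemma rcoord_le h i : `|rcoord h i| <= nrm h.
Proof.
by rewrite /rcoord; case: (i.2); rewrite (le_trans _ (nrm_coord h i.1))// ?nrm_Im ?nrm_Re.
Qed.

Lemma rcoord_sum h (F : 'I_n * bool -> R) :
  \sum_i rcoord h i * F i = \sum_j (complex.Re (h 0 j) * F (j, false) +
    complex.Im (h 0 j) * F (j, true)).
Proof.
rewrite (eq_bigr (fun p => rcoord h (p.1, p.2) * F (p.1, p.2))); last by case.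
rewrite -(pair_bigA _ (fun j b => rcoord h (j, b) * F (j, b)))/=.
apply: eq_bigr => j _; rewrite (bigD1 true)//= (bigD1 false)//= big1 ?addr0.
  by rewrite addrC.
by case.
Qed.

Lemma rcoord_expand h : h = \sum_i (rcoord h i)%:C *: bvec i.
Proof.
rewrite (eq_bigr (fun p => (rcoord h (p.1, p.2))%:C *: bvec (p.1, p.2))); last by case.
rewrite -(pair_bigA _ (fun j b => (rcoord h (j, b))%:C *: bvec (j, b)))/=.
rewrite {1}[h]row_sum_delta; apply: eq_bigr => j _.
rewrite (bigD1 true)//= (bigD1 false)//= big1 ?addr0; last by case.
rewrite /bvec/rcoord/= scalerA -scalerDl; congr (_ *: _).
by case: (h 0 j) => x y; simpc.
Qed.

(** Only derivatives along the real basis are given, so the increment is taken along a polygon with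
    one edge per basis vector; [axis_step] handles each edge. *)
Lemma path_step f Q h (r e : R) (c : 'I_n * bool -> R) (s : seq ('I_n * bool)) a :
  (forall w i, nrm (w - Q) < r -> derivable (fun t : R => f (w + t%:C *: bvec i)) 0 1 /\
     `|real_partial (bvec i) f w - c i| <= e) ->
  nrm (a - Q) + \sum_(i <- s) `|rcoord h i| < r ->
  `|f (a + \sum_(i <- s) (rcoord h i)%:C *: bvec i) - f a
     - \sum_(i <- s) rcoord h i * c i| <= e * \sum_(i <- s) `|rcoord h i|.
Proof.
move=> H; elim: s a => [|i s IH] a; first by rewrite !big_nil (addr0 a) subrr subr0 normr0 mulr0.
rewrite !big_cons => ar.
have s0 : 0 <= \sum_(i <- s) `|rcoord h i| by apply: sumr_ge0.
have step t : `|t| <= `|rcoord h i| -> nrm (a + t%:C *: bvec i - Q) <= nrm (a - Q) + `|t|.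
  move=> th; rewrite addrAC (le_trans (nrmD _ _))// lerD2l nrmZ nrm_real.
  by rewrite ler_piMr// nrm_bvec.
have h1 := @axis_step (bvec i) f a (rcoord h i) (c i) e.
have {}h1 : `|f (a + (rcoord h i)%:C *: bvec i) - f a - rcoord h i * c i| <= e * `|rcoord h i|.
  apply: h1 => t /andP[t0 t1]; apply: H.
  have tr : `|t * rcoord h i| <= `|rcoord h i|.
    by rewrite normrM (ger0_norm t0) ler_piMl.
  apply: (le_lt_trans (step _ tr)); apply: le_lt_trans ar.
  by rewrite lerD2l (le_trans tr)// lerDl.
have h2 := IH (a + (rcoord h i)%:C *: bvec i).
have {}h2 := h2 _.
rewrite addrA.
set A := f _ in h2 *; set B := f (a + _) in h1 h2 *.
have := h2; set X := \sum_(i <- s) _ * _; set Y := \sum_(i <- s) _ => {}h2.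
have {}h2 : `|A - B - X| <= e * Y.
  apply: h2; apply: le_lt_trans ar; rewrite addrA lerD2r; exact: step.
have -> : A - f a - (rcoord h i * c i + X) = (A - B - X) + (B - f a - rcoord h i * c i) by ring.
by rewrite (le_trans (ler_normD _ _))// mulrDr addrC lerD.
Qed.

Lemma sum_rcoord_le h : \sum_i `|rcoord h i| <= #|{: 'I_n * bool}|%:R * nrm h.
Proof.
rewrite (le_trans (ler_sum _ (fun i _ => rcoord_le h i)))// sumr_const mulr_natl.
exact: lexx.
Qed.

Lemma class_C_open_ball U Q : open U -> U Q ->
  exists2 r : R, 0 < r & forall w, nrm (w - Q) < r -> U w.
Proof. by move=> /open_nrm h /h. Qed.

Lemma taylor_first U f Q (e : R) : open U -> class_C 1 U f -> U Q -> 0 < e ->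
  exists2 d : R, 0 < d & forall h, nrm h < d ->
    `|f (Q + h) - f Q - \sum_i rcoord h i * real_partial (bvec i) f Q| <= e * nrm h.
Proof.
move=> oU [_ hC] UQ e0.
have [r r0 hr] := class_C_open_ball oU UQ.
pose N : R := #|{: 'I_n * bool}|%:R + 1.
have N0 : 0 < N by rewrite ltr_wpDl.
have eN : 0 < e / N by rewrite divr_gt0.
have : \forall w \near Q, forall i, `|real_partial (bvec i) f w - real_partial (bvec i) f Q| < e / N.
  apply: (@filter_forall V ('I_n * bool)%type (fun i w =>
    `|real_partial (bvec i) f w - real_partial (bvec i) f Q| < e / N) (nbhs Q) _) => i.
  have [_ [cp _]] := hC _ (bvec_basis i).
  have /continuous_nrmR/(_ _ eN)[d d0 hd] := cp Q UQ.
  exact: near_nrm d0 hd.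
move=> /nbhs_nrm[d d0 hd].
pose m := Num.min r d.
have m0 : 0 < m by rewrite lt_min r0.
exists (m / N); first by rewrite divr_gt0.
move=> h; rewrite ltr_pdivlMr// => hm.
have sN : \sum_i `|rcoord h i| <= N * nrm h.
  by rewrite (le_trans (sum_rcoord_le h))// ler_wpM2r ?nrm_ge0// lerDl.
have := @path_step f Q h m (e / N) (fun i => real_partial (bvec i) f Q) (index_enum _) Q.
rewrite -rcoord_expand subrr nrm0 add0r => H.
apply: (le_trans (H _ _)).
- move=> w i; rewrite lt_min => /andP[wr wd]; split; last exact: ltW (hd _ wd i).
  by have [dp _] := hC _ (bvec_basis i); apply: dp; exact: hr.
- by apply: le_lt_trans sN _; rewrite mulrC.
by rewrite mulrAC ler_pdivrMr// -mulrA ler_wpM2l ?(ltW e0)// mulrC.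
Qed.

Lemma quadratic_is_derive (A B t : R) :
  is_derive t 1 (fun t => t * A + t ^+ 2 / 2 * B) (A + t * B).
Proof.
apply: eps_is_derive => e e0; exists (e / (`|B| + 1)); first by rewrite divr_gt0 ?ltr_wpDl.
move=> k; rewrite ltr_pdivlMr ?ltr_wpDl// => kd.
have -> : (t + k) * A + (t + k) ^+ 2 / 2 * B - (t * A + t ^+ 2 / 2 * B) - (A + t * B) * k
  = k * (k * B / 2) by field.
rewrite normrM mulrC ler_wpM2r// normrM normrM [`|2^-1|]ger0_norm ?invr_ge0//.
have : 0 <= `|k| * `|B| by rewrite mulr_ge0.
by move: kd; rewrite mulrDr mulr1; have := normr_ge0 k; lra.
Qed.

Definition hess f Q h h' : R := \sum_i rcoord h i * \sum_j rcoord h' j *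
  real_partial (bvec j) (real_partial (bvec i) f) Q.

Lemma class_C1 U f : class_C 2 U f -> class_C 1 U f.
Proof. by move=> [cf hf]; split => // v /hf[? [? _]]. Qed.

(** Along the segment, [phi] subtracts the expected first and second order terms; its derivative is
    a combination of the remainders of [taylor_first] for the first partial derivatives, weighted by
    coordinates of [h], hence at most [e * nrm h ^+ 2]. *)
Lemma taylor_second U f Q (e : R) : open U -> class_C 2 U f -> U Q -> 0 < e ->
  exists2 d : R, 0 < d & forall h, nrm h < d -> U (Q + h) /\
    `|f (Q + h) - f Q - \sum_i rcoord h i * real_partial (bvec i) f Q
      - hess f Q h h / 2| <= e * nrm h ^+ 2.
Proof.
move=> oU hC UQ e0.
have [r r0 hr] := class_C_open_ball oU UQ.
pose N : R := #|{: 'I_n * bool}|%:R + 1.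
have N0 : 0 < N by rewrite ltr_wpDl.
have eN : 0 < e / N by rewrite divr_gt0.
have : \forall w \near Q, forall i,
   `|real_partial (bvec i) f w - real_partial (bvec i) f Q
     - \sum_j rcoord (w - Q) j * real_partial (bvec j) (real_partial (bvec i) f) Q|
   <= e / N * nrm (w - Q).
  apply: (@filter_forall V ('I_n * bool)%type (fun i w =>
    `|real_partial (bvec i) f w - real_partial (bvec i) f Q
     - \sum_j rcoord (w - Q) j * real_partial (bvec j) (real_partial (bvec i) f) Q|
    <= e / N * nrm (w - Q)) (nbhs Q) _) => i.
  have [_ c1] := hC.2 _ (bvec_basis i).
  have [d d0 hd] := taylor_first oU c1 UQ eN.
  apply/nbhs_nrm; exists d => // w /hd.
  by rewrite (_ : Q + (w - Q) = w)// addrC subrK.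
move=> /nbhs_nrm[d d0 hd].
exists (Num.min r d); first by rewrite lt_min r0.
move=> h; rewrite lt_min => /andP[hr1 hd1].
have th t : 0 <= t <= 1 -> nrm (t%:C *: h) <= nrm h.
  by move=> /andP[t0 t1]; rewrite nrmZ nrm_pos// ler_piMl ?nrm_ge0.
have Qh w : Q + w - Q = w by rewrite addrC addKr.
have Ut t : 0 <= t <= 1 -> U (Q + t%:C *: h).
  by move=> tI; apply: hr; rewrite Qh (le_lt_trans (th t tI)).
split; first by have := Ut 1; rewrite scale1r; apply; rewrite ler01 lexx.
have rc t i : rcoord (t%:C *: h) i = t * rcoord h i.
  rewrite /rcoord mxE; case: (i.2); case: (h 0 i.1) => x y; simpc => //=.
pose A := \sum_i rcoord h i * real_partial (bvec i) f Q.
pose phi t := f (Q + t%:C *: h) - (t * A + t ^+ 2 / 2 * hess f Q h h).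
pose dphi t := \sum_i rcoord h i * real_partial (bvec i) f (Q + t%:C *: h)
   - (A + t * hess f Q h h).
have D t : 0 <= t <= 1 -> is_derive t 1 phi (dphi t).
  move=> tI; apply: is_deriveB; last exact: quadratic_is_derive.
  apply: eps_is_derive => e' e'0.
  have h1 : 0 < nrm h + 1 by rewrite ltr_wpDl ?nrm_ge0.
  have [d' d'0 hd'] := taylor_first oU (class_C1 hC) (Ut t tI) (divr_gt0 e'0 h1).
  exists (d' / (nrm h + 1)); first exact: divr_gt0.
  move=> k kd; have kh : nrm (k%:C *: h) <= `|k| * (nrm h + 1).
    by rewrite nrmZ nrm_real ler_wpM2l// lerDl.
  have E : Q + t%:C *: h + k%:C *: h = Q + (t + k)%:C *: h.
    by rewrite -addrA -scalerDl -rmorphD.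
  have := hd' (k%:C *: h); rewrite E.
  have -> : \sum_i rcoord (k%:C *: h) i * real_partial (bvec i) f (Q + t%:C *: h) =
    (\sum_i rcoord h i * real_partial (bvec i) f (Q + t%:C *: h)) * k.
    by rewrite mulr_suml; apply: eq_bigr => i _; rewrite rc; ring.
  move=> H; apply: (le_trans (H _)).
    by apply: le_lt_trans kh _; rewrite -ltr_pdivlMr.
  by rewrite mulrAC ler_pdivrMr// -mulrA ler_wpM2l// ltW.
have := @mvt_le phi dphi (e * nrm h ^+ 2) D.
rewrite /phi scale1r scale0r addr0 mul1r mul0r !expr2 !mul0r mul1r addr0 subr0.
have -> : f (Q + h) - (A + 1 / 2 * hess f Q h h) - f Q =
  f (Q + h) - f Q - A - hess f Q h h / 2 by lra.
apply=> t tI.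
have -> : dphi t = \sum_i rcoord h i * (real_partial (bvec i) f (Q + t%:C *: h)
   - real_partial (bvec i) f Q - \sum_j rcoord (Q + t%:C *: h - Q) j *
     real_partial (bvec j) (real_partial (bvec i) f) Q).
  rewrite /dphi /A /hess mulr_sumr -big_split/= -sumrB; apply: eq_bigr => i _.
  have -> : \sum_j rcoord (Q + t%:C *: h - Q) j *
      real_partial (bvec j) (real_partial (bvec i) f) Q =
      t * \sum_j rcoord h j * real_partial (bvec j) (real_partial (bvec i) f) Q.
    by rewrite Qh mulr_sumr; apply: eq_bigr => j _; rewrite rc mulrA.
  by ring.
rewrite (le_trans (ler_norm_sum _ _ _))//.
apply: (@le_trans _ _ (\sum_(i : 'I_n * bool) nrm h * (e / N * nrm h))).
  apply: ler_sum => i _; rewrite normrM; apply: ler_pM => //; first exact: rcoord_le.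
  have := hd (Q + t%:C *: h); rewrite Qh => /(_ (le_lt_trans (th t tI) hd1) i) /le_trans.
  by apply; rewrite ler_wpM2l ?(ltW eN)// th.
rewrite sumr_const -mulr_natl.
have -> : #|{: 'I_n * bool}|%:R * (nrm h * (e / N * nrm h)) =
   e * (nrm h * nrm h) * (#|{: 'I_n * bool}|%:R / N) by ring.
rewrite ler_piMr// ?mulr_ge0 ?nrm_ge0 ?(ltW e0)//.
by rewrite ler_pdivrMr// mul1r lerDl.
Qed.

End Taylor.

(** * Analytic discs at a strictly positive direction of the Levi form *)

Section Levi.
Context {R : realType} {n : nat}.
Local Notation C := R[i].
Local Notation V := 'rV[C]_n.
Implicit Types (z w v h u Q : V) (f rho : V -> R) (t s : R) (U : set V).

Lemma real_partial_cst v (c : R) Q : real_partial v (fun=> c) Q = 0.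
Proof. exact: derive1_cst. Qed.

Lemma real_partial_half v f Q : derivable (fun t : R => f (Q + t%:C *: v)) 0 1 ->
  real_partial v (fun w => f w / 2) Q = real_partial v f Q / 2.
Proof.
move=> df; rewrite /real_partial !derive1E.
under eq_fun do rewrite mulrC.
by rewrite deriveZ// /GRing.scale/= mulrC.
Qed.

Lemma bvec_re (j : 'I_n) : delta_mx 0 j = @bvec R n (j, false). Proof. by []. Qed.

Lemma bvec_im (j : 'I_n) : 'i%C *: delta_mx 0 j = @bvec R n (j, true). Proof. by []. Qed.

Opaque real_partial bvec.

Lemma rcoordD h h' i : rcoord (h + h') i = rcoord h i + rcoord h' i.
Proof. by rewrite /rcoord mxE; case: (i.2); rewrite raddfD. Qed.

Lemma rcoordZ t h i : rcoord (t%:C *: h) i = t * rcoord h i.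
Proof.
by rewrite /rcoord mxE; case: (i.2); case: (h 0 i.1) => x y; simpc.
Qed.

Lemma hessDl f Q h h' k : hess f Q (h + h') k = hess f Q h k + hess f Q h' k.
Proof.
by rewrite /hess -big_split; apply: eq_bigr => i _; rewrite rcoordD mulrDl.
Qed.

Lemma hessDr f Q k h h' : hess f Q k (h + h') = hess f Q k h + hess f Q k h'.
Proof.
rewrite /hess -big_split; apply: eq_bigr => i _ /=; rewrite -mulrDr -big_split.
by congr (_ * _); apply: eq_bigr => j _; rewrite rcoordD mulrDl.
Qed.

Lemma hessZl f Q t h k : hess f Q (t%:C *: h) k = t * hess f Q h k.
Proof.
by rewrite /hess mulr_sumr; apply: eq_bigr => i _; rewrite rcoordZ mulrA.
Qed.

Lemma hessZr f Q t k h : hess f Q k (t%:C *: h) = t * hess f Q k h.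
Proof.
rewrite /hess mulr_sumr; apply: eq_bigr => i _; rewrite mulrCA; congr (_ * _).
by rewrite mulr_sumr; apply: eq_bigr => j _; rewrite rcoordZ mulrA.
Qed.

Lemma hess_le f Q : exists2 K : R, 0 <= K &
  forall h k, `|hess f Q h k| <= K * (nrm h * nrm k).
Proof.
pose K := \sum_(i : 'I_n * bool) \sum_(j : 'I_n * bool)
  `|real_partial (bvec j) (real_partial (bvec i) f) Q|.
exists K; first by apply: sumr_ge0 => i _; apply: sumr_ge0.
move=> h k; rewrite /hess (le_trans (ler_norm_sum _ _ _))// /K mulr_suml.
apply: ler_sum => i _; rewrite normrM mulrCA; apply: ler_pM => //; first exact: rcoord_le.
rewrite (le_trans (ler_norm_sum _ _ _))// mulr_suml; apply: ler_sum => j _.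
by rewrite normrM mulrC ler_wpM2l// rcoord_le.
Qed.

(** The entries are twice the Wirtinger derivatives d/dz_j ([d_z_real]), so that the real
    differential is the real part of the associated form ([grad_form]). *)
Definition grad f Q : 'cV[C]_n :=
  \col_j (real_partial (bvec (j, false)) f Q -i* real_partial (bvec (j, true)) f Q).

Lemma gradE f Q j : grad f Q j 0 =
  real_partial (bvec (j, false)) f Q -i* real_partial (bvec (j, true)) f Q.
Proof. by rewrite /grad mxE. Qed.

Lemma grad_form f Q h :
  \sum_i rcoord h i * real_partial (bvec i) f Q = complex.Re (lform (grad f Q) h).
Proof.
rewrite rcoord_sum /lform mxE raddf_sum/=; apply: eq_bigr => j _.
rewrite gradE; move: (real_partial _ _ _) (real_partial _ _ _) (h 0 j) => a b [x y] /=.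
ring.
Qed.

Lemma d_z_real f Q j : d_z j (fun w => (f w)%:C) Q = grad f Q j 0 / 2.
Proof.
rewrite /d_z /complex_partial gradE bvec_im bvec_re !real_partial_cst.
move: (real_partial _ _ _) (real_partial _ _ _) => a b; congr (_ / _).
by simpc.
Qed.

Lemma d_zbar_real f j : d_zbar j (fun w => (f w)%:C) =
  fun w => (real_partial (bvec (j, false)) f w / 2) +i*
           (real_partial (bvec (j, true)) f w / 2).
Proof.
apply/funext => w; rewrite /d_zbar /complex_partial bvec_im bvec_re !real_partial_cst.
rewrite (_ : (2 : C)^-1 = (2^-1)%:C); last by rewrite fmorphV rmorph_nat.
move: (real_partial _ _ _) (real_partial _ _ _) => a b.
by simpc.
Qed.

Definition rform (B : 'I_n * bool -> 'I_n * bool -> R) h h' : R :=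
  \sum_i rcoord h i * \sum_j rcoord h' j * B i j.

Lemma rform_pairs B h h' : rform B h h' = \sum_k \sum_j
  (complex.Re (h 0 k) * (complex.Re (h' 0 j) * B (k, false) (j, false) +
     complex.Im (h' 0 j) * B (k, false) (j, true)) +
   complex.Im (h 0 k) * (complex.Re (h' 0 j) * B (k, true) (j, false) +
     complex.Im (h' 0 j) * B (k, true) (j, true))).
Proof.
rewrite /rform rcoord_sum; apply: eq_bigr => k _.
by rewrite !rcoord_sum !mulr_sumr -big_split.
Qed.

Lemma rform_levi B v :
  rform B v v + rform B ('i%C *: v) ('i%C *: v) = 4 * complex.Re (\sum_j \sum_k
    ((B (k, false) (j, false) / 2 +i* (B (k, true) (j, false) / 2)) -
     'i%C * (B (k, false) (j, true) / 2 +i* (B (k, true) (j, true) / 2))) / 2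
     * v 0 j * (v 0 k)^*%C).
Proof.
rewrite !rform_pairs exchange_big/= [in RHS]raddf_sum mulr_sumr.
rewrite [X in _ + X]exchange_big -big_split; apply: eq_bigr => j _ /=.
rewrite raddf_sum mulr_sumr -big_split; apply: eq_bigr => k _ /=.
rewrite !mxE (_ : (2 : C)^-1 = (2^-1)%:C); last by rewrite fmorphV rmorph_nat.
move: (B _ _) (B _ _) (B _ _) (B _ _) (v 0 j) (v 0 k) => a b c d [x y] [x' y'].
by simpc => /=; field.
Qed.

Lemma d_z_d_zbar U f Q j k : class_C 2 U f -> U Q ->
  d_z j (d_zbar k (fun w => (f w)%:C)) Q =
  let B i i' := real_partial (bvec i') (real_partial (bvec i) f) Q in
  ((B (k, false) (j, false) / 2 +i* (B (k, true) (j, false) / 2)) -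
     'i%C * (B (k, false) (j, true) / 2 +i* (B (k, true) (j, true) / 2))) / 2.
Proof.
move=> [_ hC] UQ.
have dh i i' : real_partial (bvec i) (fun w => real_partial (bvec i') f w / 2) Q =
    real_partial (bvec i) (real_partial (bvec i') f) Q / 2.
  apply: real_partial_half; have [_ [_ c1]] := hC _ (bvec_basis i').
  by have [dp _] := c1 _ (bvec_basis i); exact: dp.
rewrite d_zbar_real; move: (dh (j, false) (k, false)) (dh (j, false) (k, true)).
move: (dh (j, true) (k, false)) (dh (j, true) (k, true)) => h1 h2 h3 h4.
exact: (congr2 (fun u v : C => (u - 'i%C * v) / 2)
  (congr2 (fun a b : R => a +i* b) h3 h4) (congr2 (fun a b : R => a +i* b) h1 h2)).
Qed.

Lemma levi_hess U f Q v : class_C 2 U f -> U Q ->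
  hess f Q v v + hess f Q ('i%C *: v) ('i%C *: v) = 4 * complex.Re (levi_form f Q v).
Proof.
move=> hC UQ.
rewrite (rform_levi (fun i i' => real_partial (bvec i') (real_partial (bvec i) f) Q) v).
congr (4 * complex.Re _); apply: eq_bigr => j _; apply: eq_bigr => k _.
by congr (_ * _ * _); symmetry; exact: d_z_d_zbar hC UQ.
Qed.

(** On a complex line the Hessian is [nrm l ^+ 2] times a constant, which by [levi_hess] is twice
    the Levi form, plus the real part of a holomorphic quadratic in [l]; a holomorphic bending of
    the disc can cancel the latter. *)
Lemma hess_line f Q v (l : C) : let P := hess f Q v v in
  let T := hess f Q ('i%C *: v) ('i%C *: v) in
  let S := hess f Q v ('i%C *: v) + hess f Q ('i%C *: v) v in
  hess f Q (l *: v) (l *: v) = nrm l ^+ 2 * ((P + T) / 2) +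
    complex.Re (l ^+ 2 * ((P - T) / 2 -i* (S / 2))).
Proof.
move=> P T S; rewrite nrm_sqr; case: l => x y.
have -> : (x +i* y) *: v = x%:C *: v + y%:C *: ('i%C *: v).
  by rewrite scalerA -scalerDl; congr (_ *: _); simpc.
rewrite !hessDl !hessDr !hessZl !hessZr -/P -/T /S expr2; simpc => /=.
by field.
Qed.

(** The terms with [K] cost at most three times [lam / 16 * x ^+ 2 + t / 16] and the one with [E] at
    most [lam / 4 * x ^+ 2 + t / 4]: together less than half of the main term [lam * x ^+ 2 + t]. *)
Lemma levi_estimate (lam K E x t s : R) : 0 < lam -> 0 <= K -> 0 <= x -> x <= s ->
  0 <= t -> t <= s -> s <= 1 -> K * s <= lam / 16 -> K * s <= 1 / 16 ->
  lam * s <= 1 -> 0 <= E -> E <= lam / 8 -> (0 < x) || (0 < t) ->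
  0 < lam * x ^+ 2 + t - K * (x * (x ^+ 2 + t)) - K * (x ^+ 2 + t) ^+ 2
      - E * (x + t) ^+ 2.
Proof.
move=> lam0 K0 x0 xs t0 ts s1 K1 K2 ls E0 El xt.
have X0 : 0 <= x ^+ 2 by exact: sqr_ge0.
have h1 : K * (x * (x ^+ 2 + t)) <= K * s * x ^+ 2 + K * s * t.
  rewrite -mulrDr -mulrA ler_wpM2l// ler_wpM2r// addr_ge0//.
have xx : x ^+ 2 <= s by rewrite expr2 (le_trans _ xs)// ler_piMr// (le_trans xs).
have h2 : K * (x ^+ 2 + t) ^+ 2 <= 2 * (K * s * x ^+ 2 + K * s * t).
  have -> : 2 * (K * s * x ^+ 2 + K * s * t) = K * (2 * s * (x ^+ 2 + t)) by ring.
  rewrite ler_wpM2l// expr2 ler_wpM2r ?addr_ge0//; lra.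
have h3 : E * (x + t) ^+ 2 <= lam / 8 * (2 * x ^+ 2 + 2 * (s * t)).
  apply: ler_pM => //; first exact: sqr_ge0.
  have : t ^+ 2 <= s * t by rewrite expr2 ler_wpM2r.
  by have := sqr_ge0 (x - t); rewrite sqrrB sqrrD; lra.
have a1 : K * s * x ^+ 2 <= lam / 16 * x ^+ 2 by rewrite ler_wpM2r.
have a2 : K * s * t <= 1 / 16 * t by rewrite ler_wpM2r.
have a3 : lam / 8 * (2 * x ^+ 2 + 2 * (s * t)) <= lam / 4 * x ^+ 2 + t / 4.
  have -> : lam / 8 * (2 * x ^+ 2 + 2 * (s * t)) = lam / 4 * x ^+ 2 + lam * s * t / 4.
    by field.
  have : lam * s * t <= 1 * t by rewrite ler_wpM2r.
  lra.
have a4 : 0 < lam * x ^+ 2 + t.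
  case/orP: xt => h; first by rewrite ltr_wpDr// mulr_gt0// exprn_gt0.
  by rewrite ltr_wpDl// mulr_ge0// ltW.
have a5 : 0 <= lam * x ^+ 2 by rewrite mulr_ge0// ltW.
lra.
Qed.

(* The quadratic correction [u] cancels the pluriharmonic part of the Hessian
   along the complex tangent [v], leaving the positive Levi form. *)
Lemma levi_normal_form U rho Q v : U Q -> class_C 2 U rho ->
  (exists2 w, real_basis w & real_partial w rho Q != 0) ->
  complex_tangent rho Q v -> 0 < levi_form rho Q v ->
  exists u nu lam K, [/\ 0 < lam, 0 <= K & forall (l : C) t,
    let k := l ^+ 2 *: u + t%:C *: nu in
    lam * nrm l ^+ 2 + t - K * (nrm k * (nrm (l *: v) + nrm k)) <=
    complex.Re (lform (grad rho Q) (l *: v + k)) + hess rho Q (l *: v + k) (l *: v + k) / 2].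
Proof.
move=> UQ hC [w0 [j0 bw] pw] tv lv.
have av : lform (grad rho Q) v = 0.
  have : \sum_(j < n) d_z j (fun w => (rho w)%:C) Q * v 0 j = 0 := tv.
  rewrite (eq_bigr (fun j => 2^-1 * (v 0 j * grad rho Q j 0))); last first.
    by move=> j _; rewrite d_z_real; move: (grad _ _ _ _) (v 0 j) => b c; ring.
  rewrite -mulr_sumr => /eqP; rewrite mulf_eq0 invr_eq0 pnatr_eq0/= => /eqP h.
  by rewrite /lform mxE.
have a0 : grad rho Q j0 0 != 0.
  apply/negP => /eqP; rewrite gradE => -[h1 /eqP]; rewrite oppr_eq0 => /eqP h2.
  by move/negP: pw; apply; apply/eqP; case: bw => ->;
    [rewrite bvec_re; exact: h1|rewrite bvec_im; exact: h2].
have [K K0 hK] := hess_le rho Q.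
have := levi_hess v hC UQ.
have := @hess_line rho Q v.
have := @hessDl rho Q; have := @hessDr rho Q.
have lam0 : 0 < complex.Re (levi_form rho Q v).
  by move: lv; case: (levi_form _ _ _) => x y /=; rewrite ltcE/= => /andP[].
move: lam0; move: (complex.Re (levi_form rho Q v)) => lam lam0.
move: K0 hK av a0; move: (hess rho Q) (grad rho Q) => B a {lv tv pw bw hC} K0 hK av a0 Br Bl.
move: (B v v) (B ('i%C *: v) ('i%C *: v)) (B v ('i%C *: v) + B ('i%C *: v) v) => P T S.
move=> /= hline PT.
(* A normal direction: the form [a], twice the complex differential of [rho], is nonzero, and
   [t%:C *: nu] raises [rho] by [t] to first order. *)
have [nu anu] : exists nu, lform a nu = 1.
  exists ((a j0 0)^-1 *: delta_mx 0 j0).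
  by rewrite lformZ /lform -rowE [_ 0 0]mxE mulVf.
pose alpha : C := (P - T) / 2 -i* (S / 2).
(* The form [a] takes the value [- l ^+ 2 * alpha / 2] on [l ^+ 2 *: u], opposite to what the halved
   Hessian adds to the Levi term. *)
exists ((- alpha / 2) *: nu), nu, lam, K; split => // l t /=.
set k := l ^+ 2 *: _ + _.
have -> : complex.Re (lform a (l *: v + k)) = t - complex.Re (l ^+ 2 * alpha) / 2.
  rewrite /k !lformD !lformZ av anu mulr0 add0r !mulr1.
  rewrite (_ : - alpha / 2 = - (2^-1)%:C * alpha); last first.
    by rewrite fmorphV rmorph_nat !mulNr [alpha * _]mulrC.
  suff H (x y : C) : complex.Re (x * (- (2^-1)%:C * y) + t%:C) =
      t - complex.Re (x * y) / 2 by exact: H.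
  by move: x y => [p q] [r r'] /=; simpc => /=; field.
rewrite (Bl (l *: v) k) (Br (l *: v) (l *: v) k) (Br k (l *: v) k) hline -/alpha PT.
have := hK (l *: v) k; have := hK k (l *: v); have := hK k k; rewrite !ler_norml.
rewrite mulrDr mulrDr [nrm (l *: v) * nrm k]mulrC.
have k0 : 0 <= K * (nrm k * nrm k) by rewrite !mulr_ge0 ?nrm_ge0.
move: (K * (nrm k * nrm k)) (K * (nrm k * nrm (l *: v))) k0 => p1 p2.
move: (B k k) (B k (l *: v)) (B (l *: v) k) (complex.Re _) => q1 q2 q3 q4.
have -> : nrm l ^+ 2 * (4 * lam / 2) = 2 * (lam * nrm l ^+ 2) by field.
move: (lam * nrm l ^+ 2) => y p10 /andP[h1 _] /andP[h2 _] /andP[h3 _].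
clear -h1 h2 h3 p10; lra.
Qed.

Lemma sum_bounds (a b c : R) : 0 <= a -> 0 <= b -> 0 <= c ->
  [/\ a <= a + b + c + 1, b <= a + b + c + 1, c <= a + b + c + 1 & 1 <= a + b + c + 1].
Proof. by move=> a0 b0 c0; split; lra. Qed.

Lemma small_parameter (M d K lam : R) : 0 < M -> 0 < d -> 0 <= K -> 0 < lam ->
  exists s : R, [/\ 0 < s, s <= 1, 4 * M * s < d &
    [/\ K * s <= lam / 16, K * s <= 1 / 16 & lam * s <= 1]].
Proof.
move=> M0 d0 K0 lam0.
pose s := Num.min (Num.min 1 (d / (8 * M))) (Num.min (Num.min (lam / 16 / (K + 1))
   (1 / 16 / (K + 1))) (1 / lam)).
have K1 : 0 < K + 1 by rewrite ltr_wpDl.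
have M8 : 0 < 8 * M by rewrite mulr_gt0.
have s0 : 0 < s by rewrite !lt_min ltr01 !divr_gt0.
exists s; split => //.
- by rewrite !ge_min lexx.
- have : s <= d / (8 * M) by rewrite !ge_min lexx orbT.
  by rewrite ler_pdivlMr//; lra.
have hKs (b : R) : s <= b / (K + 1) -> K * s <= b.
  rewrite ler_pdivlMr// => h; rewrite mulrC (le_trans _ h)//.
  by rewrite ler_wpM2l ?(ltW s0)// lerDl.
split.
- by apply: hKs => //; rewrite !ge_min lexx !orbT.
- by apply: hKs => //; rewrite !ge_min lexx !orbT.
have : s <= 1 / lam by rewrite !ge_min lexx !orbT.
by rewrite ler_pdivlMr// mulrC.
Qed.

Lemma positive_discs U (rho q : V -> R) Q v u nu (lam K : R) : 0 < lam -> 0 <= K ->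
  (forall (l : C) t, let k := l ^+ 2 *: u + t%:C *: nu in
    lam * nrm l ^+ 2 + t - K * (nrm k * (nrm (l *: v) + nrm k)) <= q (l *: v + k)) ->
  (forall e : R, 0 < e -> exists2 d : R, 0 < d & forall h, nrm h < d ->
    U (Q + h) /\ `|rho (Q + h) - q h| <= e * nrm h ^+ 2) ->
  exists2 s : R, 0 < s & forall (l : C) (t : R), nrm l <= s -> 0 <= t <= s ->
    (0 < nrm l) || (0 < t) ->
    let Z := Q + (l *: v + (l ^+ 2 *: u + t%:C *: nu)) in U Z /\ 0 < rho Z.
Proof.
move=> lam0 K0 hq hrho.
pose M := nrm v + nrm u + nrm nu + 1.
have [Mv Mu Mn M1] := sum_bounds (nrm_ge0 v) (nrm_ge0 u) (nrm_ge0 nu).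
rewrite -/M in Mv Mu Mn M1.
have M0 : 0 < M by exact: lt_le_trans M1.
(* Since [nrm (l *: v + k) <= 2 * M * (nrm l + t)], the Taylor error becomes at most
   [lam / 8 * (nrm l + t) ^+ 2], the term with [E] in [levi_estimate]. *)
pose e := lam / 32 / M ^+ 2.
have e0 : 0 < e by rewrite !divr_gt0// exprn_gt0.
have [d d0 hd] := hrho e e0.
pose K' := K * M ^+ 2.
have K'0 : 0 <= K' by rewrite mulr_ge0// exprn_ge0// ltW.
have [s [s0 s1 sd [sK1 sK2 sl]]] := small_parameter M0 d0 K'0 lam0.
exists s => // l t ls /andP[t0 ts] lt Z.
move: (hq l t) => /=; rewrite /Z; set k := l ^+ 2 *: u + t%:C *: nu => {}hq.
pose x := nrm l; have x0 : 0 <= x := nrm_ge0 l.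
have xt0 : 0 <= x ^+ 2 + t by rewrite addr_ge0// exprn_ge0.
have nk : nrm k <= M * (x ^+ 2 + t).
  rewrite (le_trans (nrmD (l ^+ 2 *: u) (t%:C *: nu)))//.
  rewrite (nrmZ (l ^+ 2) u) (nrmZ t%:C nu).
  rewrite (_ : nrm (l ^+ 2) = x ^+ 2); last exact: nrmX.
  rewrite nrm_pos// mulrDr.
  by apply: lerD; rewrite mulrC ler_wpM2r// exprn_ge0.
have nlv : nrm (l *: v) <= M * x by rewrite nrmZ mulrC ler_wpM2r.
have xx : x ^+ 2 <= x by rewrite expr2 ler_piMr// (le_trans ls).
have nh : nrm (l *: v + k) <= 2 * M * (x + t).
  rewrite (le_trans (nrmD _ _))//.
  have h1 : M * (x ^+ 2 + t) <= M * (x + t) by rewrite ler_pM2l// lerD2r.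
  have h2 : 0 <= M * t by rewrite mulr_ge0// ltW.
  apply: (le_trans (lerD nlv (le_trans nk h1))).
  have -> : 2 * M * (x + t) = M * x + M * (x + t) + M * t by ring.
  by rewrite lerDl.
have hdl : nrm (l *: v + k) < d.
  apply: (le_lt_trans nh); apply: le_lt_trans sd.
  have -> : 4 * M * s = 2 * M * (s + s) by ring.
  by rewrite ler_pM2l ?mulr_gt0// lerD.
have [UZ hZ] := hd _ hdl; split => //.
have b1 : K * (nrm k * (nrm (l *: v) + nrm k)) <=
    K' * (x * (x ^+ 2 + t)) + K' * (x ^+ 2 + t) ^+ 2.
  have -> : K' * (x * (x ^+ 2 + t)) + K' * (x ^+ 2 + t) ^+ 2 =
     K * (M * (x ^+ 2 + t) * (M * x + M * (x ^+ 2 + t))) by rewrite /K'; ring.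
  by rewrite ler_wpM2l//; apply: ler_pM; rewrite ?addr_ge0 ?nrm_ge0// lerD.
have b4 : e * nrm (l *: v + k) ^+ 2 <= lam / 8 * (x + t) ^+ 2.
  have -> : lam / 8 * (x + t) ^+ 2 = e * (2 * M * (x + t)) ^+ 2.
    by rewrite /e; field; rewrite gt_eqF.
  by rewrite ler_pM2l// lerXn2r// nnegrE ?nrm_ge0// mulr_ge0 ?addr_ge0// mulr_ge0// ltW.
have l8 : 0 <= lam / 8 by rewrite divr_ge0// ltW.
have := levi_estimate lam0 K'0 x0 ls t0 ts s1 sK1 sK2 sl l8 (lexx _) lt.
move: hZ hq b1 b4; rewrite ler_norml -/x => /andP[hZ _].
move: (K' * (x * (x ^+ 2 + t))) (K' * (x ^+ 2 + t) ^+ 2) (lam / 8 * (x + t) ^+ 2).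
move: (e * nrm (l *: v + k) ^+ 2) (lam * x ^+ 2) (K * _) hZ => e1 y p0 hZ p1 p2 p3.
by move: hZ; move: (rho _) (q _) => r1 r2; clear; lra.
Qed.

(** The disc [l |-> Q + l *: v + l ^+ 2 *: u] is tangent to the boundary at [Q], and [t] pushes it
    outwards along [nu]; only the disc [t = 0] meets the zero set of [rho], and only at its centre
    [Q]. *)
Theorem levi_discs U rho Q v : open U -> U Q -> class_C 2 U rho -> rho Q = 0 ->
  (exists2 w, real_basis w & real_partial w rho Q != 0) ->
  complex_tangent rho Q v -> 0 < levi_form rho Q v ->
  exists u nu, exists2 s : R, 0 < s & forall (l : C) (t : R), nrm l <= s -> 0 <= t <= s ->
    (0 < nrm l) || (0 < t) ->
    let Z := Q + (l *: v + (l ^+ 2 *: u + t%:C *: nu)) in U Z /\ 0 < rho Z.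
Proof.
move=> oU UQ hC rQ hw tv lv.
have [u [nu [lam [K [lam0 K0 hq]]]]] := levi_normal_form UQ hC hw tv lv.
exists u, nu; pose q h := complex.Re (lform (grad rho Q) h) + hess rho Q h h / 2.
apply: (@positive_discs U rho q Q v u nu lam K lam0 K0 hq) => e e0.
have [d d0 hd] := taylor_second oU hC UQ e0.
exists d => // h /hd[Uh th]; split => //; apply: le_trans th.
by rewrite /q rQ subr0 grad_form opprD addrA.
Qed.

End Levi.

(** * Squeezing function and Fridman invariant *)

Section HoleDistance.
Context {R : realType} {n : nat}.
Local Notation C := R[i].
Local Notation V := 'rV[C]_n.
Local Notation minkowski := Defs.minkowski.
Local Notation tanh := Defs.tanh.
Local Notation atanh := Defs.atanh.
Implicit Types (x y w u v Q : V) (l : C).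

Context (Omega L : set V) (hO : convex_balanced Omega) (n2 : (2 <= n)%N)
  (cL : compact L) (LO : L `<=` Omega) (cD : connected (Omega `\` L)).
Local Notation D := (Omega `\` L).
Context (z0 : V) (Dz0 : D z0) (phi psi : V -> V) (hphi : holo Omega Omega phi)
  (hpsi : holo Omega Omega psi) (phiK : forall z, Omega z -> psi (phi z) = z)
  (psiK : forall z, Omega z -> phi (psi z) = z) (phiz0 : phi z0 = 0).
Local Notation rho := (minkowski Omega).

Lemma rho_phi_lt1 w : Omega w -> rho (phi w) < 1.
Proof. by move=> Ow; apply/minkowski_domain => //; case: (hphi Ow). Qed.

(** The case of an empty hole in [caratheodory_hole]. *)
Lemma caratheodory_domain w : Omega w ->
  caratheodory Omega z0 w = (atanh (rho (phi w)))%:E.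
Proof.
move=> Ow; have D0 : Omega `\` set0 = Omega by rewrite setD0.
have c : connected (Omega `\` set0) by rewrite D0; case: hO => -[].
have [zz ww] : (Omega `\` set0) z0 /\ (Omega `\` set0) w.
  by rewrite D0; split => //; case: Dz0.
have := caratheodory_hole hO n2 (@compact0 _) (@sub0set _ Omega) c zz hphi hpsi
  phiK psiK phiz0 ww.
by rewrite D0.
Qed.

Lemma etanh_caratheodory w : Omega w ->
  etanh (caratheodory Omega z0 w) = rho (phi w).
Proof.
move=> Ow; rewrite caratheodory_domain//= tanhK ?rho_phi_lt1//.
by have := minkowski_ge0 (phi w) hO; lra.
Qed.

Lemma caratheodory_lt w (r : R) : D w ->
  (caratheodory D z0 w < r%:E)%E <-> rho (phi w) < tanh r.
Proof.
move=> Dw; have [Ow _] := Dw.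
rewrite (caratheodory_hole hO n2 cL LO cD Dz0 hphi hpsi phiK psiK phiz0 Dw).
rewrite lte_fin atanh_lt ?rho_phi_lt1//.
by have := minkowski_ge0 (phi w) hO; lra.
Qed.

Lemma nearest_point : L !=set0 ->
  exists2 w, L w & forall v, L v -> rho (phi w) <= rho (phi v).
Proof.
move=> L0; have := @compact_EVT_min _ _ (fun w => rho (phi w)) _ L0 cL.
case.
  apply: continuous_in_subspaceT => w; rewrite inE => /LO/hphi[_ dw].
  have h := differentiable_continuous dw.
  apply: (@continuous_comp _ _ _ phi rho) => //.
  exact: minkowski_continuous.
move=> w /set_mem Lw wm; exists w; first exact: Lw.
by move=> v Lv; exact: wm v (mem_set Lv).
Qed.

Context (w0 : V) (Lw0 : L w0) (w0_nearest : forall v, L v -> rho (phi w0) <= rho (phi v)).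
Local Notation d := (rho (phi w0)).

Lemma caratheodory_dist_eq : caratheodory_dist Omega L z0 = d.
Proof.
have Ow0 := LO Lw0.
apply/eqP; rewrite eq_le; apply/andP; split.
  apply: ge_inf; first by exists d => _ [w Lw <-]; rewrite etanh_caratheodory ?w0_nearest//; exact: LO.
  by exists w0 => //; rewrite etanh_caratheodory.
apply: lb_le_inf; first by exists (etanh (caratheodory Omega z0 w0)), w0.
by move=> _ [w Lw <-]; rewrite etanh_caratheodory ?w0_nearest//; exact: LO.
Qed.

Lemma distance_gt0 : 0 < d.
Proof.
rewrite lt_neqAle minkowski_ge0// andbT eq_sym minkowski_eq0//.
apply/negP => /eqP p0; have [Oz Lz] := Dz0; apply: Lz.
by rewrite -(phiK Oz) phiz0 -p0 phiK//; exact: LO.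
Qed.

Lemma psi_ball u : rho u < d -> D (psi u).
Proof.
move=> ud; have Ou : Omega u by apply/minkowski_domain => //; exact: lt_trans (rho_phi_lt1 (LO Lw0)).
split; first by case: (hpsi Ou).
by move=> /w0_nearest; rewrite psiK// leNgt ud.
Qed.

Lemma D_ball x : D x -> exists2 r : R, 0 < r & forall w, nrm (w - x) < r -> D w.
Proof. by have /open_nrm h := D_open hO cL; exact: h. Qed.

Lemma domain_ball x : Omega x ->
  exists2 r : R, 0 < r & forall w, nrm (w - x) < r -> Omega w.
Proof. by have [[/open_nrm oO _ _] _ _ _] := hO; exact: oO. Qed.

Lemma squeezing_eq : (forall w (e : R), L w -> 0 < e -> exists2 v, D v & nrm (v - w) < e) ->
  squeezing Omega D z0 = d.
Proof.
move=> thin.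
have in_set : 0 < d /\ exists f, [/\ holo D Omega f, set_inj D f, f z0 = 0
    & [set w | rho w < d] `<=` f @` D].
  split; first exact: distance_gt0.
  exists phi; split => //.
  - by move=> w [Ow _]; exact: hphi.
  - by move=> v w; rewrite !inE => -[Ov _] [Ow _] vw; rewrite -(phiK Ov) vw phiK.
  move=> u /= ud; exists (psi u); first exact: psi_ball.
  by rewrite psiK//; apply/minkowski_domain => //; exact: lt_trans (rho_phi_lt1 (LO Lw0)).
have upper r : 0 < r -> (exists f, [/\ holo D Omega f, set_inj D f, f z0 = 0
    & [set w | rho w < r] `<=` f @` D]) -> r <= d.
  move=> r0 [f [hf injf f0 hr]]; rewrite leNgt; apply/negP => dr.
  have [F hF Ff] := extension hO n2 cL LO cD Dz0 hphi hpsi phiK psiK phiz0 hf.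
  have Ow0 := LO Lw0.
  have Fz : F z0 = 0 by rewrite Ff.
  (* The Schwarz lemma keeps [F w0] in the ball contained in the image of [f], so this value is also
     taken at a point [w] of [D], which differs from [w0]. *)
  have /hr[w Dw fw] : rho (F w0) < r.
    exact: le_lt_trans (schwarz_extension hO Dz0 hphi hpsi phiK phiz0 hF Fz Ow0) dr.
  have [e e0 he] := D_ball Dw.
  have hin : hol_in f w e by move=> x /he Dx; case: (holo_hol hf Dx).
  have inj x y : nrm (x - w) < e -> nrm (y - w) < e -> f x = f y -> x = y.
    by move=> /he Dx /he Dy; apply: injf; rewrite inE.
  have ww : nrm (w - w) < e by rewrite subrr nrm0.
  have uJ := osgood hin inj ww.
  have ne : 0 < nrm (w0 - w).
    by rewrite nrm_gt0 subr_eq0; apply/negP => /eqP ww0; case: Dw; rewrite -ww0.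
  (* Half the distance keeps the local inverse near [w] away from points near [w0]; the value at a
     point [v] of [D] close to [w0] then has a second preimage near [w]. *)
  pose e' := Num.min e (nrm (w0 - w) / 2).
  have e'0 : 0 < e' by rewrite lt_min e0 divr_gt0.
  have hin' : hol_in f w e'.
    by move=> x; rewrite lt_min => /andP[/hin].
  have [g [b [b0 _ _ gP]]] := local_inverse e'0 hin' uJ.
  have [hF0 _] := hF w0 Ow0.
  have [c c0 hc] := cont_eps (hol_cont hF0) b0.
  have m0 : 0 < Num.min c (nrm (w0 - w) / 2) by rewrite lt_min c0 divr_gt0.
  have [v Dv] := thin w0 _ Lw0 m0.
  rewrite lt_min => /andP[vc vw].
  have Fv : nrm (F v - f w) < b by rewrite fw; exact: hc.
  have [fg gw _] := gP _ Fv.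
  move: gw; rewrite lt_min => /andP[ge gw].
  have gv : g (F v) = v.
    apply: injf; rewrite ?inE//; first exact: he.
    by rewrite fg Ff.
  move: gw; rewrite gv => gw.
  by have := nrmBD v w0 w; rewrite [nrm (w0 - v)]nrmBC; lra.
apply/eqP; rewrite eq_le; apply/andP; split.
  apply: ge_sup; first by exists d.
  by move=> r [r0 hr]; exact: upper.
apply: ub_le_sup => //; exists d => r [r0 hr]; exact: upper.
Qed.

Lemma fridman_lower : exists r : R, [/\ 0 < r, d = tanh r &
  exists f, [/\ holo Omega D f, set_inj Omega f & caratheodory_ball D z0 r `<=` f @` Omega]].
Proof.
have d1 := rho_phi_lt1 (LO Lw0); have d0 := distance_gt0.
have dN : -1 < d by lra.
have dK : tanh (atanh d) = d by exact: tanhK.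
exists (atanh d); split => //.
  rewrite ltNge; apply/negP; rewrite atanh_le// /Defs.tanh oppr0 subrr mul0r; lra.
have dC : d%:C != 0 :> C by rewrite fmorph_eq0 gt_eqF.
have rd u : Omega u -> rho (d%:C *: u) < d.
  move=> /(minkowski_domain _ hO) u1; rewrite minkowskiZ// nrm_pos ?(ltW d0)//.
  by rewrite gtr_pMr.
have du u : Omega u -> Omega (d%:C *: u).
  by move=> /rd h; apply/minkowski_domain => //; exact: lt_trans d1.
exists (fun u => psi (d%:C *: u)); split.
- move=> u Ou; split; first exact: psi_ball (rd u Ou).
  have [h _] := holo_hol hpsi (du u Ou).
  by apply/hol_atP; exact: (hol_scaling h).
- move=> u v; rewrite !inE => Ou Ov /(congr1 phi).
  by rewrite (psiK (du u Ou)) (psiK (du v Ov)) => /(scalerI dC).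
move=> w [Dw]; rewrite caratheodory_lt// dK => wd.
have [Ow _] := Dw.
exists ((d%:C)^-1 *: phi w); last by rewrite scalerA divff// scale1r phiK.
apply/minkowski_domain => //; rewrite minkowskiZ// nrmV nrm_pos ?(ltW d0)//.
by rewrite ltr_pdivrMl// mulr1.
Qed.

Lemma fridman_eq :
  (forall (r : R) f, d < tanh r -> holo Omega D f -> set_inj Omega f ->
     caratheodory_ball D z0 r `<=` f @` Omega -> False) -> fridman Omega D z0 = d.
Proof.
move=> H; have [r0 [r00 r0E hr0]] := fridman_lower.
have upper (x : R) : (exists r : R, [/\ 0 < r, x = tanh r &
    exists f, [/\ holo Omega D f, set_inj Omega f
      & caratheodory_ball D z0 r `<=` f @` Omega]]) -> x <= d.
  move=> [r [_ -> [f [hf inj hb]]]]; rewrite leNgt; apply/negP => dr.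
  exact: H dr hf inj hb.
apply/eqP; rewrite eq_le; apply/andP; split.
  by apply: ge_sup; [exists d, r0|exact: upper].
apply: ub_le_sup; [by exists d; exact: upper|by exists r0].
Qed.

Section Filling.
Context (f : V -> V) (hf : holo Omega D f) (injf : set_inj Omega f) (W : set V)
  (oW : open W) (WLf : W `\` L `<=` f @` Omega).

(** The inverse is chosen pointwise; injectivity of [f] on all of [Omega] forces it to coincide near
    each point with the local inverse that Osgood's theorem provides, which is holomorphic. *)
Lemma filling_inverse : exists g : V -> V, forall y, (W `\` L) y ->
  [/\ Omega (g y), f (g y) = y & hol_at g y].
Proof.
have [g hg] : {g : V -> V & forall y, (W `\` L) y -> Omega (g y) /\ f (g y) = y}.
  apply: (@choice _ _ (fun y x => (W `\` L) y -> Omega x /\ f x = y)) => y.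
  have [/WLf[x Ox fx]|h] := pselect ((W `\` L) y); first by exists x.
  by exists 0 => /h.
exists g => y WLy; have [Og fg] := hg y WLy; split => //.
have [e e0 he] := domain_ball Og.
have hin : hol_in f (g y) e by move=> x /he Ox; case: (holo_hol hf Ox).
have inj x x' : nrm (x - g y) < e -> nrm (x' - g y) < e -> f x = f x' -> x = x'.
  by move=> /he Ox /he Ox'; apply: injf; rewrite inE.
have gg : nrm (g y - g y) < e by rewrite subrr nrm0.
have [g1 [b [b0 _ hg1 g1P]]] := local_inverse e0 hin (osgood hin inj gg).
rewrite fg in hg1 g1P.
apply: (@hol_eq_near _ _ _ _ g1); last by apply: hg1; rewrite subrr nrm0.
have oWL : open (W `\` L).
  by rewrite setDE; apply: openI => //; exact: closed_openC (closed_hole cL).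
have /open_nrm/(_ _ WLy)[c c0 hc] := oWL.
have m0 : 0 < Num.min b c by rewrite lt_min b0.
apply: (near_nrm m0) => y'; rewrite lt_min => /andP[yb /hc /hg[Ogy' fgy']].
have [f1 n1 _] := g1P _ yb.
by apply: injf; rewrite ?inE//; [exact: he|rewrite f1].
Qed.

Lemma cont_scale (T : topologicalType) (a : T -> C) v (t : T) : cont_at a t ->
  cont_at (fun t => a t *: v) t.
Proof.
move=> ca; apply: (@cont_comp _ _ _ a (fun l => l *: v) t) ca _.
by apply: hol_cont; apply: (@hol_ray _ _ _ id); split.
Qed.

Lemma hol_scalel (a : C -> C) v l : hol_at a l -> hol_at (fun l => a l *: v) l.
Proof.
move=> ca; apply: (@hol_comp _ _ _ _ a (fun l => l *: v)) ca _.
by apply: (@hol_ray _ _ _ id); split.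
Qed.

Lemma circle_times_itv (s : R) : 0 <= s ->
  compact [set p : C * R | nrm p.1 = s /\ 0 <= p.2 <= s].
Proof.
move=> s0; rewrite (_ : mkset _ = [set l : C | nrm l = s] `*` `[0, s]%classic).
  by apply: compact_setX; [exact: compact_circle|exact: segment_compact].
by apply/seteqP; split=> -[l t] /=; rewrite in_itv.
Qed.

(* Discs avoiding [L] and shrinking to [Q] lift to [Omega] through [f^-1]; the
   maximum principle confines the lifted centres to a compact part of [Omega],
   so that [Q] would lie in the image of [f]. *)
Lemma no_filling Q v u nu (s : R) : W Q -> L Q -> 0 < s ->
  (forall l (t : R), nrm l <= s -> 0 <= t <= s -> (0 < nrm l) || (0 < t) ->
    ~ L (Q + (l *: v + (l ^+ 2 *: u + t%:C *: nu)))) -> False.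
Proof.
move=> WQ LQ s0 hL; have [g hg] := filling_inverse.
have /open_nrm/(_ _ WQ)[e e0 he] := oW.
pose M := nrm v + nrm u + nrm nu + 1.
have [Mv Mu Mn M1] := sum_bounds (nrm_ge0 v) (nrm_ge0 u) (nrm_ge0 nu).
rewrite -/M in Mv Mu Mn M1.
have M0 : 0 < M by exact: lt_le_trans M1.
(* With [nrm l] and [t] at most [r <= 1], each of the three displacements is at most [r * M], so the
   discs stay in [W]. *)
have [r [r0 rs r1 re]] : exists r : R, [/\ 0 < r, r <= s, r <= 1 & 3 * M * r < e].
  exists (Num.min (Num.min s 1) (e / (4 * M))); split.
  - by rewrite !lt_min s0 ltr01 divr_gt0 ?mulr_gt0.
  - by rewrite !ge_min lexx.
  - by rewrite !ge_min lexx orbT.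
  have : Num.min (Num.min s 1) (e / (4 * M)) <= e / (4 * M) by rewrite !ge_min lexx orbT.
  by rewrite ler_pdivlMr ?mulr_gt0//; lra.
pose Z l (t : R) : V := Q + (l *: v + (l ^+ 2 *: u + t%:C *: nu)).
have ZW l (t : R) : nrm l <= r -> 0 <= t <= r -> W (Z l t).
  move=> lr /andP[t0 tr]; apply: he; rewrite /Z addrC addKr.
  apply: (le_lt_trans (nrmD _ _)); apply: (le_lt_trans (lerD (lexx _) (nrmD _ _))).
  rewrite (nrmZ l v) (nrmZ (l ^+ 2) u) (nrmZ t%:C nu) nrm_pos//.
  have h1 : nrm l * nrm v <= r * M by apply: ler_pM; rewrite ?nrm_ge0.
  have h2 : nrm (l ^+ 2) * nrm u <= r * M.
    apply: ler_pM; rewrite ?nrm_ge0// nrmX expr2 (le_trans _ lr)//.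
    by rewrite ler_piMr ?nrm_ge0// (le_trans lr).
  have h3 : t * nrm nu <= r * M by apply: ler_pM; rewrite ?nrm_ge0.
  apply: le_lt_trans re; rewrite (_ : 3 * M * r = r * M + (r * M + r * M)); last by ring.
  by rewrite lerD// lerD.
have ZWL l (t : R) : nrm l <= r -> 0 <= t <= r -> (0 < nrm l) || (0 < t) -> (W `\` L) (Z l t).
  move=> lr tr lt; split; first exact: ZW.
  apply: hL => //; first exact: le_trans rs.
  by case/andP: tr => t0 tr; rewrite t0 (le_trans tr).
(* Circles of radius [r > 0] avoid [L] even for [t = 0], so compactness in the pair of [l] and [t]
   yields one level [q < 1] for all lifted boundaries. *)
have [q q1 hq] : exists2 q : R, q < 1 & forall l (t : R), nrm l = r -> 0 <= t <= r ->
    rho (g (Z l t)) <= q.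
  have r0' := ltW r0.
  have ne : [set p : C * R | nrm p.1 = r /\ 0 <= p.2 <= r] !=set0.
    have [l lr] := circle_nonempty (R := R) r0'.
    by exists (l, 0) => /=; rewrite lexx r0'.
  have := @compact_EVT_max _ _ (fun p : C * R => rho (g (Z p.1 p.2))) _ ne
    (circle_times_itv r0').
  have inWL (p : C * R) : nrm p.1 = r /\ 0 <= p.2 <= r -> (W `\` L) (Z p.1 p.2).
    by move=> [pr pt]; apply: ZWL; rewrite ?pr// r0.
  case.
    apply: continuous_in_subspaceT => p; rewrite inE => /inWL WLp.
    have [_ _ hgp] := hg _ WLp.
    have c1 : cont_at (fun p : C * R => p.1) p by split; exact: cvg_fst.
    have c2 : cont_at (fun p : C * R => (p.2)%:C : C) p.
      apply: (@cont_comp _ _ _ (fun p : C * R => p.2) (fun x : R => x%:C : C)).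
        by split; exact: cvg_snd.
      by split; exact: real_complex_continuous.
    have c3 : cont_at (fun p : C * R => Z p.1 p.2) p.
      apply: contD; first exact: cont_cst.
      apply: contD; first exact: cont_scale.
      apply: contD; last exact: cont_scale.
      by apply: cont_scale; under eq_fun do rewrite expr2; exact: contM.
    have c4 := cont_comp c3 (hol_cont hgp).
    have c5 : cont_at (fun p : C * R => rho (g (Z p.1 p.2))) p.
      by apply: (cont_comp c4); split; exact: minkowski_continuous.
    by case: c5.
  move=> p; rewrite inE => pr pm; exists (rho (g (Z p.1 p.2))).
    by apply/minkowski_domain => //; case: (hg _ (inWL p pr)).
  by move=> l t lr tr; apply: (pm (l, t)); rewrite inE.
(* For [t > 0] the whole disc avoids [L] and lifts; the maximum principle applies to each of these
   discs with the same [q]. *)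
have center (t : R) : 0 < t -> t <= r -> rho (g (Q + t%:C *: nu)) <= q.
  move=> t0 tr.
  have tI : 0 <= t <= r by rewrite (ltW t0).
  have -> : Q + t%:C *: nu = Z 0 t by rewrite /Z scale0r expr0n/= scale0r !add0r.
  apply: (@max_principle_minkowski R n Omega r (fun l => g (Z l t)) q 0 hO r0).
  - move=> l lr; have [|_ _ hgl] := hg (Z l t); first by apply: ZWL; rewrite ?t0 ?orbT.
    apply: (@hol_comp _ _ _ _ (fun l => Z l t) g) hgl.
    have hc (c : V) : hol_at (fun _ : C => c) l by split; exact: differentiable_cst.
    apply: hol_add (hc Q) _; apply: hol_add.
      by apply: (@hol_scalel id); exact: hol_id.
    apply: hol_add (hc _).
    by apply: (@hol_scalel (fun l => l ^+ 2)); apply: holX; exact: hol_id.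
  - by move=> l lr; apply: hq.
  - by rewrite nrm0 ltW.
have fcenter (t : R) : 0 < t -> t <= r -> f (g (Q + t%:C *: nu)) = Q + t%:C *: nu.
  move=> t0 tr; have -> : Q + t%:C *: nu = Z 0 t by rewrite /Z scale0r expr0n/= scale0r !add0r.
  have [|_ ->//] := hg (Z 0 t); apply: ZWL; rewrite ?nrm0 ?t0 ?orbT ?(ltW r0)//.
  by rewrite (ltW t0).
pose x_ (k : nat) : V := g (Q + (r / k.+1%:R)%:C *: nu).
have tk (k : nat) : 0 < r / k.+1%:R /\ r / k.+1%:R <= r.
  by rewrite divr_gt0// ler_pdivrMr// ler_peMr ?ler1n ?(ltW r0).
have q0 : 0 <= q by apply: le_trans (minkowski_ge0 _ hO) (center r r0 (lexx r)).
(* The lifted centres remain in the compact set [rho <= q], so a cluster point [x] lies in [Omega];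
   continuity of [f] gives [f x = Q], although [f] avoids [L]. *)
have [x [/= xq cx]] : [set w | rho w <= q] `&` cluster (x_ @ \oo) !=set0.
  apply: (compact_minkowski hO q0).
  by exists 0%N => // k _ /=; have [t0 tr] := tk k; exact: center.
have Ox : Omega x by apply/minkowski_domain => //; exact: le_lt_trans q1.
have [hfx Dfx] := holo_hol hf Ox.
suff fxQ : f x = Q by case: Dfx; rewrite fxQ.
apply/eqP; rewrite -subr_eq0 -nrm_eq0 eq_le nrm_ge0 andbT; apply/ler_addgt0Pr => b b0.
rewrite add0r; have b2 : 0 < b / 2 by rewrite divr_gt0.
have [c c0 hc] := cont_eps (hol_cont hfx) b2.
have [_ [[k kA <-] kB]] : ([set x_ k | k in [set k | r / k.+1%:R * nrm nu < b / 2]] `&`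
    [set w | nrm (w - x) < c]) !=set0.
  apply: cx; last by apply/nbhs_nrm; exists c.
  pose N := Num.bound (r * nrm nu / (b / 2)).
  have hN : r * nrm nu / (b / 2) < N%:R.
    apply: archi_boundP; apply: divr_ge0; last exact: ltW.
    by apply: mulr_ge0; [exact: ltW|exact: nrm_ge0].
  exists N => // k /= Nk; exists k => //=.
  move: hN; rewrite ltr_pdivrMr// => hN.
  rewrite mulrAC ltr_pdivrMr// [b / 2 * _]mulrC; apply: (lt_le_trans hN).
  by rewrite ler_pM2r// ler_nat; exact: leq_trans Nk _.
have := hc _ kB; have [t0 tr] := tk k; rewrite /x_ fcenter//.
have := nrmBD (Q + (r / k.+1%:R)%:C *: nu) (f x) Q.
rewrite (nrmBC (f x) (Q + _)) [Q + _ - Q]addrC addKr nrmZ nrm_pos ?(ltW t0)//.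
move=> h1 h2; apply: (le_trans h1); apply: ltW.
by rewrite (splitr b); exact: ltrD h2 kA.
Qed.

End Filling.

End HoleDistance.

(** * Boundary points of [G] and signs of a local defining function *)

Section Hole.
Context {R : realType} {n : nat}.
Local Notation C := R[i].
Local Notation V := 'rV[C]_n.
Implicit Types (y w Q : V) (G U K L : set V) (rho : V -> R).

Lemma sublevel_open (A : set V) (u : V -> R) (t : R) : open A ->
  (forall w, A w -> cont_at u w) -> open [set w | A w /\ u w < t].
Proof.
move=> /open_nrm oA cu; apply/open_nrm => w [Aw uw].
have [/continuous_nrmR c] := cu w Aw.
have e0 : 0 < t - u w by rewrite subr_gt0.
have [d d0 hd] := c _ e0; have [b b0 hb] := oA w Aw.
exists (Num.min d b); first by rewrite lt_min d0.
move=> v; rewrite lt_min => /andP[/hd ud /hb Av]; split; first exact: Av.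
by move: ud; rewrite ltr_norml; move: (u v) (u w) => x y /andP[_]; lra.
Qed.

Lemma boundary_closed G : closed (boundary G).
Proof.
rewrite /boundary setDE; apply: closedI; first exact: closed_closure.
by apply: open_closedC; exact: open_interior.
Qed.

(** Where [rho] is positive it is positive nearby, and there are no points of [G]. In contrapositive
    form this places the discs of [levi_discs] off the hole. *)
Lemma defining_le0 G U rho y : open U -> local_defining_function G U rho -> U y ->
  closure G y -> rho y <= 0.
Proof.
move=> oU [[crho _] GU _] Uy cy; rewrite leNgt; apply/negP => ry.
have /continuous_nrmR/(_ _ ry)[d d0 hd] := crho y Uy.
have /open_nrm/(_ _ Uy)[e e0 he] := oU.
have [w [Gw]] : (G `&` [set w | nrm (w - y) < Num.min d e]) !=set0.
  by apply: cy; apply/nbhs_nrm; exists (Num.min d e); rewrite ?lt_min ?d0.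
rewrite /= lt_min => /andP[/hd wd /he Uw].
have : (G `&` U) w by [].
by rewrite GU => -[_]; move: wd; rewrite ltr_norml => /andP[]; lra.
Qed.

Lemma defining_eq0 G U rho Q : open G -> open U -> local_defining_function G U rho ->
  U Q -> boundary G Q -> rho Q = 0.
Proof.
move=> oG oU hG UQ [cQ nQ].
apply/eqP; rewrite eq_le (defining_le0 oU hG UQ cQ)/= leNgt; apply/negP => rQ.
have [_ GU _] := hG; have [GQ _] : (G `&` U) Q by rewrite GU.
by apply: nQ; exact: open_nbhs_nbhs.
Qed.

(** Points of the open set [G] are off its boundary and accumulate at each boundary point; hence the
    hole has empty interior. *)
Lemma boundary_thin G w (e : R) : open G -> boundary G w -> 0 < e ->
  exists2 v, ~ boundary G v & nrm (v - w) < e.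
Proof.
move=> oG [cw _] e0; have [v [Gv ve]] : (G `&` [set v | nrm (v - w) < e]) !=set0.
  by apply: cw; apply/nbhs_nrm; exists e.
by exists v => // -[_]; apply; exact: open_nbhs_nbhs.
Qed.

End Hole.

Theorem theorem2p7 (R : realType) (n : nat) (Omega G K : set 'rV[R[i]]_n)
    (n_ge2 : (2 <= n)%N)
    (Omega_domain : domain Omega)
    (Omega_bounded : bounded_set Omega)
    (Omega_balanced : balanced Omega)
    (Omega_convex : convex_set Omega)
    (Omega_homogeneous : homogeneous Omega)
    (G_domain : domain G)
    (G_relatively_compact : compact (closure G) /\ closure G `<=` Omega)
    (G_dense : boundary G `<=` closure (pseudoconvex_not_levi_flat G))
    (K_nonempty : K !=set0)
    (K_open : relatively_open K (boundary G))
    (D_connected : connected (Omega `\` closure K)) :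
  forall z, (Omega `\` closure K) z ->
    [/\ squeezing Omega (Omega `\` closure K) z
          = fridman Omega (Omega `\` closure K) z,
        fridman Omega (Omega `\` closure K) z
          = caratheodory_dist Omega (closure K) z
      & exists2 w, closure K w &
          caratheodory_dist Omega (closure K) z
            = etanh (caratheodory Omega z w)].
Proof.
move=> z Dz; have hO : convex_balanced Omega by split.
have [oG _ _] := G_domain; have [cG GO] := G_relatively_compact.
have [V oV KV] := K_open.
have Kb : K `<=` boundary G by rewrite KV => w [].
have Lb : closure K `<=` boundary G.
  by move=> w cw; apply: boundary_closed; exact: closureS cw.
have LG : closure K `<=` closure G by move=> w /Lb[].
have cL : compact (closure K).
  by apply: subclosed_compact cG LG; exact: closed_closure.
have LO : closure K `<=` Omega by move=> w /LG/GO.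
have [Oz Lz] := Dz.
have O0 : Omega 0.
  by rewrite -(scale0r z); apply: Omega_balanced Oz; rewrite normr0 ler01.
have [phi [psi [hphi hpsi phiK psiK]] phiz] := Omega_homogeneous z 0 Oz O0.
have L0 : closure K !=set0 by have [k Kk] := K_nonempty; exists k; exact: subset_closure.
have [w0 Lw0 w0m] := nearest_point hO cL LO hphi L0.
have dist := caratheodory_dist_eq hO n_ge2 LO Dz hphi hpsi phiK psiK phiz Lw0 w0m.
have thin w (e : R) : closure K w -> 0 < e ->
    exists2 v, (Omega `\` closure K) v & nrm (v - w) < e.
  move=> Lw e0; have [r r0 hr] := domain_ball hO (LO _ Lw).
  have m0 : 0 < Num.min e r by rewrite lt_min e0.
  have [v bv] := boundary_thin oG (Lb _ Lw) m0.
  rewrite lt_min => /andP[ve vr]; exists v; last exact: ve.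
  by split; [exact: hr vr|move=> /Lb].
have sq := squeezing_eq hO n_ge2 cL LO D_connected Dz hphi hpsi phiK psiK phiz Lw0 w0m thin.
have fr : fridman Omega (Omega `\` closure K) z = Defs.minkowski Omega (phi w0).
  apply: (fridman_eq hO n_ge2 cL LO D_connected Dz hphi hpsi phiK psiK phiz Lw0 w0m).
  move=> r f dr hf injf hb.
  (* Within [D] this is the Caratheodory ball, by [caratheodory_lt]; since [d < tanh r] it also
     reaches the hole, at [w0]. *)
  pose W := [set w | Omega w /\ Defs.minkowski Omega (phi w) < Defs.tanh r].
  have oW : open W.
    have [oO _ _] := Omega_domain; apply: sublevel_open oO _ => w Ow.
    have [hw _] := holo_hol hphi Ow.
    by apply: (cont_comp (hol_cont hw)); split; exact: minkowski_continuous.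
  have Ww0 : W w0 by split; [exact: LO Lw0|exact: dr].
  have [k [Kk Wk]] : (K `&` W) !=set0 by apply: Lw0; apply: open_nbhs_nbhs; split; [exact: oW|exact: Ww0].
  have [bk Vk] : (boundary G `&` V) k by rewrite -KV.
  (* Density gives a point of positive Levi form near [k]; staying in [V], which cuts [K] out of the
     boundary of [G], it belongs to [K]. *)
  have [Q [levQ [WQ VQ]]] : (pseudoconvex_not_levi_flat G `&` (W `&` V)) !=set0.
    apply: (G_dense _ bk); apply: open_nbhs_nbhs; split; first exact: openI oW oV.
    by split; [exact: Wk|exact: Vk].
  have [bQ [U [rho [oU UQ hG _ [v tv lv]]]]] := levQ.
  have LQ : closure K Q by apply: subset_closure; rewrite KV; split; [exact: bQ|exact: VQ].
  have rQ := defining_eq0 oG oU hG UQ bQ.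
  have [hC _ hd] := hG.
  have [u [nu [s s0 hs]]] := levi_discs oU UQ hC rQ (hd Q UQ) tv lv.
  have WLf : W `\` closure K `<=` f @` Omega.
    move=> w [[Ow wr] Lw]; have Dw : (Omega `\` closure K) w by split; [exact: Ow|exact: Lw].
    apply: hb; split; first exact: Dw.
    by apply: (proj2 (caratheodory_lt hO n_ge2 cL LO D_connected Dz hphi hpsi phiK psiK phiz r Dw)).
  have discs (l : R[i]) (t : R) : nrm l <= s -> 0 <= t <= s -> (0 < nrm l) || (0 < t) ->
      ~ closure K (Q + (l *: v + (l ^+ 2 *: u + t%:C *: nu))).
    move=> ls ts lt /Lb[cZ _]; have [UZ] := hs l t ls ts lt.
    by rewrite ltNge (defining_le0 oU hG UZ cZ).
  exact: (@no_filling R n Omega (closure K) hO cL f hf injf W oW WLf Q v u nu s WQ LQ s0 discs).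
split; first by rewrite sq fr.
- by rewrite fr dist.
exists w0; first exact: Lw0.
rewrite dist.
by rewrite (etanh_caratheodory hO n_ge2 Dz hphi hpsi phiK psiK phiz (LO _ Lw0)).
Qed.
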